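(* Let $\mathbb{F}$ be $\mathbb{R}$ or $\mathbb{C}$, let $G$ be a Lie group over $\mathbb{F}$ with Lie algebra $\mathfrak{g}$, and let $\rho: G\to \mathrm{GL}(\mathbb{V})$ be a representation of $G$ on a finite-dimensional complex vector space $\mathbb{V}$, with differential $d\rho:\mathfrak{g}\to\mathfrak{gl}(\mathbb{V})$. The following are equivalent: (a) $\rho$ is a Cayley representation. (b) There exists an open neighbourhood $N$ of $0\in\mathfrak{g}$ such that $\log(1+d\rho(x))-\log(1-d\rho(x))\in d\rho(\mathfrak{g})$ for any $x\in N$. (c) $d\rho(\mathfrak{g})$ has the power span property. (d) If $a,b\in d\rho(\mathfrak{g})$, then $aba\in d\rho(\mathfrak{g})$. (e) If $a,b,c\in d\rho(\mathfrak{g})$, then $abc+cba\in d\rho(\mathfrak{g})$.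
   Context: A representation of a Lie group $G$ over $\mathbb{F}$ is a homomorphism $\rho: G\to\mathrm{GL}(\mathbb{V})$, $\mathbb{V}$ a finite-dimensional complex vector space, which is smooth if $\mathbb{F}=\mathbb{R}$ and complex analytic if $\mathbb{F}=\mathbb{C}$. The Cayley transform is $C(u)=(1+u)(1-u)^{-1}$, for $u\in\mathfrak{gl}(\mathbb{V})$ with $1-u$ invertible. The representation $\rho$ is a Cayley representation if there is an open neighbourhood $N$ of $0$ in $\mathfrak{g}$ such that $C$ is defined on $d\rho(N)$ and $C(d\rho(N))\subseteq\rho(G)$ (here $\rho(G)$ need not be closed in $\mathrm{GL}(\mathbb{V})$). A linear subspace $\mathbb{W}\subseteq\mathfrak{gl}(\mathbb{V})$ has the power span property if $x^{2k+1}\in\mathbb{W}$ for every $x\in\mathbb{W}$ and every integer $k\ge 0$. Products are products of endomorphisms of $\mathbb{V}$. $\log$ is the matrix logarithm, defined near the identity by its power series. *)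

(* Defs.v *)
From HB Require Import structures.
From mathcomp Require Import all_boot all_order all_algebra.
From mathcomp Require Import complex.
From mathcomp Require Import all_classical all_reals all_analysis.

Set Implicit Arguments.
Unset Strict Implicit.
Unset Printing Implicit Defensive.

Import Order.TTheory GRing.Theory Num.Theory numFieldNormedType.Exports.

Local Open Scope classical_set_scope.
Local Open Scope complex_scope.
Local Open Scope ring_scope.

Variant base_field := BaseR | BaseC.

Definition base_type (R : realType) (F : base_field) : numFieldType :=
  match F with BaseR => (R : numFieldType) | BaseC => (R[i] : numFieldType) end.

Definition partial (R : realType) (m : nat) (s : seq 'I_m)
    (f : 'rV[R]_m -> R) : 'rV[R]_m -> R :=
  foldr (fun i g x => 'D_(delta_mx 0 i) g x) f s.

(* Meant for open U: the partial derivatives at x see f on a neighbourhood of x. *)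
Definition Cinfty (R : realType) (m : nat) (U : set 'rV[R]_m)
    (f : 'rV[R]_m -> R) : Prop :=
  forall (s : seq 'I_m) (x : 'rV[R]_m), U x ->
    {for x, continuous (partial s f)} /\
    forall i : 'I_m, derivable (partial s f) x (delta_mx 0 i).

Definition monomial (R : realType) (m : nat) (c : ('I_m -> nat) -> R[i])
    (h : 'rV[R[i]]_m) (al : 'I_m -> nat) : R[i] :=
  c al * \prod_(i < m) h 0 i ^+ al i.

(* The multi-indices al with |al| = k have all their entries at most k. *)
Definition degree_sum (R : realType) (m : nat) (w : ('I_m -> nat) -> R[i])
    (k : nat) : R[i]^o :=
  \sum_(al : {ffun 'I_m -> 'I_k.+1} | (\sum_(i < m) al i)%N == k)
     w (fun i => al i : nat).

(* f is near every point of U the sum of an absolutely convergent power series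
   in m variables; the terms are grouped by total degree. *)
Definition analytic (R : realType) (m : nat) (U : set 'rV[R[i]]_m)
    (f : 'rV[R[i]]_m -> R[i]) : Prop :=
  forall a, U a -> exists (c : ('I_m -> nat) -> R[i]) (r : R), 0 < r /\
    forall h : 'rV[R[i]]_m, (forall i, `|h 0 i| < r%:C) ->
      cvgn (series (degree_sum (fun al => `|monomial c h al|))) /\
      series (degree_sum (monomial c h)) @ \oo --> (f (a + h) : R[i]^o).

Definition smooth_fun (R : realType) (F : base_field) (m : nat) :
    set 'rV[base_type R F]_m -> ('rV[base_type R F]_m -> base_type R F) -> Prop :=
  match F with BaseR => @Cinfty R m | BaseC => @analytic R m end.

Definition smooth_map (R : realType) (F : base_field) (m n : nat)
    (U : set 'rV[base_type R F]_m)
    (f : 'rV[base_type R F]_m -> 'rV[base_type R F]_n) : Prop :=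
  forall j, smooth_fun U (fun x => f x 0 j).

Definition smooth_cfun (R : realType) (F : base_field) (m : nat) :
    set 'rV[base_type R F]_m -> ('rV[base_type R F]_m -> R[i]) -> Prop :=
  match F with
  | BaseR => fun U f => Cinfty U (fun x => complex.Re (f x)) /\
                        Cinfty U (fun x => complex.Im (f x))
  | BaseC => @analytic R m
  end.

(* The derivative at a in the direction v of a complex-valued function. *)
Definition cderive (R : realType) (F : base_field) (m : nat) :
    ('rV[base_type R F]_m -> R[i]) ->
    'rV[base_type R F]_m -> 'rV[base_type R F]_m -> R[i] :=
  match F with
  | BaseR => fun f a v => 'D_v (fun x : 'rV[R]_m => complex.Re (f x)) a +i*
                          'D_v (fun x : 'rV[R]_m => complex.Im (f x)) a
  | BaseC => fun f a v => 'D_v (f : 'rV[R[i]]_m -> R[i]^o) a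
  end.

(* No compatibility is required here; it is part of [lieGroup]. *)
#[short(type="topGroupType")]
HB.structure Definition TopGroup := {G of Group G & Topological G}.

Record chart (R : realType) (F : base_field) (d : nat) (M : topologicalType) :=
  Chart {
    chart_dom : set M;
    chart_map :> M -> 'rV[base_type R F]_d;
    chart_inv : 'rV[base_type R F]_d -> M;
    chart_dom_open : open chart_dom;
    chart_im_open : open (chart_map @` chart_dom);
    chart_mapK : forall p, chart_dom p -> chart_inv (chart_map p) = p;
    chart_map_continuous : forall p, chart_dom p -> {for p, continuous chart_map};
    chart_inv_continuous :
      forall x, (chart_map @` chart_dom) x -> {for x, continuous chart_inv}
  }.

Definition chart_im (R : realType) (F : base_field) (d : nat)
    (M : topologicalType) (c : chart R F d M) : set 'rV[base_type R F]_d :=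
  c @` chart_dom c.

Record manifold (R : realType) (F : base_field) (d : nat)
    (M : topologicalType) := Manifold {
  atlas : set (chart R F d M);
  manifold_hausdorff : hausdorff_space M;
  manifold_second_countable : @second_countable M;
  atlas_cover : forall p : M, exists2 c, atlas c & chart_dom c p;
  atlas_compatible : forall c1 c2, atlas c1 -> atlas c2 ->
    smooth_map (c1 @` (chart_dom c1 `&` chart_dom c2)) (c2 \o chart_inv c1)
}.

Record lieGroup (R : realType) (F : base_field) := LieGroup {
  lie_sort :> topGroupType;
  lie_dim : nat;
  lie_manifold : manifold R F lie_dim lie_sort;
  lie_mul_continuous :
    continuous (fun p : lie_sort * lie_sort => (p.1 * p.2)%g);
  lie_inv_continuous : continuous (fun g : lie_sort => g^-1%g);
  lie_mul_smooth : forall c1 c2 c3,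
    atlas lie_manifold c1 -> atlas lie_manifold c2 -> atlas lie_manifold c3 ->
    let mul_loc (z : 'rV_(lie_dim + lie_dim)) :=
      (chart_inv c1 (lsubmx z) * chart_inv c2 (rsubmx z))%g in
    smooth_map [set z | [/\ chart_im c1 (lsubmx z), chart_im c2 (rsubmx z)
                          & chart_dom c3 (mul_loc z)]]
               (c3 \o mul_loc);
  lie_inv_smooth : forall c1 c2,
    atlas lie_manifold c1 -> atlas lie_manifold c2 ->
    let inv_loc x := (chart_inv c1 x)^-1%g in
    smooth_map [set x | chart_im c1 x /\ chart_dom c2 (inv_loc x)]
               (c2 \o inv_loc)
}.

Definition ecoord (R : realType) (V : vectType R[i])
    (j : 'I_(\dim {: 'End(V)})) (u : 'End(V)) : R[i] :=
  coord (vbasis {: 'End(V)}) j u.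

(* The values of rho are invertible, since rho 1 = 1 and rho is multiplicative.
   The coordinates of the complex vector space 'End(V) in a basis define its
   topology and smooth structure, which do not depend on the basis. *)
Definition representation (R : realType) (F : base_field) (G : lieGroup R F)
    (V : vectType R[i]) (rho : G -> 'End(V)) : Prop :=
  [/\ rho 1%g = \1%VF,
      forall g h : G, rho (g * h)%g = (rho g \o rho h)%VF
    & forall c, atlas (lie_manifold G) c ->
        forall j, smooth_cfun (chart_im c)
                              (fun x => ecoord j (rho (chart_inv c x)))].

Definition chart_at_1 (R : realType) (F : base_field) (G : lieGroup R F)
    (c : chart R F (lie_dim G) G) : Prop :=
  atlas (lie_manifold G) c /\ chart_dom c 1%g.

(* A chart c at 1 identifies the Lie algebra T_1 G with the space 'rV_(lie_dim G)
   of tangent vectors in the coordinates c; [differential rho c] is the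
   differential of rho at 1 under this identification. *)
Definition differential (R : realType) (F : base_field) (G : lieGroup R F)
    (V : vectType R[i]) (rho : G -> 'End(V)) (c : chart R F (lie_dim G) G)
    (x : 'rV[base_type R F]_(lie_dim G)) : 'End(V) :=
  \sum_j cderive (fun y => ecoord j (rho (chart_inv c y))) (c 1%g) x
           *: (vbasis {: 'End(V)})`_j.

Definition endo_exp (K : fieldType) (V : vectType K) (f : 'End(V)) (n : nat) :
    'End(V) :=
  iter n (fun g => f \o g)%VF \1%VF.

Definition endo_invertible (K : fieldType) (V : vectType K) (f : 'End(V)) :=
  lker f == 0%VS.

Definition cayley (K : fieldType) (V : vectType K) (u : 'End(V)) : 'End(V) :=
  ((\1 + u) \o (\1 - u)^-1)%VF.

Definition cayley_representation (R : realType) (F : base_field)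
    (G : lieGroup R F) (V : vectType R[i]) (rho : G -> 'End(V))
    (c : chart R F (lie_dim G) G) : Prop :=
  exists N : set 'rV[base_type R F]_(lie_dim G), [/\ open N, N 0 &
    forall x, N x ->
      endo_invertible (\1 - differential rho c x)%VF /\
      range rho (cayley (differential rho c x))].

(* The power series of log at f converges to l. *)
Definition is_log (R : realType) (V : vectType R[i]) (f l : 'End(V)) : Prop :=
  let log_sum :=
    series (fun k => ((-1) ^+ k / k.+1%:R) *: endo_exp (f - \1%VF) k.+1) in
  forall j, ecoord j (log_sum n) @[n --> \oo] --> (ecoord j l : R[i]^o).

Definition log_condition (R : realType) (F : base_field)
    (G : lieGroup R F) (V : vectType R[i]) (rho : G -> 'End(V))
    (c : chart R F (lie_dim G) G) : Prop :=
  exists N : set 'rV[base_type R F]_(lie_dim G), [/\ open N, N 0 &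
    forall x, N x -> exists l1 l2,
      [/\ is_log (\1 + differential rho c x)%VF l1,
          is_log (\1 - differential rho c x)%VF l2
        & range (differential rho c) (l1 - l2)]].

Definition power_span (K : fieldType) (V : vectType K) (W : set 'End(V)) :=
  forall x, W x -> forall k, W (endo_exp x (2 * k + 1)).

(* Main.v *)
Require Import Defs.
From HB Require Import structures.
From mathcomp Require Import all_boot all_order all_algebra.
From mathcomp Require Import complex ring lra.
From mathcomp Require Import all_classical all_reals all_analysis.
(** The differential of rho has image W, and (a) compares W with the image of
    rho, which need not be closed. Choosing a complement E of the kernel of the
    differential in a chart at 1, the restriction F of rho to a small ball of E is
    an injective immersion whose tangent space at F z is W (F z). A curve q with
    q' = w(t) q and w(t) in W that starts at 1 stays in the image of F: the
    distance from q to F grows at rate at most a constant times itself. Applied to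
    q(t) = rho (t x) this gives that rho maps a neighbourhood of 1 into the image
    of F; applied to the Cayley transform q(t) = C(t u), for which
    q' = 2 u (1 - t^2 u^2)^-1 q, it gives (c) => (a). Conversely, if C(t u) lies
    in the image of rho for all small t, then by Baire's theorem it lies in one
    translate of the image of F for t in some interval, whence
    u (1 - t^2 u^2)^-1 belongs to W; letting t tend to 0 all the odd powers of u
    belong to W. The same coefficient extraction treats the logarithms in (b).
    For (c) => (d), subtract [a, [a, b]] from the polarized cube. All estimates
    are made with real matrices, on which End V acts by right multiplication; a
    complex chart is used through its real and imaginary coordinates. *)

Set Implicit Arguments.
Unset Strict Implicit.
Unset Printing Implicit Defensive.

Import Order.TTheory GRing.Theory Num.Theory numFieldNormedType.Exports.

Local Open Scope classical_set_scope.
Local Open Scope complex_scope.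
Local Open Scope ring_scope.

(** * Norms of matrices *)

(** The obstacle is that the image of rho may be dense in a larger group: a curve of matrices lying
    in it has no evident continuous lift to G, and no closed subgroup theorem applies. What is
    closed is the image under F of a compact parameter ball; since G is second countable, countably
    many translates of that piece cover the image of rho, as Baire's theorem requires. In the other
    direction, a curve tangent to the right-invariant distribution p -> W p has to stay in the leaf
    through 1. Frobenius, or the exponential map with uniqueness for differential equations, would
    give this; following the curve inside F by a supremum argument needs neither, nor an inverse
    function theorem: strict differentiability at 1 makes F bi-Lipschitz, and invertibility of
    matrices close to 1 makes its tangent spaces full. Endomorphisms are read in the regular
    representation on End V, which is faithful because End V contains the identity; products,
    resolvents and logarithms become matrix computations over the reals. *)

Lemma mx_norm_lub (K : numFieldType) m n (A : 'M[K]_(m, n)) (c : K) :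
  0 <= c -> (forall i j, `|A i j| <= c) -> `|A| <= c.
Proof.
move=> c0 Ac; rewrite /Num.norm /= mx_normE.
have -> : c = (NngNum c0)%:num by [].
rewrite num_le; apply/bigmax_leP; split=> [|[i j] _]; first by rewrite -num_le.
by rewrite -num_le /=; exact: Ac.
Qed.

Lemma mx_norm_entry (K : numFieldType) m n (A : 'M[K]_(m, n)) i j :
  `|A i j| <= `|A|.
Proof.
rewrite [leRHS]/Num.norm /= mx_normE.
have -> : `|A i j| = (`|A i j|%:nng)%:num by [].
rewrite num_le.
exact: (le_bigmax _ (fun ij : 'I_m * 'I_n => `|A ij.1 ij.2|%:nng) (i, j)).
Qed.

Lemma mx_norm_mul (K : numFieldType) m n p (A : 'M[K]_(m, n)) (B : 'M[K]_(n, p)) :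
  `|A *m B| <= n%:R * `|A| * `|B|.
Proof.
apply: mx_norm_lub => [|i j]; first by rewrite !mulr_ge0.
rewrite mxE (le_trans (ler_norm_sum _ _ _))//.
rewrite -mulrA mulr_natl -[X in _ *+ X]card_ord -sumr_const.
apply: ler_sum => k _; rewrite normrM.
by apply: ler_pM => //; exact: mx_norm_entry.
Qed.

Lemma linear_bound (R : realType) (Y : normedModType R) m n
    (L : {linear 'M[R]_(m, n) -> Y}) :
  exists2 C, 0 < C & forall A, `|L A| <= C * `|A|.
Proof.
pose C := \sum_i \sum_j `|L (delta_mx i j)|.
have C0 : 0 <= C by do 2!apply: sumr_ge0 => ? _.
exists (C + 1); first by rewrite ltr_wpDl.
move=> A; rewrite {1}[A]matrix_sum_delta linear_sum.
apply: (@le_trans _ _ (C * `|A|)); last by rewrite ler_wpM2r// lerDl.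
rewrite (le_trans (ler_norm_sum _ _ _))// mulr_suml; apply: ler_sum => i _.
rewrite linear_sum (le_trans (ler_norm_sum _ _ _))// mulr_suml.
apply: ler_sum => j _. rewrite linearZ normrZ mulrC.
by rewrite ler_wpM2l// mx_norm_entry.
Qed.

Lemma mulmx_bound (R : realType) m n p (B : 'M[R]_(n, p)) :
  exists2 C, 0 < C & forall A : 'M[R]_(m, n), `|A *m B| <= C * `|A|.
Proof. exact: (linear_bound (mulmxr B)). Qed.

Section perturbation.
Variables (R : realType) (N : nat).
Local Notation K0 := (N.+1%:R : R).

(** The entrywise maximum norm is submultiplicative only up to the size of the matrices. The
    constant [K0] is [N.+1] rather than [N] so that it is positive also when [N] is 0. *)
Lemma norm_mxM m p (A : 'M[R]_(m, N)) (B : 'M[R]_(N, p)) :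
  `|A *m B| <= K0 * `|A| * `|B|.
Proof.
rewrite (le_trans (mx_norm_mul _ _))// -!mulrA ler_wpM2r ?mulr_ge0//.
by rewrite ler_nat.
Qed.

Lemma norm_mxM3 (A B E : 'M[R]_N) (a b e : R) :
  `|A| <= a -> `|B| <= b -> `|E| <= e ->
  `|A *m B *m E| <= K0 * K0 * (a * b * e).
Proof.
have K00 : 0 < K0 by rewrite ltr0n.
move=> Aa Bb Ee.
have a0 := le_trans (normr_ge0 _) Aa; have b0 := le_trans (normr_ge0 _) Bb.
have -> : K0 * K0 * (a * b * e) = K0 * (K0 * a * b) * e by ring.
rewrite (le_trans (norm_mxM _ _))//; apply: ler_pM => //.
rewrite ler_pM2l// (le_trans (norm_mxM _ _))//; apply: ler_pM => //.
by rewrite ler_pM2l.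
Qed.

Lemma norm_mx1 : `|1%:M : 'M[R]_N| <= 1.
Proof.
by apply: mx_norm_lub => // i j; rewrite mxE; case: eqP; rewrite ?normr1 ?normr0.
Qed.

Lemma unitmx_of_kernel (k : nat) (A : 'M[R]_k) :
  (forall v : 'rV[R]_k, v *m A = 0 -> v = 0) -> A \in unitmx.
Proof.
move=> A0; rewrite -row_free_unit -kermx_eq0; apply/eqP/row_matrixP => i.
by rewrite row0; apply: A0; rewrite -row_mul mulmx_ker row0.
Qed.

(** No Neumann series: if [v *m A = B] then [v = B + v *m (1%:M - A)], and the last term has at most
    half the norm of [v]. Hence |v| <= 2 |B|, which gives both the injectivity of [A] and the bound
    on its inverse. *)
Lemma near1_inverse (A : 'M[R]_N) : K0 * `|1%:M - A| <= 2^-1 ->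
  exists B, [/\ A *m B = 1%:M, B *m A = 1%:M, `|B| <= 2
              & `|B - 1%:M| <= 2 * (K0 * `|1%:M - A|)].
Proof.
set t := K0 * _ => t2.
have t0 : 0 <= t by rewrite mulr_ge0.
have bnd p (v : 'M[R]_(p, N)) (B : 'M[R]_(p, N)) : v *m A = B -> `|v| <= 2 * `|B|.
  move=> vA; have -> : v = B + v *m (1%:M - A).
    by rewrite mulmxBr mulmx1 vA addrC subrK.
  rewrite -[X in `|X + _|]vA -[X in _ <= 2 * `|X|]vA.
  have := norm_mxM v (1%:M - A).
  have -> : v *m A + v *m (1%:M - A) = v by rewrite -mulmxDr addrC subrK mulmx1.
  rewrite mulrAC -/t => h.
  have := ler_normD (v *m A) (v *m (1%:M - A)).
  rewrite -mulmxDr addrC subrK mulmx1.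
  have : t * `|v| <= 2^-1 * `|v| by rewrite ler_wpM2r.
  lra.
have Au : A \in unitmx.
  apply: unitmx_of_kernel => v /bnd; rewrite normr0 mulr0 => v0.
  by apply/eqP; rewrite -normr_le0.
have iA := mulVmx Au; have B2 : `|invmx A| <= 2.
  rewrite (le_trans (bnd _ _ _ iA))//.
  by rewrite -[leRHS]mulr1 ler_wpM2l ?norm_mx1.
exists (invmx A); split => //; first exact: mulmxV.
have -> : invmx A - 1%:M = invmx A *m (1%:M - A) by rewrite mulmxBr mulmx1 iA.
rewrite (le_trans (norm_mxM _ _))// mulrAC mulrC -/t ler_wpM2r//.
Qed.

End perturbation.

(** * Limits in images of linear maps and of compact balls *)

Section closed_range.
Variables (R : realType) (D m n : nat) (L : {linear 'rV[R]_D -> 'M[R]_(m, n)}).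

(** The image is cut out by the linear equations [cokermx Lam], which are bounded and so pass to
    limits. Memberships in W obtained by approximation go through this lemma. *)
Lemma range_closure (v : 'M[R]_(m, n)) :
  (forall e, 0 < e -> exists2 A, range L A & `|A - v| <= e) -> range L v.
Proof.
move=> vcl; pose Lam := lin1_mx (mxvec \o L).
have LamE x : x *m Lam = mxvec (L x) by rewrite mul_rV_lin1.
suff /submxP[x xv] : (mxvec v <= Lam)%MS.
  by exists x => //; apply: (can_inj mxvecK); rewrite -LamE xv.
rewrite submxE; apply/eqP.
pose f := [the {linear _ -> _} of mulmxr (cokermx Lam) \o (@mxvec R m n)].
have [C C0 fC] := linear_bound f.
apply/eqP; rewrite -normr_le0 -/(f v); apply/ler_addgt0Pr => e e0.
have [_ [x _ <-]] := vcl (e / C) (divr_gt0 e0 C0); rewrite ler_pdivlMr// mulrC.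
rewrite add0r => h; apply: le_trans h; rewrite -normrN.
have <- : f (L x - v) = - f v.
  rewrite raddfB /= -[RHS]sub0r; congr (_ - _).
  by rewrite -LamE -mulmxA mulmx_coker mulmx0.
exact: fC.
Qed.

End closed_range.

Section compact_ball.
Variables (R : realType) (k : nat) (Y : normedModType R) (F : 'rV[R]_k -> Y).
Variables (r C : R).
Hypothesis r0 : 0 <= r.
Hypothesis FC : forall z z', `|z| <= r -> `|z'| <= r -> `|F z - F z'| <= C * `|z - z'|.

(** The distance to [A] is continuous on a compact ball, so its minimum is attained. This is the
    substitute for closedness of the image of rho. *)
Lemma lipschitz_ball_attained (A : Y) (b : R) :
  (forall e, 0 < e -> exists2 z, `|z| <= r & `|A - F z| <= b + e) ->
  exists2 z, `|z| <= r & `|A - F z| <= b.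
Proof.
move=> h; pose f z := `|A - F z|; pose B := [set z : 'rV[R]_k | `|z| <= r].
have cB : compact B.
  apply: bounded_closed_compact.
    by exists r; split; [exact: num_real|move=> M rM z zr; exact: le_trans zr (ltW rM)].
  apply: (@closed_comp _ _ (fun z : 'rV[R]_k => `|z|) [set x | x <= r]).
    by move=> z _; exact: norm_continuous.
  exact: closed_le.
have cf : {within B, continuous f}.
  apply/subspace_continuousP => z zB.
  apply/cvgrPdist_le => /= e e0; rewrite near_withinE; near=> x => xB.
  apply: (le_trans (ler_dist_dist _ _)).
  rewrite opprB addrC subrKA (le_trans (FC xB zB))//.
  have C1 : 0 < `|C| + 1 by rewrite ltr_wpDl.
  apply: (@le_trans _ _ ((`|C| + 1) * `|x - z|)).
    by rewrite ler_wpM2r// (le_trans (ler_norm _))// lerDl.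
  rewrite mulrC -ler_pdivlMr// distrC.
  by near: x; apply: cvgr_dist_le => //; rewrite divr_gt0.
have [|c cBc cmin] := EVT_min_rV _ cB cf.
  by exists 0; rewrite /B /= normr0.
rewrite inE in cBc; exists c => //; apply/ler_addgt0Pr => e e0.
have [z zr zb] := h e e0.
by apply: le_trans zb; apply: cmin; rewrite inE.
Unshelve. all: by end_near. Qed.

End compact_ball.

(** * Strict differentiability and transversal charts *)

(** Both points move, unlike in [frechet]. When [L] is injective this yields a lower Lipschitz bound
    for [f] near [a], and it controls the derivatives at neighbouring points. *)
Definition strict_diff (R : realType) (X Y : normedModType R) (f L : X -> Y)
    (a : X) :=
  forall e : R, 0 < e -> exists2 d : R, 0 < d &
    forall x y, `|x - a| < d -> `|y - a| < d ->
      `|f x - f y - L (x - y)| <= e * `|x - y|.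

Definition frechet (R : realType) (X Y : normedModType R) (f L : X -> Y)
    (a : X) :=
  forall e : R, 0 < e -> exists2 d : R, 0 < d &
    forall x, `|x - a| < d -> `|f x - f a - L (x - a)| <= e * `|x - a|.

Section differentials.
Variables (R : realType) (D D' : nat) (Y : normedModType R).

Lemma strict_diff_frechet (X : normedModType R) (f L : X -> Y) a :
  strict_diff f L a -> frechet f L a.
Proof.
move=> h e e0; have [d d0 hd] := h e e0; exists d => // x xa.
by apply: hd; rewrite // subrr normr0.
Qed.

Lemma strict_diff_mulmx (f : 'rV[R]_D -> Y) (L : {linear 'rV[R]_D -> Y})
    (B : 'M[R]_(D', D)) :
  strict_diff f L 0 -> strict_diff (f \o mulmxr B) (L \o mulmxr B) 0.
Proof.
move=> h e e0; have [C C0 CB] := mulmx_bound 1 B.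
have [d d0 hd] := h (e / C) (divr_gt0 e0 C0).
exists (d / C); first exact: divr_gt0.
move=> x y; rewrite !subr0 !ltr_pdivlMr// => xd yd.
have lt (z : 'rV[R]_D') : `|z| * C < d -> `|z *m B - 0| < d.
  rewrite subr0; apply: le_lt_trans; rewrite mulrC; exact: CB.
have := hd _ _ (lt _ xd) (lt _ yd); rewrite /= -mulmxBl => /le_trans; apply.
rewrite mulrAC -mulrA ler_wpM2l ?(ltW e0)// ler_pdivrMr// mulrC.
exact: CB.
Qed.

Lemma frechet_mulmx (f : 'rV[R]_D -> Y) (L : {linear 'rV[R]_D -> Y})
    (B : 'M[R]_(D', D)) a :
  frechet f L (a *m B) -> frechet (f \o mulmxr B) (L \o mulmxr B) a.
Proof.
move=> h e e0; have [C C0 CB] := mulmx_bound 1 B.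
have [d d0 hd] := h (e / C) (divr_gt0 e0 C0).
exists (d / C); first exact: divr_gt0.
move=> x; rewrite !ltr_pdivlMr// => xd.
have lt : `|x *m B - a *m B| < d.
  by rewrite -mulmxBl; apply: le_lt_trans xd; rewrite mulrC; exact: CB.
have := hd _ lt; rewrite /= -mulmxBl => /le_trans; apply.
rewrite mulrAC -mulrA ler_wpM2l ?(ltW e0)// ler_pdivrMr// mulrC.
exact: CB.
Qed.

Lemma frechet_ray (f : 'rV[R]_D -> Y) (L : {linear 'rV[R]_D -> Y}) a v :
  frechet f L a -> forall e : R, 0 < e -> exists2 d : R, 0 < d &
    forall s, `|s| < d -> `|f (a + s *: v) - f a - s *: L v| <= e * `|s|.
Proof.
move=> h e e0; have v0 : 0 < `|v| + 1 by rewrite ltr_wpDl.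
have [d d0 hd] := h (e / (`|v| + 1)) (divr_gt0 e0 v0).
exists (d / (`|v| + 1)); first exact: divr_gt0.
move=> s; rewrite ltr_pdivlMr// => sd.
have := hd (a + s *: v); rewrite addrC addKr linearZ /= normrZ => h1.
have /h1 : `|s| * `|v| < d by apply: le_lt_trans sd; rewrite ler_wpM2l// lerDl.
move=> /le_trans; apply; rewrite mulrAC -mulrA ler_wpM2l ?(ltW e0)//.
by rewrite ler_pdivrMr// ler_wpM2l// lerDl.
Qed.

(** Both linear maps approximate the same increment [f (z + s *: v) - f z], each up to
    [e * s * |v|]; dividing by [s] gives the factor 2. *)
Lemma strict_diff_frechet_near (f : 'rV[R]_D -> Y) (L L' : {linear 'rV[R]_D -> Y})
    a z (e d : R) :
  (forall x y, `|x - a| < d -> `|y - a| < d ->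
      `|f x - f y - L (x - y)| <= e * `|x - y|) -> 0 < e ->
  `|z - a| < d -> frechet f L' z -> forall v, `|L' v - L v| <= 2 * e * `|v|.
Proof.
move=> h e0 zd h' v.
  have [->|v0] := eqVneq v 0.
    by rewrite (linear0 L) (linear0 L') subr0 !normr0 mulr0.
have v0' : 0 < `|v| by rewrite normr_gt0.
have [d' d'0 hd'] := frechet_ray v h' (mulr_gt0 e0 v0').
pose s := Num.min (d' / 2) ((d - `|z - a|) / (2 * `|v|)).
have dz : 0 < d - `|z - a| by rewrite subr_gt0.
have s0 : 0 < s by rewrite lt_min !divr_gt0// mulr_gt0.
have sd' : `|s| < d'.
  rewrite gtr0_norm// (@le_lt_trans _ _ (d' / 2))//; last by lra.
  by rewrite ge_min lexx.
have sv : s * `|v| < d - `|z - a|.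
  apply: (@le_lt_trans _ _ ((d - `|z - a|) / 2)); last by lra.
  have : s <= (d - `|z - a|) / (2 * `|v|) by rewrite ge_min lexx orbT.
  by rewrite invfM mulrA ler_pdivlMr.
have h1 := hd' s sd'.
have := h (z + s *: v) z; rewrite addrAC => /(_ _ zd).
have -> : `|z - a + s *: v| < d.
  rewrite (le_lt_trans (ler_normD _ _))// normrZ gtr0_norm//; lra.
have -> : z + s *: v - z = s *: v by rewrite addrC addKr.
move=> /(_ isT); rewrite linearZ /= normrZ => h2.
have : `|s *: (L' v - L v)| <= s * (2 * e * `|v|).
  have -> : s *: (L' v - L v) = (f (z + s *: v) - f z - s *: L v)
     - (f (z + s *: v) - f z - s *: L' v).
    by rewrite scalerBr opprB [RHS]addrC subrKA.
  rewrite (le_trans (ler_normB _ _))//.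
  move: h1 h2; rewrite !(gtr0_norm s0) => h1 h2.
  lra.
by rewrite normrZ gtr0_norm// ler_pM2l.
Qed.

End differentials.

Section transversal.
Variables (R : realType) (N D : nat) (H : 'rV[R]_D -> 'M[R]_N).
Variable L : {linear 'rV[R]_D -> 'M[R]_N}.
Hypothesis H0 : H 0 = 1%:M.
Hypothesis Hs : strict_diff H L 0.
Hypothesis Hl : exists2 r : R, 0 < r & forall x, `|x| < r ->
  exists2 Lx : {linear 'rV[R]_D -> 'M[R]_N}, frechet H Lx x &
    forall v, exists2 w, range L w & Lx v = w *m H x.
Local Notation K0 := (N.+1%:R : R).

(** A parametrization near 1 of the leaf of the distribution p -> W p: bi-Lipschitz, with tangent
    space at [F z] equal to W (F z), in both inclusions. The bound on [1%:M - F z] makes [F z]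
    invertible through [near1_inverse]. *)
Definition transversal_chart k (F : 'rV[R]_k -> 'M[R]_N)
    (LE : {linear 'rV[R]_k -> 'M[R]_N}) (r c C : R) :=
  [/\ [/\ 0 < r, 0 < c & 0 < C], F 0 = 1%:M /\ strict_diff F LE 0,
   forall v, range L (LE v),
   forall z z', `|z| <= r -> `|z'| <= r ->
     c * `|z - z'| <= `|F z - F z'| <= C * `|z - z'|
  & forall z, `|z| <= r -> (K0 * `|1%:M - F z| <= 2^-1) /\
     exists Lz : {linear 'rV[R]_k -> 'M[R]_N}, [/\ frechet F Lz z,
       forall v, exists2 w, range L w & Lz v = w *m F z &
       forall w, range L w -> exists v, Lz v = w *m F z]].

Lemma exists_transversal_chart : exists k (B : 'M[R]_(k, D))
  (LE : {linear 'rV[R]_k -> 'M[R]_N}) r c C,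
  transversal_chart (H \o mulmxr B) LE r c C.
Proof.
pose Lam := lin1_mx (mxvec \o L).
have LamE x : x *m Lam = mxvec (L x) by rewrite mul_rV_lin1.
pose k := \rank Lam; pose P := row_base Lam.
(* The rows of [B] are preimages of a basis of W, so they span a complement of the kernel of [L];
   [LE] is then injective with image W, and [ell] inverts it. *)
pose B : 'M[R]_(k, D) := P *m pinvmx Lam.
have BLam : B *m Lam = P by rewrite mulmxKpV// eq_row_base.
pose LE := [the {linear _ -> _} of L \o mulmxr B].
pose ell := [the {linear 'M[R]_N -> 'rV[R]_k} of mulmxr (pinvmx P) \o mxvec].
have LEE v : mxvec (LE v) = v *m P by rewrite /= -LamE -mulmxA BLam.
have ellLE v : ell (LE v) = v.
  by rewrite /= -/(mxvec (LE v)) LEE mulmxKp// row_base_free.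
have LEell w : range L w -> LE (ell w) = w.
  move=> [x _ <-]; apply: (can_inj mxvecK); rewrite LEE /= mulmxKpV//.
  by rewrite eq_row_base -LamE submxMl.
have [Cl Cl0 Clb] := linear_bound ell.
have [CE CE0 CEb] := linear_bound LE.
pose F := H \o mulmxr B.
have Fs : strict_diff F LE 0 by exact: strict_diff_mulmx.
have [r0 r00 Hr0] := Hl.
have [CB CB0 CBb] := mulmx_bound 1 B.
have K00 : 0 < K0 by rewrite ltr0n.
(* With [e <= (8 * Cl)^-1] the strict error costs |z - z'| / 8 in the lower bound, which leaves room
   for the constant [(2 * Cl)^-1]. With [e <= 2^-1] nearby derivatives are bounded by [CE + 1]. *)
pose e : R := Num.min 2^-1 (8 * Cl)^-1.
have e0 : 0 < e by rewrite lt_min !invr_gt0 !mulr_gt0// ltr0n.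
have e2 : e <= 2^-1 by rewrite ge_min lexx.
have eCl : Cl * e <= 8^-1.
  have : e <= (8 * Cl)^-1 by rewrite ge_min lexx orbT.
  by rewrite invfM ler_pdivlMr// mulrC.
have [d d0 hd] := Fs e e0.
pose C := CE + e.
have C0 : 0 < C by rewrite addr_gt0.
have Fub z z' : `|z| < d -> `|z'| < d -> `|F z - F z'| <= C * `|z - z'|.
  move=> zd z'd; have := hd z z'; rewrite !subr0 => /(_ zd z'd) h.
  rewrite -[F z - F z'](subrK (LE (z - z'))) (le_trans (ler_normD _ _))//.
  by rewrite mulrDl addrC lerD.
have Flb z z' : `|z| < d -> `|z'| < d -> (2 * Cl)^-1 * `|z - z'| <= `|F z - F z'|.
  move=> zd z'd; have := hd z z'; rewrite !subr0 => /(_ zd z'd) h.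
  have h1 : `|z - z'| <= Cl * `|LE (z - z')|.
    by rewrite -{1}[z - z']ellLE; exact: Clb.
  have h2 : `|LE (z - z')| <= `|F z - F z'| + e * `|z - z'|.
    rewrite -lerBlDl (le_trans _ h)// (le_trans (lerB_dist _ _))//.
    by rewrite distrC.
  rewrite mulrC ler_pdivrMr ?mulr_gt0//.
  have : Cl * `|LE (z - z')| <= Cl * `|F z - F z'| + 8^-1 * `|z - z'|.
    apply: (le_trans (ler_wpM2l (ltW Cl0) h2)).
    by rewrite mulrDr lerD2l mulrA ler_wpM2r.
  by have := normr_ge0 (z - z'); lra.
have F0 : F 0 = 1%:M by rewrite /F /= mul0mx.
(* [eta] bounds [K0 * |1 - F z|], hence the inverse of [F z] is within [2 * eta] of 1; the constant
   turns this into an error of 1/8 on [M] below. *)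
pose eta := Num.min 2^-1 (16 * Cl * K0 * (CE + 1))^-1.
have CEK : 0 < 16 * Cl * K0 * (CE + 1) by rewrite !mulr_gt0 ?addr_gt0// ltr0n.
have eta0 : 0 < eta by rewrite lt_min !invr_gt0 CEK ltr0n.
have eta2 : eta <= 2^-1 by rewrite ge_min lexx.
have etaK : Cl * K0 * (CE + 1) * (2 * eta) <= 8^-1.
  have : eta <= (16 * Cl * K0 * (CE + 1))^-1 by rewrite ge_min lexx orbT.
  by rewrite -(ler_pM2l CEK) mulfV ?gt_eqF//; lra.
pose r := Num.min (d / 2) (Num.min (r0 / (2 * CB)) (eta / (K0 * C))).
have r_gt0 : 0 < r by rewrite !lt_min !divr_gt0 ?mulr_gt0.
have rd (z : 'rV[R]_k) : `|z| <= r -> `|z| < d.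
  move=> /le_lt_trans; apply; rewrite (@le_lt_trans _ _ (d / 2))//; last by lra.
  by rewrite ge_min lexx.
exists k, B, LE, r, (2 * Cl)^-1, C; split.
- by split => //; rewrite invr_gt0 mulr_gt0.
- by [].
- by move=> v; exists (v *m B).
- by move=> z z' /rd zd /rd z'd; rewrite -/F Fub ?Flb.
move=> z zr; rewrite -/F.
have Fz : K0 * `|1%:M - F z| <= eta.
  have := Fub 0 z; rewrite F0 normr0 sub0r normrN => /(_ d0 (rd _ zr)) h.
  apply: (le_trans (ler_wpM2l (ltW K00) h)).
  rewrite mulrA mulrC -ler_pdivlMr ?mulr_gt0// (le_trans zr)//.
  by rewrite !ge_min lexx !orbT.
have Fz2 := le_trans Fz eta2; split => //.
have [|Lx Hx Lx1] := Hr0 (z *m B).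
  apply: (le_lt_trans (CBb z)); rewrite mulrC -ltr_pdivlMr//.
  apply: (le_lt_trans zr); apply: (@le_lt_trans _ _ (r0 / (2 * CB))).
    by rewrite !ge_min lexx !orbT.
  rewrite ltr_pdivrMr ?mulr_gt0// mulrCA divfK ?gt_eqF//; lra.
pose Lz := [the {linear 'rV[R]_k -> 'M[R]_N} of Lx \o mulmxr B].
have FLz : frechet F Lz z by exact: frechet_mulmx.
have [G' [FG G'F G'2 G'1]] := near1_inverse Fz2.
exists Lz; split => // [v|w Lw]; first exact: Lx1.
have zd : `|z - 0| < d by rewrite subr0; exact: rd.
have LzLE v : `|Lz v - LE v| <= 2 * e * `|v|.
  exact: (strict_diff_frechet_near hd e0 zd FLz).
(* [M] is the derivative at [z], translated back to 1 and read in the parameter space. The errors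
   1/8 and 1/4 keep it within 1/2 of the identity, so it is invertible and every [w] in W is
   reached. *)
pose M := [the {linear 'rV[R]_k -> 'rV[R]_k} of ell \o (mulmxr G' \o Lz)].
have Mv v : `|M v - v| <= 2^-1 * `|v|.
  have -> : M v - v = ell (Lz v *m G' - LE v).
    by rewrite [RHS]raddfB; congr (_ - _); exact/esym/ellLE.
  apply: (le_trans (Clb _)).
  have -> : Lz v *m G' - LE v = Lz v *m (G' - 1%:M) + (Lz v - LE v).
    by rewrite mulmxBr mulmx1 addrA subrK.
  have h1 := ler_normD (Lz v *m (G' - 1%:M)) (Lz v - LE v).
  have h2 := norm_mxM (Lz v) (G' - 1%:M).
  have h3 : `|Lz v| <= (CE + 1) * `|v|.
    rewrite -[Lz v](subrK (LE v)) (le_trans (ler_normD _ _))//.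
    rewrite mulrDl addrC lerD// (le_trans (LzLE v))// ler_wpM2r//; lra.
  have h4 : `|Lz v *m (G' - 1%:M)| <= K0 * ((CE + 1) * `|v|) * (2 * eta).
    apply: (le_trans h2); apply: ler_pM => //.
      by rewrite ler_wpM2l// ltW.
    by apply: (le_trans G'1); rewrite ler_wpM2l.
  have h5 : Cl * (K0 * ((CE + 1) * `|v|) * (2 * eta)) <= 8^-1 * `|v|.
    have -> : Cl * (K0 * ((CE + 1) * `|v|) * (2 * eta)) =
      Cl * K0 * (CE + 1) * (2 * eta) * `|v| by ring.
    by rewrite ler_wpM2r.
  have h6 : Cl * (2 * e * `|v|) <= 4^-1 * `|v|.
    have -> : Cl * (2 * e * `|v|) = 2 * (Cl * e) * `|v| by ring.
    by rewrite ler_wpM2r//; lra.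
  have h7 : Cl * `|Lz v *m (G' - 1%:M) + (Lz v - LE v)| <=
     Cl * (K0 * ((CE + 1) * `|v|) * (2 * eta)) + Cl * (2 * e * `|v|).
    rewrite -mulrDr ler_pM2l//; have := LzLE v; lra.
  have := normr_ge0 v; lra.
have Mu : lin1_mx M \in unitmx.
  apply: unitmx_of_kernel => v; rewrite mul_rV_lin1 => Mv0.
  have := Mv v; rewrite Mv0 sub0r normrN => h; apply/eqP.
  by rewrite -normr_le0; have := normr_ge0 v; lra.
pose v := ell w *m invmx (lin1_mx M).
have Mvw : M v = ell w by rewrite -mul_rV_lin1 mulmxKV.
have [w' Lw' Lzv] := Lx1 (v *m B).
have Lzw' : Lz v *m G' = w' by rewrite [Lz v]Lzv -mulmxA FG mulmx1.
exists v; rewrite [Lz v]Lzv; congr (_ *m _).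
by rewrite -(LEell _ Lw) -(LEell _ Lw') -Mvw -Lzw'.
Qed.

End transversal.

Section range_linear.
Variables (R : realType) (D m n : nat) (L : {linear 'rV[R]_D -> 'M[R]_(m, n)}).

Lemma range_linear0 : range L 0.
Proof. by exists 0 => //; rewrite linear0. Qed.

Lemma range_linearD a b : range L a -> range L b -> range L (a + b).
Proof. by move=> [x _ <-] [y _ <-]; exists (x + y) => //; rewrite linearD. Qed.

Lemma range_linearZ s a : range L a -> range L (s *: a).
Proof. by move=> [x _ <-]; exists (s *: x) => //; rewrite linearZ. Qed.

Lemma range_linearN a : range L a -> range L (- a).
Proof. by move=> /(range_linearZ (-1)); rewrite scaleN1r. Qed.

Lemma range_linearB a b : range L a -> range L b -> range L (a - b).
Proof. by move=> aL bL; apply: range_linearD => //; exact: range_linearN. Qed.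

Lemma range_linear_sum (I : Type) (s : seq I) (P : pred I) (a : I -> 'M[R]_(m, n)) :
  (forall i, P i -> range L (a i)) -> range L (\sum_(i <- s | P i) a i).
Proof.
move=> h; elim/big_ind : _ => //; first exact: range_linear0.
exact: range_linearD.
Qed.

End range_linear.

(** * Curves tangent to the distribution p -> W p *)

Section chart.
Variables (R : realType) (N D : nat) (L : {linear 'rV[R]_D -> 'M[R]_N}).
Variables (k : nat) (F : 'rV[R]_k -> 'M[R]_N).
Variables (LE : {linear 'rV[R]_k -> 'M[R]_N}) (r c C : R).
Hypothesis FC : transversal_chart L F LE r c C.
Local Notation K0 := (N.+1%:R : R).
Let K00 : 0 < K0. Proof. by rewrite ltr0n. Qed.
Let r0 : 0 < r. Proof. by case: FC => -[]. Qed.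
Let c0 : 0 < c. Proof. by case: FC => -[]. Qed.
Let C0 : 0 < C. Proof. by case: FC => -[]. Qed.
Let F0 : F 0 = 1%:M. Proof. by case: FC => _ []. Qed.
Let Flb z z' : `|z| <= r -> `|z'| <= r -> c * `|z - z'| <= `|F z - F z'|.
Proof. by case: FC => _ _ _ h _ zr z'r; case/andP: (h z z' zr z'r). Qed.
Let Fub z z' : `|z| <= r -> `|z'| <= r -> `|F z - F z'| <= C * `|z - z'|.
Proof. by case: FC => _ _ _ h _ zr z'r; case/andP: (h z z' zr z'r). Qed.

Let Fdiff z : `|z| <= r -> exists Lz : {linear 'rV[R]_k -> 'M[R]_N}, [/\ frechet F Lz z,
       forall v, exists2 w, range L w & Lz v = w *m F z &
       forall w, range L w -> exists v, Lz v = w *m F z].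
Proof. by case: FC => _ _ _ _ h zr; case: (h z zr). Qed.

(** By the lower Lipschitz bound the points [z] satisfy |z - z0| = O(s), so [F z - F z0] is
    [Lz (z - z0)] up to o(s). Thus [v] is a limit of elements of W (F z0), and W is closed.
    Arbitrarily small [s] are enough. *)
Lemma tangent_in_range (z0 : 'rV[R]_k) (v G : 'M[R]_N) :
  `|z0| <= r -> F z0 *m G = 1%:M ->
  (forall e : R, 0 < e -> exists2 s, 0 < s <= e &
     exists2 z, `|z| <= r & `|F z - F z0 - s *: v| <= e * s) ->
  range L (v *m G).
Proof.
move=> z0r FG h; apply: range_closure => d d0.
have [Lz [FLz LzW _]] := Fdiff z0r.
pose A := `|v| + 1; have A0 : 0 < A by rewrite ltr_wpDl.
pose d' := d / (K0 * (`|G| + 1)).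
have KG0 : 0 < K0 * (`|G| + 1) by rewrite mulr_gt0// ltr_wpDl.
have d'0 : 0 < d' by rewrite divr_gt0.
(* Since |z - z0| <= s A / c, this precision makes the error of the derivative at most [d' / 2 * s];
   the other half of [d'] is for the error in the hypothesis. *)
have e10 : 0 < d' * c / (2 * A) by apply: divr_gt0; apply: mulr_gt0.
have [dz dz0 hdz] := FLz _ e10.
pose e := Num.min 1 (Num.min (d' / 2) (dz * c / (2 * A))).
have e0 : 0 < e by rewrite !lt_min ltr01 !divr_gt0 ?mulr_gt0.
have e1 : e <= 1 by rewrite ge_min lexx.
have ed' : e <= d' / 2 by rewrite !ge_min lexx !orbT.
have edz : e * A <= dz * c / 2.
  rewrite -ler_pdivlMr//; have -> : dz * c / 2 / A = dz * c / (2 * A).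
    by rewrite invfM mulrA.
  by rewrite !ge_min lexx !orbT.
have [s /andP[s0 se] [z zr hz]] := h e e0.
have h1 : c * `|z - z0| <= s * A.
  apply: (le_trans (Flb zr z0r)); rewrite -[F z - F z0](subrK (s *: v)).
  rewrite (le_trans (ler_normD _ _))// normrZ gtr0_norm// /A mulrDr mulr1.
  rewrite addrC lerD2l (le_trans hz)//.
  by rewrite -[leRHS]mul1r ler_wpM2r// ltW.
have zd : `|z - z0| < dz.
  rewrite -(ltr_pM2l c0); apply: (le_lt_trans h1).
  have : s * A <= e * A by rewrite ler_wpM2r// ltW.
  have : 0 < dz * c by rewrite mulr_gt0.
  rewrite mulrC in edz *; lra.
have h2 := hdz _ zd.
have h3 : d' * c / (2 * A) * `|z - z0| <= d' / 2 * s.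
  have -> : d' * c / (2 * A) * `|z - z0| = d' / 2 * (c * `|z - z0| / A).
    by rewrite invfM; ring.
  by rewrite ler_wpM2l ?ler_pdivrMr// ltW// divr_gt0.
have [w Lw Lzw] := LzW (z - z0).
exists (s^-1 *: w); first exact: range_linearZ.
have wE : w = Lz (z - z0) *m G by rewrite Lzw -mulmxA FG mulmx1.
have -> : s^-1 *: w - v *m G = s^-1 *: (Lz (z - z0) - s *: v) *m G.
  by rewrite wE -scalemxAl mulmxBl scalerBr -!scalemxAl scalerA mulVf ?gt_eqF// scale1r.
apply: (le_trans (norm_mxM _ _)); rewrite normrZ gtr0_norm ?invr_gt0//.
have h4 : `|Lz (z - z0) - s *: v| <= d' * s.
  have -> : Lz (z - z0) - s *: v =
      (F z - F z0 - s *: v) - (F z - F z0 - Lz (z - z0)).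
    by rewrite [in RHS]opprB [RHS]addrC subrKA.
  rewrite (le_trans (ler_normB _ _))//.
  have : e * s <= d' / 2 * s by rewrite ler_wpM2r// ltW.
  lra.
have h5 : s^-1 * `|Lz (z - z0) - s *: v| <= d' by rewrite mulrC ler_pdivrMr.
rewrite -mulrA (le_trans (_ : _ <= K0 * (d' * (`|G| + 1))))//.
  rewrite ler_pM2l// ler_pM// ?lerDl// mulr_ge0// invr_ge0 ltW//.
by rewrite mulrCA /d' divfK ?gt_eqF.
Qed.

(* For every e > 0 the point q t stays within 2 e t of the image of F; since
   balls are compact, e may be replaced by 0. *)
Lemma flow_in_chart (q : R -> 'M[R]_N) : q 0 = 1%:M ->
  (forall t, 0 <= t <= 1 -> `|q t - 1%:M| <= c * r / 4) ->
  (forall t, 0 <= t <= 1 -> exists w, [/\ range L w, K0 * `|w| <= 2^-1 &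
     forall e : R, 0 < e -> exists2 d : R, 0 < d &
       forall s, `|s| < d -> `|q (t + s) - q t - s *: (w *m q t)| <= e * `|s|]) ->
  exists2 z, `|z| <= r & q 1 = F z.
Proof.
move=> q0 q1 dq.
have qc t : 0 <= t <= 1 -> forall e : R, 0 < e -> exists2 d : R, 0 < d &
    forall s, `|s| < d -> `|q (t + s) - q t| <= e.
  move=> /dq[w [_ _ hw]] e e0.
  have [d d0 hd] := hw 1 ltr01.
  pose A := `|w *m q t| + 1; have A0 : 0 < A by rewrite ltr_wpDl.
  exists (Num.min d (e / A)); first by rewrite lt_min d0 divr_gt0.
  move=> s; rewrite lt_min => /andP[sd]; rewrite ltr_pdivlMr// => se.
  rewrite -[q (t + s) - q t](subrK (s *: (w *m q t))).
  rewrite (le_trans (ler_normD _ _))// normrZ.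
  by have := hd s sd; rewrite /A in se; lra.
suff h (e : R) : 0 < e -> exists2 z, `|z| <= r & `|q 1 - F z| <= 0 + e.
  have [z zr] := lipschitz_ball_attained (ltW r0) Fub h.
  by rewrite normr_le0 subr_eq0 => /eqP; exists z.
(* Shrinking [e] is harmless, and it keeps the approximating parameters in the ball of radius
   [r / 2]. *)
wlog ecr : e / e <= c * r / 8.
  move=> hw e0; have cr0 : 0 < c * r / 8 by rewrite divr_gt0// mulr_gt0.
  have [||z zr hz] := hw (Num.min e (c * r / 8)); rewrite ?ge_min ?lexx ?orbT//.
    by rewrite lt_min e0.
  by exists z => //; apply: (le_trans hz); rewrite lerD2l ge_min lexx.
move=> {}e0'; pose e' := e / 2; have e0 : 0 < e' by rewrite divr_gt0.
pose S := [set t : R | 0 <= t <= 1 /\ exists2 z, `|z| <= r & `|q t - F z| <= 2 * e' * t].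
have S0 : S 0.
  split; first by rewrite lexx ler01.
  by exists 0; rewrite ?normr0 ?(ltW r0)// q0 F0 subrr normr0 mulr0.
have Sub : ubound S 1 by move=> t [/andP[]].
have hs : has_sup S by split; [exists 0|exists 1].
pose sg := sup S.
have sg01 : 0 <= sg <= 1.
  by apply/andP; split; [exact: (sup_upper_bound hs)|apply: sup_le_ub => //; exists 0].
(* The supremum belongs to [S]: continuity of [q] gives the bound up to any [eta], and compactness
   removes [eta]. *)
have [zs zsr hzs] : exists2 z, `|z| <= r & `|q sg - F z| <= 2 * e' * sg.
  apply: (lipschitz_ball_attained (ltW r0) Fub) => eta eta0.
  have [d d0 hd] := qc sg sg01 eta eta0.
  have [t [t01 [z zr hz]] tsg] := sup_adherent d0 hs.
  have tsg' : t <= sg by apply: (sup_upper_bound hs); split => //; exists z.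
  exists z => //; rewrite -[q sg - F z](subrKA (q t)) (le_trans (ler_normD _ _))//.
  rewrite addrC lerD//.
    by apply: (le_trans hz); rewrite ler_wpM2l// mulr_ge0// ltW.
  have := hd (t - sg); have -> : sg + (t - sg) = t by lra.
  move=> h; rewrite distrC; apply: h.
  by rewrite distrC ger0_norm ?subr_ge0//; rewrite -/sg in tsg; lra.
suff sg1 : sg = 1.
  exists zs => //; move: hzs; rewrite sg1 /e'; lra.
apply/eqP; rewrite eq_le; case/andP: (sg01) => sg0 -> /=; rewrite leNgt.
apply/negP => sg1.
have [w [Lw wK hw]] := dq sg sg01.
have [Lz [FLz _ /(_ _ Lw)[v Lzv]]] := Fdiff zsr.
have e20 : 0 < e' / 2 by rewrite divr_gt0.
have [d1 d10 hd1] := hw _ e20.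
have [d2 d20 hd2] := frechet_ray v FLz e20.
(* The lower Lipschitz bound between [zs] and 0, where [F] is 1, together with the smallness of
   [q - 1]; the remaining [r / 2] is room for one more step. *)
have zs2 : `|zs| <= r / 2.
  have h1 := Flb zsr (_ : `|0| <= r); rewrite normr0 subr0 F0 in h1.
  have {}h1 := h1 (ltW r0); rewrite -(ler_pM2l c0) (le_trans h1)//.
  rewrite -(subrKA (q sg)) (le_trans (ler_normD _ _))// distrC.
  have : 2 * e' * sg <= 2 * e' by rewrite -[leRHS]mulr1 ler_pM2l ?mulr_gt0// ltW.
  have := q1 _ sg01; rewrite /e' in hzs *; lra.
pose s := Num.min (Num.min (d1 / 2) (d2 / 2)) (Num.min (1 - sg) (r / (2 * (`|v| + 1)))).
have v0 : 0 < `|v| + 1 by rewrite ltr_wpDl.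
have s0 : 0 < s by rewrite !lt_min !divr_gt0 ?mulr_gt0//= subr_gt0 sg1.
have sd1 : `|s| < d1.
  rewrite gtr0_norm// (@le_lt_trans _ _ (d1 / 2))//; last by lra.
  by rewrite !ge_min lexx.
have sd2 : `|s| < d2.
  rewrite gtr0_norm// (@le_lt_trans _ _ (d2 / 2))//; last by lra.
  by rewrite !ge_min lexx ?orbT.
have ssg : s <= 1 - sg by rewrite !ge_min lexx ?orbT.
have sv : s * (`|v| + 1) <= r / 2.
  rewrite -ler_pdivlMr// -mulrA -invfM.
  by rewrite !ge_min lexx ?orbT.
suff : S (sg + s) by move=> /(sup_upper_bound hs); rewrite -/sg; lra.
split; first by apply/andP; split; lra.
(* [v] is chosen with [Lz v = w *m F zs], so that [F] moves with the same [w] as [q]. *)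
exists (zs + s *: v).
  rewrite (le_trans (ler_normD _ _))// normrZ gtr0_norm//; lra.
have h1 := hd1 s sd1; have h2 := hd2 s sd2.
rewrite gtr0_norm// in h1 h2.
have h3 : `|w *m (q sg - F zs)| <= 2^-1 * `|q sg - F zs|.
  by rewrite (le_trans (norm_mxM _ _))// ler_wpM2r.
(* Each derivative contributes an error [e' / 2 * s]. The discrepancy at [sg], at most [2 * e'],
   grows by at most [s / 2] times itself because [K0 * |w| <= 2^-1]. The total [2 * e' * s] is
   exactly the slope allowed in [S]. *)
have -> : q (sg + s) - F (zs + s *: v) =
   (q (sg + s) - q sg - s *: (w *m q sg)) - (F (zs + s *: v) - F zs - s *: Lz v)
   + (q sg - F zs + s *: (w *m (q sg - F zs))).
  rewrite Lzv mulmxBr scalerBr.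
  move: (q (sg + s)) (F (zs + s *: v)) (q sg) (F zs) (s *: _) (s *: _).
  by move=> a b a1 b1 a2 b2; apply/matrixP => i j; rewrite !mxE; ring.
rewrite (le_trans (ler_normD _ _))//.
have h4 := ler_normB (q (sg + s) - q sg - s *: (w *m q sg))
  (F (zs + s *: v) - F zs - s *: Lz v).
have h5 := ler_normD (q sg - F zs) (s *: (w *m (q sg - F zs))).
rewrite [in X in _ <= _ + X]normrZ gtr0_norm// in h5.
have h6 : s * `|w *m (q sg - F zs)| <= s * (2^-1 * (2 * e')).
  rewrite ler_pM2l// (le_trans h3)// ler_pM2l//.
  apply: (le_trans hzs).
  by rewrite -[leRHS]mulr1 ler_pM2l ?mulr_gt0// ltW.
lra.
Qed.

Variable H : 'rV[R]_D -> 'M[R]_N.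
Hypothesis H0 : H 0 = 1%:M.
Hypothesis Hs : strict_diff H L 0.
Hypothesis Hl : exists2 r : R, 0 < r & forall x, `|x| < r ->
  exists2 Lx : {linear 'rV[R]_D -> 'M[R]_N}, frechet H Lx x &
    forall v, exists2 w, range L w & Lx v = w *m H x.

(** The directions discarded with the kernel of [L] add no new values near 1: the ray from 0 to [x]
    is sent to a curve tangent to the distribution, to which [flow_in_chart] applies. *)
Lemma small_in_chart : exists2 rho : R, 0 < rho & forall x, `|x| < rho ->
  exists2 z, `|z| <= r & H x = F z.
Proof.
have [r1 r10 hr1] := Hl.
have [d d0 hd] := Hs ltr01.
have [CL CL0 CLb] := linear_bound L.
have K01 : 1 <= K0 by rewrite ler1n.
(* In [w = Lx x *m G], the derivative is bounded by [CL + 2] times |x| and the inverse [G] by 2. One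
   [K0] comes from this product, the other from the required bound on [K0 * |w|]. *)
pose A := 2 * K0 * K0 * (CL + 2).
have A0 : 0 < A by rewrite !mulr_gt0// addr_gt0.
have KA : K0 * (CL + 1) <= A.
  have -> : A = K0 * (2 * (CL + 2) * K0) by rewrite /A; ring.
  rewrite ler_pM2l// (@le_trans _ _ (2 * (CL + 2)))//; first by lra.
  by rewrite -[leLHS]mulr1 ler_wpM2l// mulr_ge0// ltW// addr_gt0.
have CA : CL + 1 <= A.
  rewrite (le_trans _ KA)// -[leLHS]mul1r ler_wpM2r// ltW// addr_gt0//.
pose b := Num.min 2^-1 (c * r / 4).
have b0 : 0 < b by rewrite lt_min invr_gt0 ltr0n divr_gt0// mulr_gt0.
have b2 : b <= 2^-1 by rewrite ge_min lexx.
have bcr : b <= c * r / 4 by rewrite ge_min lexx orbT.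
pose rho := Num.min (Num.min r1 d) (b / A).
have rho0 : 0 < rho by rewrite !lt_min r10 d0 divr_gt0.
exists rho => // x; rewrite !lt_min => /andP[/andP[xr1 xd]].
rewrite ltr_pdivlMr// => xA.
have sx t : 0 <= t <= 1 -> `|t *: x| <= `|x|.
  move=> /andP[t0 t1]; rewrite normrZ ger0_norm//.
  by rewrite -[leRHS]mul1r ler_wpM2r.
have H1 t : 0 <= t <= 1 -> `|H (t *: x) - 1%:M| <= (CL + 1) * `|x|.
  move=> t01; have := hd (t *: x) 0; rewrite !subr0 normr0 H0 => h.
  have {}h := h (le_lt_trans (sx _ t01) xd) d0.
  rewrite -[_ - 1%:M](subrK (L (t *: x))) (le_trans (ler_normD _ _))//.
  have := CLb (t *: x); have := sx _ t01.
  have := ler_wpM2l (ltW CL0) (sx _ t01); lra.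
have x0 := normr_ge0 x.
have hA (u : R) : u <= A -> u * `|x| <= b.
  move=> uA; apply: ltW; apply: le_lt_trans xA; rewrite mulrC ler_wpM2l//.
pose q t := H (t *: x).
have [||t t01|z zr qz] := @flow_in_chart q.
- by rewrite /q scale0r.
- move=> t t01; apply: (le_trans (H1 _ t01)).
  exact: le_trans (hA _ CA) bcr.
- have xr : `|t *: x| < r1 by exact: le_lt_trans (sx _ t01) xr1.
  have [Lx Hx Lx1] := hr1 _ xr.
  have [w Lw Lxw] := Lx1 x.
  exists w; split => //.
    have [|G [HG GH G2 _]] := @near1_inverse R N (H (t *: x)).
      rewrite distrC (le_trans (ler_wpM2l (ltW K00) (H1 _ t01)))// mulrA.
      exact: le_trans (hA _ KA) b2.
    have -> : w = Lx x *m G by rewrite Lxw -mulmxA HG mulmx1.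
    have h1 : `|Lx x| <= (CL + 2) * `|x|.
      have xd' : `|t *: x - 0| < d by rewrite subr0; exact: le_lt_trans (sx _ t01) xd.
      have := strict_diff_frechet_near hd ltr01 xd' Hx x.
      rewrite mulr1 -[Lx x](subrK (L x)) => h.
      rewrite (le_trans (ler_normD _ _))// addrC mulrDl.
      by rewrite subrK in h *; exact: lerD.
    apply: (le_trans _ b2); apply: le_trans (hA _ (lexx A)).
    have h2 := norm_mxM (Lx x) G.
    apply: (le_trans (ler_wpM2l (ltW K00) h2)).
    have -> : A * `|x| = K0 * (K0 * ((CL + 2) * `|x|) * 2) by rewrite /A; ring.
    rewrite ler_pM2l// ler_pM//.
    by rewrite ler_pM2l.
  move=> e e0; have [d' d'0 hd'] := frechet_ray x Hx e0.
  by exists d' => // s /hd'; rewrite /q scalerDl Lxw.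
- by exists z => //; rewrite -qz /q scale1r.
Qed.

End chart.

(** * Resolvents and odd powers *)

Section resolvent_def.
Variables (R : realType) (N : nat) (u : 'M[R]_N).

Definition resolvent (t : R) := invmx (1%:M - t *: u).

(** This is u^(2m+1) (1 - t^2 u^2)^-1, the remainder of the odd geometric series after [m] terms
    divided by t^(2m). For [m = 0] it is half the factor w(t) in the equation of the Cayley
    curve. *)
Definition odd_resolvent (t : R) (m : nat) :=
  resolvent t *m resolvent (- t) *m u ^+ m.*2.+1.

End resolvent_def.

Section expansion.
Variables (R : realType) (N D : nat) (L : {linear 'rV[R]_D -> 'M[R]_N}).
Local Notation K0 := (N.+1%:R : R).
Let K00 : 0 < K0. Proof. by rewrite ltr0n. Qed.

Lemma norm_mxX (u : 'M[R]_N) n : `|u ^+ n| <= (K0 * `|u|) ^+ n.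
Proof.
elim: n => [|n IHn]; first by rewrite !expr0 norm_mx1.
rewrite !exprS (le_trans (norm_mxM _ _))// ler_wpM2l// mulr_ge0// ltW//.
Qed.

(** By strong induction: the earlier terms are already in the range and can be subtracted; dividing
    by [t ^+ m] and letting [t] tend to 0 isolates [a m]. Only arbitrarily small [t] are required,
    which is all that Baire's theorem provides. *)
Lemma expansion_coefficients (a : nat -> 'M[R]_N) (C : nat -> R) :
  (forall d : R, 0 < d -> exists2 t, 0 < t < d & exists2 S, range L S &
     forall m, `|S - \sum_(j < m) t ^+ j *: a j| <= C m * t ^+ m) ->
  forall j, range L (a j).
Proof.
move=> h; elim/ltn_ind => m IHm; apply: range_closure => e e0.
have A0 : 0 < `|C m.+1| + 1 by rewrite ltr_wpDl.
have [t /andP[t0]] := h _ (divr_gt0 e0 A0); rewrite ltr_pdivlMr// => te [S LS hS].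
exists (t ^- m *: (S - \sum_(j < m) t ^+ j *: a j)).
  apply/range_linearZ/range_linearB => //; apply: range_linear_sum => j _.
  exact/range_linearZ/IHm.
have tm : t ^+ m != 0 by rewrite expf_neq0// gt_eqF.
have -> : t ^- m *: (S - \sum_(j < m) t ^+ j *: a j) - a m =
    t ^- m *: (S - \sum_(j < m.+1) t ^+ j *: a j).
  rewrite big_ord_recr /= opprD addrA [RHS]scalerBr scalerA mulVf// scale1r//.
rewrite normrZ ger0_norm ?invr_ge0 ?exprn_ge0 ?(ltW t0)//.
rewrite mulrC ler_pdivrMr ?exprn_gt0// (le_trans (hS _))// exprSr mulrA mulrAC.
rewrite ler_wpM2r ?exprn_ge0 ?(ltW t0)//.
have : C m.+1 * t <= `|C m.+1| * t by rewrite ler_wpM2r ?ler_norm// ltW.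
by move: te; rewrite mulrDr; lra.
Qed.

Lemma near1_invmx (A : 'M[R]_N) : K0 * `|1%:M - A| <= 2^-1 ->
  [/\ A \in unitmx, `|invmx A| <= 2
    & `|invmx A - 1%:M| <= 2 * (K0 * `|1%:M - A|)].
Proof.
move=> /near1_inverse[B [AB BA B2 B1]].
have [Au _] := mulmx1_unit AB.
suff <- : B = invmx A by [].
by rewrite -[invmx A]mul1mx -BA mulmxK.
Qed.

Section resolvent.
Variable u : 'M[R]_N.
Local Notation Rs := (resolvent u).
Local Notation small t := (K0 * `|t *: u| <= 2^-1).

Lemma resolventP t : small t -> [/\ (1%:M - t *: u) *m Rs t = 1%:M,
  Rs t *m (1%:M - t *: u) = 1%:M, `|Rs t| <= 2
  & `|Rs t - 1%:M| <= 2 * (K0 * `|t *: u|)].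
Proof.
have E : 1%:M - (1%:M - t *: u) = t *: u by rewrite opprB addrC subrK.
move=> st; have [|Au R2 R1] := @near1_invmx (1%:M - t *: u); first by rewrite E.
rewrite E in R1.
by split => //; rewrite ?mulmxV ?mulVmx.
Qed.

Lemma smallN t : small t -> small (- t).
Proof. by rewrite scaleNr normrN. Qed.

(** The resolvent identity. Used once it bounds the increments of the Cayley curve, used twice it
    computes the derivative with a quadratic remainder. *)
Lemma resolvent_eq s t : small s -> small t ->
  Rs s - Rs t = (s - t) *: (Rs s *m u *m Rs t).
Proof.
move=> /resolventP[_ sV _ _] /resolventP[tV _ _ _].
have -> : (s - t) *: (Rs s *m u *m Rs t) = Rs s *m ((s - t) *: u) *m Rs t.
  by rewrite -scalemxAr -scalemxAl.
have -> : (s - t) *: u = (1%:M - t *: u) - (1%:M - s *: u).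
  by rewrite opprB [RHS]addrC subrKA scalerBl.
by rewrite mulmxBr mulmxBl -mulmxA tV mulmx1 sV mul1mx.
Qed.

Lemma resolvent_comm t : small t -> u *m Rs t = Rs t *m u.
Proof.
move=> /resolventP[tV Vt _ _]; rewrite -[LHS]mul1mx -Vt -!mulmxA; congr (_ *m _).
by rewrite !mulmxA mulmxBl mul1mx -scalemxAl scalemxAr -[X in X - _]mulmx1 -mulmxBr
  -mulmxA tV mulmx1.
Qed.

(** Since 1 + t u = 2 - (1 - t u), the Cayley curve is affine in the resolvent, and the resolvent
    identity applies to it. *)
Lemma cayleyE t : small t -> (1%:M + t *: u) *m Rs t = 2 *: Rs t - 1%:M.
Proof.
move=> /resolventP[tV _ _ _].
have -> : 1%:M + t *: u = 2 *: 1%:M - (1%:M - t *: u).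
  by apply/matrixP => i j; rewrite !mxE; ring.
by rewrite mulmxBl tV -scalemxAl mul1mx.
Qed.

Local Notation E := (odd_resolvent u).

Lemma odd_resolvent_rec t m : small t ->
  E t m = u ^+ m.*2.+1 + t ^+ 2 *: E t m.+1.
Proof.
move=> st; have [_ Vt _ _] := resolventP st; have [_ V't _ _] := resolventP (smallN st).
have e1 : Rs t *m Rs (- t) *m (1%:M - t ^+ 2 *: (u *m u)) = 1%:M.
  have -> : 1%:M - t ^+ 2 *: (u *m u) = (1%:M - (- t) *: u) *m (1%:M - t *: u).
    rewrite scaleNr opprK mulmxBr mulmx1 mulmxDl mul1mx opprD addrA addrK.
    by rewrite -scalemxAl -scalemxAr scalerA.
  by rewrite mulmxA -(mulmxA (Rs t)) V't mulmx1.
have e2 : Rs t *m Rs (- t) *m (1%:M - t ^+ 2 *: (u *m u)) *m u ^+ m.*2.+1 =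
    E t m - t ^+ 2 *: E t m.+1.
  rewrite -mulmxA mulmxBl mul1mx mulmxBr; congr (_ - _).
  by rewrite -scalemxAl -scalemxAr /odd_resolvent doubleS !exprS -!mulmxE !mulmxA.
by move: e2; rewrite e1 mul1mx => ->; rewrite subrK.
Qed.

Lemma odd_resolvent_expansion t m : small t ->
  E t 0 - \sum_(j < m) (t ^+ 2) ^+ j *: u ^+ j.*2.+1 = (t ^+ 2) ^+ m *: E t m.
Proof.
move=> st; elim: m => [|m IHm]; first by rewrite big_ord0 subr0 expr0 scale1r.
rewrite big_ord_recr /= opprD addrA IHm odd_resolvent_rec// scalerDr addrAC subrr.
by rewrite add0r scalerA -exprSr.
Qed.

Lemma odd_resolvent_bound t m : small t ->
  `|E t m| <= K0 * (K0 * 2 * 2) * (K0 * `|u|) ^+ m.*2.+1.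
Proof.
move=> st; have [_ _ R2 _] := resolventP st; have [_ _ R2' _] := resolventP (smallN st).
rewrite (le_trans (norm_mxM _ _))//; apply: ler_pM => //.
- rewrite ler_pM2l// (le_trans (norm_mxM _ _))// -!mulrA ler_pM2l//.
  by rewrite ler_pM.
- exact: norm_mxX.
Qed.

(** The partial sums of the odd geometric series lie in the range and converge, [K0 * |u|] being at
    most 1/2; the remainder is below any [e] because 2^(2m+1) exceeds m. *)
Lemma odd_resolvent_range t : small t -> `|t| <= 1 -> K0 * `|u| <= 2^-1 ->
  (forall j, range L (u ^+ j.*2.+1)) -> range L (E t 0).
Proof.
move=> st t1 u2 Lu; apply: range_closure => e e0.
pose A := K0 * (K0 * 2 * 2).
have A0 : 0 < A by rewrite !mulr_gt0.
have [m mA] : exists m : nat, A / e < m%:R.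
  by exists (Num.bound (A / e)); rewrite archi_boundP// divr_ge0// ltW.
exists (\sum_(j < m) (t ^+ 2) ^+ j *: u ^+ j.*2.+1).
  by apply: range_linear_sum => j _; exact/range_linearZ.
rewrite distrC odd_resolvent_expansion// normrZ.
have t2 : `|(t ^+ 2) ^+ m| <= 1 by rewrite !normrX !exprn_ile1 ?exprn_ge0.
apply: (@le_trans _ _ (1 * (A * 2 ^- m.*2.+1))).
  apply: ler_pM => //; rewrite (le_trans (odd_resolvent_bound _ st))//.
  by rewrite ler_pM2l// -exprVn lerXn2r// nnegrE ?invr_ge0// mulr_ge0// ltW.
rewrite mul1r ler_pdivrMr ?exprn_gt0// mulrC -ler_pdivrMr//.
rewrite (le_trans (ltW mA))// -natrX ler_nat (leq_trans (ltnW (@ltn_expl 2 m isT)))//.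
by rewrite leq_exp2l// -addnn leqW// leq_addl.
Qed.

End resolvent.
End expansion.

(** * From odd powers in W to Cayley transforms in the chart *)

Section cayley.
Variables (R : realType) (N D : nat) (L : {linear 'rV[R]_D -> 'M[R]_N}).
Variables (k : nat) (F : 'rV[R]_k -> 'M[R]_N).
Variables (LE : {linear 'rV[R]_k -> 'M[R]_N}) (r c C : R).
Hypothesis FC : transversal_chart L F LE r c C.
Local Notation K0 := (N.+1%:R : R).
Let K00 : 0 < K0. Proof. by rewrite ltr0n. Qed.
Let r0 : 0 < r. Proof. by case: FC => -[]. Qed.
Let c0 : 0 < c. Proof. by case: FC => -[]. Qed.

Lemma cayley_in_chart : exists2 eta : R, 0 < eta & forall u : 'M[R]_N, `|u| < eta ->
  (forall j, range L (u ^+ j.*2.+1)) -> 1%:M - u \in unitmx /\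
  exists2 z, `|z| <= r & (1%:M + u) *m invmx (1%:M - u) = F z.
Proof.
pose b := Num.min 2^-1 (c * r / 4).
have b0 : 0 < b by rewrite lt_min invr_gt0 ltr0n divr_gt0// mulr_gt0.
have b2 : b <= 2^-1 by rewrite ge_min lexx.
have bcr : b <= c * r / 4 by rewrite ge_min lexx orbT.
have K01 : 1 <= K0 by rewrite ler1n.
(* [w] is twice a product of [u] with two resolvents of norm at most 2, whence 8. The product of
   three matrices costs [K0 * K0], and the last [K0] comes from the required bound on [K0 * |w|]. *)
pose A := 8 * K0 * (K0 * K0).
have A0 : 0 < A by rewrite !mulr_gt0.
have KA : 8 * K0 <= A.
  by rewrite -[leLHS]mulr1 ler_pM2l ?mulr_gt0// -[leLHS]mulr1 ler_pM.
exists (b / A); first by rewrite divr_gt0.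
move=> u; rewrite ltr_pdivlMr// => uA Lu.
have u0 := normr_ge0 u.
have Kub : 8 * (K0 * `|u|) <= b.
  by apply: le_trans (ltW uA); rewrite mulrA mulrC ler_wpM2l.
have KKub : K0 * (K0 * K0 * (2 * `|u| * 2)) <= b / 2.
  have -> : K0 * (K0 * K0 * (2 * `|u| * 2)) = `|u| * A / 2 by rewrite /A; field.
  by rewrite ler_pM2r// ltW.
(* The bound 2 rather than 1 covers [t + s] with [t] in [0, 1] and |s| < 1, where the difference
   quotient is evaluated. *)
have small t : `|t| <= 2 -> K0 * `|t *: u| <= 2^-1.
  move=> t2; rewrite normrZ mulrCA.
  have : `|t| * (K0 * `|u|) <= 2 * (K0 * `|u|).
    by rewrite ler_wpM2r// mulr_ge0// ltW.
  lra.
have lt2 (t : R) : 0 <= t <= 1 -> `|t| <= 2.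
  by move=> /andP[t0 t1]; rewrite ger0_norm//; lra.
pose q t := 2 *: resolvent u t - 1%:M.
have s1 : K0 * `|1 *: u| <= 2^-1 by rewrite small// normr1; lra.
have [||t t01|z zr qz] := @flow_in_chart _ _ _ _ _ _ _ _ _ _ FC q.
- by rewrite /q /resolvent scale0r subr0 invmx1; apply/matrixP => i j; rewrite !mxE; ring.
- move=> t t01; have [_ _ _ h] := resolventP (small _ (lt2 _ t01)).
  have -> : q t - 1%:M = 2 *: (resolvent u t - 1%:M).
    by apply/matrixP => i j; rewrite /q !mxE; ring.
  rewrite normrZ ger0_norm//; move: h; rewrite normrZ.
  move: t01 => /andP[t0 t1]; rewrite ger0_norm// => h.
  have : K0 * (t * `|u|) <= K0 * `|u|.
    by rewrite ler_pM2l// -[leRHS]mul1r ler_wpM2r.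
  lra.
- have st := small _ (lt2 _ t01); have [tV Vt R2 _] := resolventP st.
  have [tV' Vt' R2' _] := resolventP (smallN st).
  exists (2 *: odd_resolvent u t 0); split.
  + apply: range_linearZ; apply: odd_resolvent_range => //.
      by case/andP: t01 => t0 t1; rewrite ger0_norm.
    lra.
  + rewrite normrZ ger0_norm// /odd_resolvent expr1.
    have h : `|resolvent u t *m resolvent u (- t) *m u| <= K0 * K0 * (2 * 2 * `|u|).
      exact: norm_mxM3.
    have : 2 * (K0 * `|resolvent u t *m resolvent u (- t) *m u|) <=
      2 * (K0 * (K0 * K0 * (2 * 2 * `|u|))) by rewrite !ler_pM2l.
    by rewrite -[2 * 2 * `|u|]mulrAC; lra.
  have wq : odd_resolvent u t 0 *m q t = resolvent u t *m u *m resolvent u t.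
    rewrite /q -cayleyE// /odd_resolvent expr1 mulmxA.
    rewrite -(mulmxA _ u) mulmxDr mulmx1 -scalemxAr.
    have -> : u + t *: (u *m u) = (1%:M - (- t) *: u) *m u.
      by rewrite scaleNr opprK mulmxDl mul1mx scalemxAl.
    by rewrite mulmxA -(mulmxA _ (resolvent u (- t))) Vt' mulmx1.
  move=> e e0.
  pose B := 2 * (K0 * K0 * (K0 * K0 * (2 * `|u| * 2) * `|u| * 2)) + 1.
  have B0 : 0 < B by rewrite ltr_wpDl// !mulr_ge0.
  exists (Num.min 1 (e / B)); first by rewrite lt_min ltr01 divr_gt0.
  move=> s; rewrite lt_min => /andP[s_1]; rewrite ltr_pdivlMr// => sB.
  have sts : K0 * `|(t + s) *: u| <= 2^-1.
    apply: small; rewrite (le_trans (ler_normD _ _))//.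
    by case/andP: t01 => t0 t1; rewrite (ger0_norm t0); lra.
  have [_ _ Rs2 _] := resolventP sts.
  (* Two applications of the resolvent identity leave a remainder quadratic in [s]. *)
  have -> : q (t + s) - q t - s *: (2 *: odd_resolvent u t 0 *m q t) =
      (2 * s ^+ 2) *: (resolvent u (t + s) *m u *m resolvent u t *m u *m resolvent u t).
    have -> : q (t + s) - q t = 2 *: (resolvent u (t + s) - resolvent u t).
      by apply/matrixP => i j; rewrite /q !mxE; ring.
    rewrite resolvent_eq// addrAC subrr add0r -scalemxAl wq.
    rewrite scalerA (scalerA s) (mulrC s) -scalerBr -!mulmxBl.
    rewrite resolvent_eq// addrAC subrr add0r -!scalemxAl scalerA.
    by rewrite expr2 !mulrA.
  rewrite normrZ normrM [`|2|]ger0_norm// normrX.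
  have h : `|resolvent u (t + s) *m u *m resolvent u t *m u *m resolvent u t| <=
      K0 * K0 * (K0 * K0 * (2 * `|u| * 2) * `|u| * 2).
    by apply: norm_mxM3 => //; exact: norm_mxM3.
  have : `|s| ^+ 2 * B <= e * `|s| by rewrite expr2 mulrAC ler_wpM2r// ltW.
  have : 2 * `|s| ^+ 2 * `|resolvent u (t + s) *m u *m resolvent u t *m u *m resolvent u t|
    <= 2 * `|s| ^+ 2 * (K0 * K0 * (K0 * K0 * (2 * `|u| * 2) * `|u| * 2)).
    by rewrite ler_wpM2l// mulr_ge0.
  have : 0 <= `|s| ^+ 2 by rewrite exprn_ge0.
  rewrite /B; move: (K0 * K0 * _) => X; move: `| _ *m _ | => Y; rewrite mulrDr mulr1.
  lra.
- have [tV _ _ _] := resolventP s1; rewrite scale1r in tV.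
  split; first by have [] := mulmx1_unit tV.
  exists z => //; rewrite -qz /q -cayleyE// scale1r /resolvent scale1r//.
Qed.

End cayley.

(** * From Cayley curves in the group back to odd powers, by Baire's theorem *)

Lemma closed_cover_interval (R : realType) (a b : R) (T : nat -> set R) :
  a < b -> (forall n, closed (T n)) ->
  (forall t, a < t < b -> exists n, T n t) ->
  exists n t, a < t < b /\ exists2 d : R, 0 < d & forall s, `|s - t| < d -> T n s.
Proof.
move=> ab Tcl Tcov; apply: contrapT => noT.
(* If no [T n] contains an interval, these complements are open and dense, and Baire's theorem gives
   a point of ]a, b[ outside every [T n]. *)
have dT n : open (~` (T n `&` `[a, b]%classic)) /\ dense (~` (T n `&` `[a, b]%classic)).
  split; first by apply: closed_openC; apply: closedI; [exact: Tcl|exact: itv_closed].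
  move=> O [t Ot] oO; apply: contrapT => nOT.
  have sub s : O s -> T n s /\ a <= s <= b.
    move=> Os; apply: contrapT => nT; apply: nOT; exists s; split => //.
  apply: noT; have /nbhs_ballP[d /= d0 dO] : nbhs t O by exact: open_nbhs_nbhs.
  have dO' s : `|s - t| < d -> O s by move=> sd; apply: dO; rewrite /ball /= distrC.
  exists n, t; split; last by exists d => // s /dO' /sub[].
  (* The points [t - d / 2] and [t + d / 2] also lie in [a, b], so [t] is strictly inside. *)
  have d2 : `|d / 2| < d by rewrite gtr0_norm ?divr_gt0//; lra.
  have [|_ /andP[+ _]] := sub (t - d / 2).
    by apply: dO'; rewrite addrAC subrr sub0r normrN.
  have [|_ /andP[_ +]] := sub (t + d / 2); first by apply: dO'; rewrite addrAC subrr add0r.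
  by move=> ? ?; apply/andP; split; lra.
have [||t [/= tab tT]] := @Baire R R^o _ dT `]a, b[%classic.
- by exists ((a + b) / 2); rewrite /= in_itv /=; apply/andP; split; lra.
- by apply: interval_open.
rewrite in_itv /= in tab; have [n Tnt] := Tcov _ tab.
apply: (tT n) => //; split => //; rewrite /= in_itv /=.
by case/andP: tab => /ltW-> /ltW->.
Qed.

Section group_tangent.
Variables (R : realType) (N D : nat) (L : {linear 'rV[R]_D -> 'M[R]_N}).
Variables (k : nat) (F : 'rV[R]_k -> 'M[R]_N).
Variables (LE : {linear 'rV[R]_k -> 'M[R]_N}) (r c C : R).
Hypothesis FC : transversal_chart L F LE r c C.
Local Notation K0 := (N.+1%:R : R).
Let K00 : 0 < K0. Proof. by rewrite ltr0n. Qed.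
Let r0 : 0 < r. Proof. by case: FC => -[]. Qed.
Let F0 : F 0 = 1%:M. Proof. by case: FC => _ []. Qed.
Let Fub z z' : `|z| <= r -> `|z'| <= r -> `|F z - F z'| <= C * `|z - z'|.
Proof. by case: FC => _ _ _ h _ zr z'r; case/andP: (h z z' zr z'r). Qed.

Variables (Gr : set 'M[R]_N) (g g' : nat -> 'M[R]_N).
Hypothesis gK : forall n, g n *m g' n = 1%:M.
Hypothesis cover : forall p, Gr p -> exists n,
  exists2 z, `|z| <= r & p = F z *m g n.

(** After translating back by [g' n], a limit point is approximated by values of [F] on the closed
    ball, and by compactness it is such a value. *)
Lemma chart_translate_closed n (a b : R) (q : R -> 'M[R]_N) :
  (forall t, a <= t <= b -> forall e : R, 0 < e -> exists2 d : R, 0 < d &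
     forall s, a <= s <= b -> `|s - t| < d -> `|q t - q s| <= e) ->
  closed [set t | a <= t <= b /\ exists2 z, `|z| <= r & q t = F z *m g n].
Proof.
move=> qc t tcl.
have tab : a <= t <= b.
  have : closed `[a, b]%classic by apply: interval_closed.
  move=> /(_ t); rewrite /= in_itv /=; apply.
  by move=> B /tcl[s [[sab _] Bs]]; exists s; split => //=; rewrite in_itv.
split => //.
have G'0 : 0 < K0 * (`|g' n| + 1) by rewrite mulr_gt0// ltr_wpDl.
have h (e : R) : 0 < e -> exists2 z, `|z| <= r & `|q t *m g' n - F z| <= 0 + e.
  move=> e0; have [d d0 hd] := qc t tab _ (divr_gt0 e0 G'0).
  have [s [[sab [z zr qs]]]] := tcl (ball t d) (nbhsx_ballx t d d0).
  rewrite /ball /= distrC => /(hd _ sab) => h.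
  exists z => //; rewrite add0r.
  have -> : F z = q s *m g' n by rewrite qs -mulmxA gK mulmx1.
  rewrite -mulmxBl (le_trans (norm_mxM _ _))//.
  move: h; rewrite ler_pdivlMr// => h; apply: le_trans h.
  by rewrite mulrAC mulrC; apply: ler_wpM2l => //; rewrite ler_pM2l// lerDl.
have [z zr] := lipschitz_ball_attained (ltW r0) Fub h.
rewrite normr_le0 subr_eq0 => /eqP qz; exists z => //.
by rewrite -qz -mulmxA (mulmx1C (gK n)) mulmx1.
Qed.

Lemma cayley_curve_powers (u : 'M[R]_N) (e : R) : 0 < e ->
  (forall t, 0 < t < e -> 1%:M - t *: u \in unitmx ->
     Gr ((1%:M + t *: u) *m invmx (1%:M - t *: u))) ->
  forall j, range L (u ^+ j.*2.+1).
Proof.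
move=> e0 Gu.
have u0 : 0 < `|u| + 1 by rewrite ltr_wpDl.
(* The expansion of [odd_resolvent u t 0] is a power series in [t ^+ 2] whose coefficients are the
   odd powers of [u]; it suffices to know its value for arbitrarily small [t]. *)
suff h (d : R) : 0 < d -> exists2 t, 0 < t < d &
    K0 * `|t *: u| <= 2^-1 /\ range L (odd_resolvent u t 0).
  apply: (@expansion_coefficients _ _ _ _ _
    (fun m => K0 * (K0 * 2 * 2) * (K0 * `|u|) ^+ m.*2.+1)) => d d0.
  have m0 : 0 < Num.min 1 d by rewrite lt_min ltr01.
  have [t /andP[t0]] := h _ m0.
  rewrite lt_min => /andP[t1 td] [st Lt].
  exists (t ^+ 2).
    rewrite exprn_gt0//= (le_lt_trans _ td)// expr2 -[leRHS]mulr1.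
    by rewrite ler_wpM2l// ltW.
  exists (odd_resolvent u t 0) => // m.
  have t20 : 0 <= (t ^+ 2) ^+ m by rewrite exprn_ge0// sqr_ge0.
  rewrite odd_resolvent_expansion// normrZ (ger0_norm t20) mulrC.
  by rewrite ler_wpM2r//; exact: odd_resolvent_bound.
move=> d0.
pose b := Num.min (Num.min d e / 2) (2 * K0 * (`|u| + 1))^-1.
have b0 : 0 < b by rewrite lt_min invr_gt0 divr_gt0 ?lt_min ?d0//= !mulr_gt0.
have bde : b < Num.min d e.
  apply: (@le_lt_trans _ _ (Num.min d e / 2)); first by rewrite ge_min lexx.
  have : 0 < Num.min d e by rewrite lt_min d0.
  lra.
have small t : 0 < t <= b -> K0 * `|t *: u| <= 2^-1.
  move=> /andP[t0 tb]; rewrite normrZ gtr0_norm//.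
  have : t * (2 * K0 * (`|u| + 1)) <= 1.
    rewrite -ler_pdivlMr ?mulr_gt0// div1r (le_trans tb)//.
    by rewrite ge_min lexx orbT.
  have : 0 <= K0 * t by rewrite mulr_ge0// ltW.
  lra.
pose q t := 2 *: resolvent u t - 1%:M.
have qB s t : K0 * `|s *: u| <= 2^-1 -> K0 * `|t *: u| <= 2^-1 ->
    q s - q t = (s - t) *: (2 *: (resolvent u s *m u *m resolvent u t)).
  move=> ss st; rewrite scalerA mulrC -scalerA -resolvent_eq//.
  by apply/matrixP => i j; rewrite /q !mxE; ring.
pose B := 2 * (K0 * K0 * (2 * `|u| * 2)) + 1.
have B0 : 0 < B by rewrite ltr_wpDl// !mulr_ge0.
have RuR s t : K0 * `|s *: u| <= 2^-1 -> K0 * `|t *: u| <= 2^-1 ->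
    `|2 *: (resolvent u s *m u *m resolvent u t)| <= B.
  move=> /resolventP[_ _ Rs _] /resolventP[_ _ Rt _].
  rewrite normrZ ger0_norm// /B; have := norm_mxM3 Rs (lexx `|u|) Rt; lra.
have b2b : b / 2 < b by lra.
have in0 t : b / 2 <= t <= b -> 0 < t <= b by move=> /andP[? ?]; apply/andP; split; lra.
(* The lower end [b / 2] keeps the interval away from 0, where nothing is assumed about the
   curve. *)
have [||n [t0 [t0b [d1 d10 hd1]]]] := @closed_cover_interval R (b / 2) b
    (fun n => [set t | b / 2 <= t <= b /\ exists2 z, `|z| <= r & q t = F z *m g n]) b2b.
- move=> n; apply: chart_translate_closed => t tb eta eta0.
  exists (eta / B); first exact: divr_gt0.
  move=> s sb; rewrite ltr_pdivlMr// => h.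
  have st := small _ (in0 _ tb); have ss := small _ (in0 _ sb).
  rewrite qB// normrZ distrC (le_trans _ (ltW h))// ler_wpM2l//.
  exact: RuR.
- move=> t tb; have tb' : b / 2 <= t <= b by case/andP: tb => /ltW-> /ltW->.
  have st := small _ (in0 _ tb').
  have [tV _ _ _] := resolventP st.
  have te : 0 < t < e.
    have /andP[-> tb''] /= := in0 _ tb'.
    by rewrite (le_lt_trans tb'')// (lt_le_trans bde)// ge_min lexx orbT.
  have tu : 1%:M - t *: u \in unitmx by have [] := mulmx1_unit tV.
  by have [m hm] := cover (Gu t te tu); exists m; split => //; rewrite /q -cayleyE.
have /in0 t0b' : b / 2 <= t0 <= b by case/andP: t0b => /ltW-> /ltW->.
have st0 := small _ t0b'.
exists t0.
  case/andP: t0b' => -> /= tb; rewrite (le_lt_trans tb)// (lt_le_trans bde)//.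
  by rewrite ge_min lexx.
split => //.
have [_ [z0 z0r qz0]] : b / 2 <= t0 <= b /\ exists2 z, `|z| <= r & q t0 = F z *m g n.
  by apply: hd1; rewrite subrr normr0.
have [tV Vt R2 _] := resolventP st0.
have [tV' Vt' R2' _] := resolventP (smallN st0).
pose RuR0 := resolvent u t0 *m u *m resolvent u t0.
pose Q' := (1%:M - t0 *: u) *m resolvent u (- t0).
have qQ' : q t0 *m Q' = 1%:M.
  rewrite /q -cayleyE// /Q' mulmxA -(mulmxA _ (resolvent u t0)) Vt mulmx1.
  by move: tV'; rewrite scaleNr opprK.
(* [2 *: RuR0] is the velocity of [q] at [t0]. Multiplied by [g' n] it becomes a tangent vector of
   [F] at [z0], and [g n *m Q'] is the inverse of [F z0], so the unknown translate cancels. *)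
have -> : odd_resolvent u t0 0 = 2^-1 *: ((2 *: RuR0) *m g' n *m (g n *m Q')).
  rewrite -!scalemxAl scalerA mulVf ?gt_eqF// scale1r.
  rewrite mulmxA -(mulmxA RuR0) (mulmx1C (gK n)) mulmx1 /RuR0 /Q' mulmxA.
  rewrite -(mulmxA _ (resolvent u t0)) Vt mulmx1 /odd_resolvent expr1.
  rewrite -!mulmxA; congr (_ *m _); rewrite -resolvent_comm//; exact: smallN.
apply: range_linearZ; apply: (tangent_in_range FC z0r).
  by rewrite mulmxA -qz0.
move=> eta eta0.
have G'0 : 0 < K0 * (`|g' n| + 1) by rewrite mulr_gt0// ltr_wpDl.
pose B2 := K0 * K0 * (B * `|u| * 2) + 1.
have B20 : 0 < B2 by rewrite ltr_wpDl// !mulr_ge0// ltW.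
pose s := Num.min (Num.min (eta / 2) (d1 / 2))
  (Num.min ((b - t0) / 2) (eta / (B2 * (K0 * (`|g' n| + 1))))).
have s0 : 0 < s.
  have bt0 : 0 < b - t0 by case/andP: t0b => _; rewrite subr_gt0.
  rewrite !lt_min; apply/andP; split; apply/andP; split; apply: divr_gt0 => //.
  by rewrite !mulr_gt0.
exists s.
  rewrite s0/= (@le_trans _ _ (eta / 2))//; last by lra.
  by rewrite !ge_min lexx.
have sd1 : s <= d1 / 2 by rewrite !ge_min lexx !orbT.
have [|tsb [z zr qz]] := hd1 (t0 + s).
  by rewrite (addrC t0) addrK gtr0_norm//; lra.
have sts := small _ (in0 _ tsb).
exists z => //.
have -> : F z - F z0 - s *: (2 *: RuR0 *m g' n) =
   (q (t0 + s) - q t0 - s *: (2 *: RuR0)) *m g' n.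
  by rewrite (mulmxBl (_ - q t0)) (mulmxBl (q _)) qz qz0 -!mulmxA gK !mulmx1 -(scalemxAl s).
rewrite (le_trans (norm_mxM _ _))//.
have -> : q (t0 + s) - q t0 - s *: (2 *: RuR0) =
    s ^+ 2 *: ((2 *: (resolvent u (t0 + s) *m u *m resolvent u t0)) *m u *m resolvent u t0).
  have est : t0 + s - t0 = s by rewrite addrAC subrr add0r.
  rewrite qB// est -scalerBr -scalerBr -!mulmxBl resolvent_eq// est.
  by rewrite -!scalemxAl !scalerA; congr (_ *: _); ring.
have : `|(2 *: (resolvent u (t0 + s) *m u *m resolvent u t0)) *m u *m resolvent u t0|
    <= B2.
  rewrite /B2; have := norm_mxM3 (RuR _ _ sts st0) (lexx `|u|) R2; lra.
rewrite normrZ normrX (gtr0_norm s0) => h.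
have sB : s * (B2 * (K0 * (`|g' n| + 1))) <= eta.
  by rewrite -ler_pdivlMr ?mulr_gt0// !ge_min lexx !orbT.
apply: (@le_trans _ _ (K0 * (s ^+ 2 * B2) * (`|g' n| + 1))).
  apply: ler_pM => //; last by rewrite lerDl.
    by rewrite !mulr_ge0 ?exprn_ge0// ltW.
  by rewrite ler_pM2l// ler_pM2l// exprn_gt0.
have -> : K0 * (s ^+ 2 * B2) * (`|g' n| + 1) = s * (B2 * (K0 * (`|g' n| + 1))) * s.
  by ring.
by rewrite ler_pM2r.
Qed.

End group_tangent.

(** * Conjugation, brackets and triple products *)

Section adjoint.
Variables (R : realType) (N D : nat) (L : {linear 'rV[R]_D -> 'M[R]_N}).
Local Notation K0 := (N.+1%:R : R).
Let K00 : 0 < K0. Proof. by rewrite ltr0n. Qed.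
Variable H : 'rV[R]_D -> 'M[R]_N.
Hypothesis H0 : H 0 = 1%:M.
Hypothesis Hs : strict_diff H L 0.

(** The curve [A *m H (s *: y) *m A'] runs in the image of [F] and has velocity [A *m L y *m A'] at
    1, so [tangent_in_range] applies at the origin. *)
Lemma conj_range (k : nat) (F : 'rV[R]_k -> 'M[R]_N)
    (LE : {linear 'rV[R]_k -> 'M[R]_N}) (r c C : R) (A A' : 'M[R]_N) :
  transversal_chart L F LE r c C -> A *m A' = 1%:M ->
  (exists2 d : R, 0 < d & forall x, `|x| < d ->
     exists2 z, `|z| <= r & A *m H x *m A' = F z) ->
  forall w, range L w -> range L (A *m w *m A').
Proof.
move=> FC AA [d d0 hd] _ [y _ <-].
have [[r0 _ _] [F0 _] _ _ _] := FC.
rewrite -[_ *m A']mulmx1; apply: (tangent_in_range FC (z0 := 0)).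
- by rewrite normr0 ltW.
- by rewrite F0 mulmx1.
move=> e e0; pose B := K0 * K0 * (`|A| * 1 * `|A'|) + 1.
have B0 : 0 < B by rewrite ltr_wpDl// !mulr_ge0.
have [d' d'0 hd'] := frechet_ray y (strict_diff_frechet Hs) (divr_gt0 e0 B0).
have y0 : 0 < `|y| + 1 by rewrite ltr_wpDl.
pose s := Num.min (e / 2) (Num.min (d' / 2) (d / (2 * (`|y| + 1)))).
have s0 : 0 < s by rewrite !lt_min !divr_gt0 ?mulr_gt0.
exists s; first by rewrite s0 (@le_trans _ _ (e / 2)) ?ge_min ?lexx//; lra.
have sd' : `|s| < d'.
  rewrite gtr0_norm// (@le_lt_trans _ _ (d' / 2))//; last by lra.
  by rewrite !ge_min lexx ?orbT.
have sy : `|s *: y| < d.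
  rewrite normrZ gtr0_norm//.
  have : s * (`|y| + 1) <= d / 2.
    by rewrite -ler_pdivlMr// -mulrA -invfM !ge_min lexx ?orbT.
  lra.
have [z zr hz] := hd _ sy; exists z => //; rewrite -hz F0.
have -> : A *m H (s *: y) *m A' - 1%:M - s *: (A *m L y *m A') =
    A *m (H (s *: y) - 1%:M - s *: L y) *m A'.
  by rewrite !mulmxBr !mulmxBl mulmx1 AA -scalemxAr -scalemxAl.
have := hd' s sd'; rewrite add0r H0 (gtr0_norm s0) => h.
apply: (le_trans (norm_mxM3 (lexx _) h (lexx _))).
have -> : K0 * K0 * (`|A| * (e / B * s) * `|A'|) =
   (K0 * K0 * (`|A| * 1 * `|A'|)) * (e / B * s) by ring.
apply: (@le_trans _ _ (B * (e / B * s))).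
  by rewrite ler_wpM2r ?lerDl// mulr_ge0// ltW// divr_gt0.
by rewrite mulrA mulrCA mulfV ?mulr1// gt_eqF.
Qed.

(** The bracket is the derivative at 0 of the conjugates of [b] by [H (s *: y)]. The difference
    quotient equals [(X *m b - b *m X) *m G], where [X] tends to [a] and the inverse [G] tends to
    1. *)
Lemma bracket_range :
  (forall w, range L w -> exists2 d : R, 0 < d & forall x A', `|x| < d ->
     H x *m A' = 1%:M -> range L (H x *m w *m A')) ->
  forall a b, range L a -> range L b -> range L (a *m b - b *m a).
Proof.
move=> had _ b [y _ <-] Lb; apply: range_closure => e e0.
set a := L y; have [d d0 hd] := had b Lb.
pose B1 := K0 * K0 * (`|a| + 1) * `|b| * 4 + 1.
have B10 : 0 < B1 by rewrite ltr_wpDl// !mulr_ge0// addr_ge0.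
(* [e1] bounds [X - a], which accounts for [e / 2]; the choice of [s] bounds [G - 1], which accounts
   for the rest. *)
pose e1 := Num.min 1 (e / (2 * B1)).
have e10 : 0 < e1 by rewrite lt_min ltr01 divr_gt0// mulr_gt0.
have e11 : e1 <= 1 by rewrite ge_min lexx.
have e12 : 2 * (K0 * `|b|) * e1 <= e / 2.
  have h : B1 * e1 <= e / 2.
    rewrite mulrC -ler_pdivlMr// -mulrA -invfM.
    by rewrite ge_min lexx orbT.
  apply: le_trans h; rewrite ler_pM2r// /B1.
  have K01 : 1 <= K0 by rewrite ler1n.
  have : K0 * `|b| * 1 <= K0 * `|b| * (K0 * (`|a| + 1)).
    rewrite ler_wpM2l ?mulr_ge0//.
    by rewrite -[leLHS]mulr1 ler_pM// lerDr.
  have : 0 <= K0 * `|b| by rewrite mulr_ge0.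
  have -> : K0 * K0 * (`|a| + 1) * `|b| * 4 = K0 * `|b| * (K0 * (`|a| + 1)) * 4.
    by ring.
  lra.
have [d' d'0 hd'] := frechet_ray y (strict_diff_frechet Hs) e10.
have y0 : 0 < `|y| + 1 by rewrite ltr_wpDl.
have A0 : 0 < `|a| + 1 by rewrite ltr_wpDl.
pose B2 := K0 * (2 * (K0 * (`|a| + 1) * `|b|)) * (2 * (K0 * (`|a| + 1))) + 1.
have B20 : 0 < B2 by rewrite ltr_wpDl// !mulr_ge0// addr_ge0.
have K0A : 0 < 2 * (K0 * (`|a| + 1)) by rewrite !mulr_gt0.
pose s := Num.min (Num.min (d / (2 * (`|y| + 1))) (d' / 2))
  (Num.min (2 * (K0 * (`|a| + 1)))^-1 (e / 2 / B2)).
have s0 : 0 < s by rewrite !lt_min invr_gt0 !divr_gt0 ?mulr_gt0.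
have sd' : `|s| < d'.
  rewrite gtr0_norm// (@le_lt_trans _ _ (d' / 2))//; last by lra.
  by rewrite !ge_min lexx ?orbT.
have sy : `|s *: y| < d.
  rewrite normrZ gtr0_norm//.
  have : s * (`|y| + 1) <= d / 2.
    by rewrite -ler_pdivlMr// -mulrA -invfM !ge_min lexx ?orbT.
  lra.
have sK : s * (2 * (K0 * (`|a| + 1))) <= 1.
  by rewrite -ler_pdivlMr// div1r !ge_min lexx ?orbT.
have sB : s * B2 <= e / 2 by rewrite -ler_pdivlMr// !ge_min lexx ?orbT.
have h1 := hd' s sd'; rewrite add0r H0 (gtr0_norm s0) in h1.
have h2 : `|H (s *: y) - 1%:M| <= s * (`|a| + 1).
  rewrite -[_ - 1%:M](subrK (s *: a)) (le_trans (ler_normD _ _))//.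
  rewrite normrZ gtr0_norm// mulrDr mulr1 addrC lerD2l (le_trans h1)//.
  by rewrite -[leRHS]mul1r ler_pM2r.
have h3 : K0 * `|1%:M - H (s *: y)| <= K0 * (s * (`|a| + 1)).
  by rewrite distrC ler_pM2l.
have [|G [HG GH G2 G1]] := @near1_inverse _ _ (H (s *: y)).
  by apply: (le_trans h3); lra.
have {}G1 : `|G - 1%:M| <= s * (2 * (K0 * (`|a| + 1))).
  by apply: (le_trans G1); lra.
pose X := s^-1 *: (H (s *: y) - 1%:M).
have XA : `|X| <= `|a| + 1.
  by rewrite normrZ gtr0_norm ?invr_gt0// ler_pdivrMl.
have Xa : `|X - a| <= e1.
  have -> : X - a = s^-1 *: (H (s *: y) - 1%:M - s *: a).
    by rewrite [RHS]scalerBr scalerA mulVf ?gt_eqF// scale1r.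
  by rewrite normrZ gtr0_norm ?invr_gt0// ler_pdivrMl// mulrC.
exists (s^-1 *: (H (s *: y) *m b *m G - b)).
  by apply/range_linearZ/range_linearB => //; exact: hd.
have -> : s^-1 *: (H (s *: y) *m b *m G - b) = (X *m b - b *m X) *m G.
  have -> : X *m b - b *m X = s^-1 *: (H (s *: y) *m b - b *m H (s *: y)).
    rewrite -scalemxAl -scalemxAr -scalerBr mulmxBl mulmxBr mul1mx mulmx1.
    by rewrite opprB addrA subrK.
  by rewrite -scalemxAl mulmxBl -(mulmxA b) HG mulmx1.
have comm_bound Z z : `|Z| <= z -> `|Z *m b - b *m Z| <= 2 * (K0 * z * `|b|).
  move=> Zz; rewrite (le_trans (ler_normB _ _))// mulr_natl mulr2n.
  have z0 := le_trans (normr_ge0 _) Zz.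
  apply: lerD; rewrite (le_trans (norm_mxM _ _))//.
    by rewrite ler_wpM2r// ler_pM2l.
  by rewrite mulrAC ler_wpM2r// ler_pM2l.
have -> : (X *m b - b *m X) *m G - (a *m b - b *m a) =
    (X *m b - b *m X) *m (G - 1%:M) + ((X - a) *m b - b *m (X - a)).
  rewrite mulmxBr mulmx1 mulmxBl (mulmxBl X) (mulmxBr b X).
  by apply/matrixP => i j; rewrite !mxE; ring.
rewrite (le_trans (ler_normD _ _))//.
have h4 := comm_bound _ _ Xa.
have h5 : `|(X *m b - b *m X) *m (G - 1%:M)| <= s * B2.
  rewrite (le_trans (norm_mxM _ _))//.
  apply: (@le_trans _ _ (K0 * (2 * (K0 * (`|a| + 1) * `|b|)) * (s * (2 * (K0 * (`|a| + 1)))))).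
    by apply: ler_pM => //; rewrite ler_pM2l//; exact: comm_bound.
  by rewrite /B2; have := s0; lra.
lra.
Qed.

(** The cubes of a + b, a - b and b give (aab + aba + baa)/3, while [a, [a, b]] = aab - 2 aba + baa;
    a third of the latter removes the outer terms and raises the coefficient of aba to 1. *)
Lemma triple_range :
  (forall a b, range L a -> range L b -> range L (a *m b - b *m a)) ->
  (forall a, range L a -> range L (a *m a *m a)) ->
  forall a b, range L a -> range L b -> range L (a *m b *m a).
Proof.
move=> brk cube a b La Lb.
have c1 := cube _ (range_linearD La Lb).
have c2 := cube _ (range_linearB La Lb).
have cb := cube _ Lb.
have br := brk _ _ La (brk _ _ La Lb).
suff -> : a *m b *m a = 6^-1 *: ((a + b) *m (a + b) *m (a + b)
   - (a - b) *m (a - b) *m (a - b) - 2 *: (b *m b *m b))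
   - 3^-1 *: (a *m (a *m b - b *m a) - (a *m b - b *m a) *m a).
  apply: range_linearB; apply: range_linearZ => //.
  by apply: range_linearB; [apply: range_linearB|apply: range_linearZ].
rewrite !(mulmxDl, mulmxDr, mulNmx, mulmxN, mulmxA).
move: (a *m a *m a) (a *m a *m b) (a *m b *m a) (b *m a *m a).
move: (a *m b *m b) (b *m a *m b) (b *m b *m a) (b *m b *m b).
by move=> m1 m2 m3 m4 m5 m6 m7 m8; apply/matrixP => i j; rewrite !mxE; field.
Qed.

End adjoint.

(** * Smooth and analytic maps are strictly differentiable *)

Section Cinfty.
Variables (R : realType) (m : nat).

Lemma line_mean_value (f : 'rV[R]_m -> R) (z v : 'rV[R]_m) (a b D e : R) :
  a <= b ->
  (forall t, a <= t <= b -> derivable (f : _ -> R^o) (z + t *: v) v /\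
     `|'D_v f (z + t *: v) - D| <= e) ->
  `|f (z + b *: v) - f (z + a *: v) - (b - a) * D| <= e * (b - a).
Proof.
move=> ab h; pose g (t : R) : R := f (z + t *: v).
have dg t : a <= t <= b -> is_derive t (1 : R) (g : R -> R) ('D_v f (z + t *: v)).
  move=> /h[df _].
  have E : (fun s : R => s^-1 *: ((g \o shift t) (s *: 1) - g t)) =
      (fun s : R => s^-1 *: ((f \o shift (z + t *: v)) (s *: v) - f (z + t *: v))).
    apply/funext => s /=; rewrite /g [s *: 1]mulr1 scalerDl.
    by rewrite (addrCA z (s *: v)).
  by split; rewrite /derivable /derive E.
have gc : {within `[a, b], continuous g}.
  apply: derivable_within_continuous => t; rewrite in_itv /= => tab.
  exact: (@ex_derive _ _ _ _ _ _ _ (dg t tab)).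
have [t tab|t tab] := @MVT_segment R g (fun t => 'D_v f (z + t *: v)) a b ab _ gc.
  by apply: dg; move: tab; rewrite in_itv /= => /andP[/ltW-> /ltW->].
rewrite -/(g b) -/(g a) => ->; rewrite mulrC -mulrBr mulrC.
rewrite normrM (ger0_norm (_ : 0 <= b - a)) ?subr_ge0//.
rewrite ler_wpM2r ?subr_ge0//; apply: (h t _).2.
by move: tab; rewrite in_itv.
Qed.

(** Moving from [y] to [x] one coordinate at a time, the mean value theorem compares each increment
    with the partial derivative at [a]; continuity of the first partials makes this uniform in both
    points. *)
Lemma Cinfty_strict_diff (U : set 'rV[R]_m) (f : 'rV[R]_m -> R) a :
  nbhs a U -> Cinfty U f ->
  strict_diff (f : _ -> R^o)
    (fun v => \sum_i v 0 i * 'D_(delta_mx 0 i) f a) a.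
Proof.
move=> aU fU e e0; pose e' := e / (m.+1)%:R.
have e'0 : 0 < e' by rewrite divr_gt0// ltr0n.
have [d d0 hd] : exists2 d : R, 0 < d & forall x, `|x - a| < d ->
    U x /\ forall i, `|'D_(delta_mx 0 i) f x - 'D_(delta_mx 0 i) f a| <= e'.
  have Ua := nbhs_singleton aU.
  have Da : \forall x \near a,
      forall i : 'I_m, `|'D_(delta_mx 0 i) f x - 'D_(delta_mx 0 i) f a| <= e'.
    apply: (@filter_forall _ _ (fun (i : 'I_m) x =>
      `|'D_(delta_mx 0 i) f x - 'D_(delta_mx 0 i) f a| <= e') (nbhs a) _) => i.
    have [/cvgrPdist_le/(_ e' e'0) + _] := fU [:: i] a Ua.
    by apply: filterS => x; rewrite distrC.
  have /nbhs_ballP[d /= d0 h] : nbhs a (U `&` [set x | forall i : 'I_m,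
      `|'D_(delta_mx 0 i) f x - 'D_(delta_mx 0 i) f a| <= e']) by exact: filterI.
  by exists d => // x xa; apply: h; rewrite -ball_normE /= distrC.
exists d => // x y xd yd.
pose z j : 'rV[R]_m := \row_i (if (i < j)%N then x 0 i else y 0 i).
have z0 : z 0 = y by apply/rowP => i; rewrite mxE.
have zm : z m = x by apply/rowP => i; rewrite mxE ltn_ord.
(* With the coordinate [j] erased, [z j] and [z j.+1] lie on the same line through [w j]. *)
pose w (j : 'I_m) : 'rV[R]_m :=
  \row_i (if i == j then 0 else if (i < j)%N then x 0 i else y 0 i).
have wy j : w j + y 0 j *: delta_mx 0 j = z j.
  apply/rowP => i; rewrite !mxE /=; case: (eqVneq i j) => [->|ij].
    by rewrite ltnn ?eqxx /= ?mulr1 ?add0r.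
  by rewrite mulr0 addr0.
have wx j : w j + x 0 j *: delta_mx 0 j = z j.+1.
  apply/rowP => i; rewrite !mxE /= [in RHS]ltnS.
  case: (eqVneq i j) => [->|ij] /=; first by rewrite leqnn mulr1 add0r.
  by rewrite mulr0 addr0 ltn_neqAle (_ : (i != j :> nat) = true).
(* In the maximum norm a ball is a product of intervals, so mixing coordinates of [x] and [y] does
   not leave it. *)
have wd j t : (y 0 j <= t <= x 0 j) || (x 0 j <= t <= y 0 j) ->
    `|w j + t *: delta_mx 0 j - a| < d.
  move=> tj; pose M := Num.max `|x - a| `|y - a|.
  have Md : M < d by rewrite gt_max xd yd.
  apply: le_lt_trans Md.
  have M0 : 0 <= M by rewrite le_max normr_ge0.
  apply: mx_norm_lub => // i0 i; rewrite (ord1 i0) !mxE /=.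
  have xM k : `|x 0 k - a 0 k| <= M.
    by rewrite le_max; apply/orP; left; have := mx_norm_entry (x - a) 0 k; rewrite !mxE.
  have yM k : `|y 0 k - a 0 k| <= M.
    by rewrite le_max; apply/orP; right; have := mx_norm_entry (y - a) 0 k; rewrite !mxE.
  case: (eqVneq i j) => [->|ij].
    rewrite ?eqxx /= ?mulr1 ?add0r; have := xM j; have := yM j; rewrite !ler_norml.
    by case/orP: tj => /andP[? ?] /andP[? ?] /andP[? ?]; apply/andP; split; lra.
  by rewrite mulr0 addr0; case: ifP.
have step (j : 'I_m) : `|f (z j.+1) - f (z j) - (x - y) 0 j * 'D_(delta_mx 0 j) f a|
    <= e' * `|x - y|.
  have xyj : `|x 0 j - y 0 j| <= `|x - y|.
    by have := mx_norm_entry (x - y) 0 j; rewrite !mxE.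
  have dj t : (y 0 j <= t <= x 0 j) || (x 0 j <= t <= y 0 j) ->
      derivable (f : _ -> R^o) (w j + t *: delta_mx 0 j) (delta_mx 0 j) /\
      `|'D_(delta_mx 0 j) f (w j + t *: delta_mx 0 j) - 'D_(delta_mx 0 j) f a| <= e'.
    by move=> /wd/hd[Uw Dw]; split => //; have [_ /(_ j)] := fU [::] _ Uw.
  rewrite -wx -wy !mxE; have [yx|/ltW xy] := leP (y 0 j) (x 0 j).
    apply: (le_trans (line_mean_value yx (fun t h => dj t (introT orP (or_introl h))))).
    by rewrite ler_pM2l// (le_trans (ler_norm _)).
  have := line_mean_value xy (fun t h => dj t (introT orP (or_intror h))).
  move=> h; have -> : f (w j + x 0 j *: delta_mx 0 j) -
    f (w j + y 0 j *: delta_mx 0 j) - (x 0 j - y 0 j) * 'D_(delta_mx 0 j) f a =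
    - (f (w j + y 0 j *: delta_mx 0 j) - f (w j + x 0 j *: delta_mx 0 j) -
      (y 0 j - x 0 j) * 'D_(delta_mx 0 j) f a) by ring.
  rewrite normrN.
  apply: (le_trans h).
  by rewrite ler_pM2l// (le_trans (ler_norm _))// distrC.
have -> : f x - f y = \sum_(j < m) (f (z j.+1) - f (z j)).
  by rewrite -(big_mkord xpredT (fun j => f (z j.+1) - f (z j))) telescope_sumr// z0 zm.
rewrite -sumrB (le_trans (ler_norm_sum _ _ _))//.
rewrite (le_trans (ler_sum _ (fun j _ => step j)))// sumr_const card_ord.
rewrite -mulr_natl mulrA ler_wpM2r// /e' mulrCA -[leRHS]mulr1 ler_pM2l//.
by rewrite ler_pdivrMr ?ltr0n// mul1r ler_nat.
Qed.

End Cinfty.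

(** * Estimates for power series in several variables *)

Section monomials.
Variable K : numFieldType.

(** The factor [d] on the left avoids the exponent [n.-1] and its special case at 0. *)
Lemma expr_lipschitz (x y d e : K) n : 0 <= d -> `|x| <= d -> `|y| <= d ->
  `|x - y| <= e -> d * `|x ^+ n - y ^+ n| <= n%:R * d ^+ n * e.
Proof.
move=> d0 xd yd xye; elim: n => [|n IHn].
  by rewrite !expr0 subrr normr0 mulr0 !mul0r.
have e0 : 0 <= e by exact: le_trans (normr_ge0 _) xye.
have -> : x ^+ n.+1 - y ^+ n.+1 = x * (x ^+ n - y ^+ n) + (x - y) * y ^+ n.
  by rewrite !exprS; ring.
apply: (@le_trans _ _ (d * (d * `|x ^+ n - y ^+ n|) + d * (e * d ^+ n))).
  rewrite -mulrDr ler_wpM2l// (le_trans (ler_normD _ _))// !normrM normrX.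
  apply: lerD; first by rewrite ler_wpM2r.
  by apply: ler_pM => //; rewrite ?exprn_ge0// lerXn2r// nnegrE.
have -> : n.+1%:R * d ^+ n.+1 * e = d * (n%:R * d ^+ n * e) + d * (e * d ^+ n).
  by rewrite exprS -natr1; ring.
by rewrite lerD2r ler_wpM2l.
Qed.

Lemma monomial_lipschitz (I : Type) (s : seq I) (al : I -> nat) (x y : I -> K)
    (d e : K) :
  0 <= d -> 0 <= e -> (forall i, `|x i| <= d) -> (forall i, `|y i| <= d) ->
  (forall i, `|x i - y i| <= e) ->
  d * `|\prod_(i <- s) x i ^+ al i - \prod_(i <- s) y i ^+ al i| <=
    (\sum_(i <- s) al i)%:R * d ^+ (\sum_(i <- s) al i)%N * e.
Proof.
move=> d0 e0 xd yd xye.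
have bnd (z : I -> K) (t : seq I) : (forall i, `|z i| <= d) ->
    `|\prod_(i <- t) z i ^+ al i| <= d ^+ (\sum_(i <- t) al i)%N.
  move=> zd; elim: t => [|i t IHt]; first by rewrite !big_nil normr1 expr0.
  rewrite !big_cons normrM exprD normrX; apply: ler_pM => //.
  by rewrite lerXn2r// nnegrE.
elim: s => [|i s IHs]; first by rewrite !big_nil subrr normr0 mulr0 !mul0r.
rewrite !big_cons.
set X := \prod_(_ <- _) _; set Y := \prod_(_ <- _) _; set n := (\sum_(_ <- _) _)%N.
have -> : x i ^+ al i * X - y i ^+ al i * Y =
    (x i ^+ al i - y i ^+ al i) * X + y i ^+ al i * (X - Y) by ring.
apply: (@le_trans _ _ ((d * `|x i ^+ al i - y i ^+ al i|) * d ^+ n +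
    d ^+ al i * (d * `|X - Y|))).
  rewrite -mulrA (mulrCA (d ^+ al i)) -mulrDr ler_wpM2l//.
  rewrite (le_trans (ler_normD _ _))// !normrM normrX.
  apply: lerD; first by rewrite ler_wpM2l//; exact: bnd.
  by rewrite ler_wpM2r// lerXn2r// nnegrE.
have -> : (al i + n)%:R * d ^+ (al i + n) * e =
   (al i)%:R * d ^+ al i * e * d ^+ n + d ^+ al i * (n%:R * d ^+ n * e).
  by rewrite natrD exprD; ring.
apply: lerD; last by rewrite ler_wpM2l ?exprn_ge0.
by rewrite ler_wpM2r ?exprn_ge0//; exact: expr_lipschitz.
Qed.

(** The shift by 2 lets the terms of degree 0 and 1 be split off from the partial sums. *)
Lemma series_le_bound (u : nat -> K) (l : K^o) (c b : K) :
  (series u : nat -> K^o) @ \oo --> l ->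
  (forall n, `|series u n.+2 - c| <= b) -> `|l - c| <= b.
Proof.
move=> ul ub; apply/ler_addgt0Pr => e e0.
have /cvgrPdist_le/(_ e e0)[M _ hM] := ul.
have := hM M.+2 (leqW (leqW (leqnn M))) => h.
rewrite -[l - c](subrKA (series u M.+2 : K^o)) (le_trans (ler_normD _ _))//.
by rewrite addrC; exact: lerD.
Qed.

(** Induction needs the sharper bound 4 t (1 - 2^-n): as n + 2 <= 2^(n+1) and t <= 1/4, the next
    term is at most 2 t 2^-n. *)
Lemma weighted_geometric (t : K) n : 0 <= t -> t <= 4^-1 ->
  \sum_(k < n) k.+2%:R * t ^+ k.+1 <= 4 * t.
Proof.
move=> t0 t4; apply: (@le_trans _ _ (4 * t * (1 - 2 ^- n))); last first.
  by rewrite -[leRHS]mulr1 ler_wpM2l ?mulr_ge0// lerBlDr lerDl invr_ge0 exprn_ge0.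
elim: n => [|n IHn]; first by rewrite big_ord0 expr0 invr1 subrr mulr0.
rewrite big_ord_recr /=.
have -> : 4 * t * (1 - 2 ^- n.+1) = 4 * t * (1 - 2 ^- n) + 2 * t * 2 ^- n.
  rewrite exprSr; have : 2 ^+ n != 0 :> K by rewrite expf_neq0.
  by move=> h; field.
rewrite lerD//; have -> : 2 * t * 2 ^- n = t * (2 * 2 ^- n) by rewrite mulrA (mulrC t).
rewrite exprS mulrCA ler_wpM2l//.
apply: (@le_trans _ _ (2 ^+ n.+1 * 4 ^- n)).
  apply: ler_pM => //; first by rewrite exprn_ge0.
    by rewrite -natrX ler_nat; exact: ltn_expl.
  by rewrite -exprVn lerXn2r// nnegrE// invr_ge0.
have -> : 4 = 2 * 2 :> K by rewrite -natrM.
have h : 2 ^+ n != 0 :> K by rewrite expf_neq0.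
by rewrite exprMn exprS; rewrite le_eqVlt; apply/orP; left; apply/eqP; field.
Qed.

End monomials.

Section analytic.
Variables (R : realType) (m : nat).
Local Notation C := R[i].

Lemma degree_sum1_linear (c : ('I_m -> nat) -> C) (h h' : 'rV[C]_m) (s : C) :
  degree_sum (monomial c (s *: h + h')) 1 =
  s * degree_sum (monomial c h) 1 + degree_sum (monomial c h') 1 :> C.
Proof.
rewrite /degree_sum mulr_sumr -big_split /=; apply: eq_bigr => al /eqP al1.
have [j alj] : exists j, forall i, al i = (i == j) :> nat.
  have [j alj] : exists j, (0 < al j)%N.
    apply: contrapT => /forallNP h0; move: al1; rewrite big1// => i _.
    by apply/eqP; rewrite -leqn0 leqNgt; exact/negP.
  exists j => i; move: al1; rewrite (bigD1 j)//=.
  have [-> | ij] := eqVneq i j.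
    by move=> h1; apply/eqP; rewrite eqn_leq alj andbT -[X in (_ <= X)%N]h1 leq_addr.
  rewrite (bigD1 i)//= -(prednK alj) addSn => -[] /eqP.
  by rewrite !addn_eq0 => /and3P[_ /eqP].
have E (z : 'rV[C]_m) : \prod_i z 0 i ^+ al i = z 0 j.
  rewrite (bigD1 j)//= alj eqxx expr1 big1 ?mulr1// => i ij.
  by rewrite alj (negPf ij) expr0.
by rewrite /monomial !E !mxE mulrDr mulrCA.
Qed.

(** The degree 1 part of the series is the derivative; on a polydisc smaller by a factor [th], the
    parts of degree k >= 2 have Lipschitz constants O(k th^(k-1)), with a sum of order [th]. Bounds
    are stated entrywise by real numbers, for later use in real coordinates. *)
Lemma analytic_strict_diff (U : set 'rV[C]_m) (f : 'rV[C]_m -> C) a :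
  analytic U f -> U a -> exists Lam : 'cV[C]_m,
  forall e : R, 0 < e -> exists2 d : R, 0 < d & forall x y : 'rV[C]_m, forall M : R, 0 <= M ->
    (forall i, `|(x - a) 0 i| < d%:C) -> (forall i, `|(y - a) 0 i| < d%:C) ->
    (forall i, `|(x - y) 0 i| <= M%:C) ->
    `|f x - f y - ((x - y) *m Lam) 0 0| <= (e * M)%:C.
Proof.
move=> fU /fU[c [r [r0 hc]]].
pose P k (h : 'rV[C]_m) : C := degree_sum (monomial c h) k.
pose Lam : 'cV[C]_m := \col_i P 1 (delta_mx 0 i).
have P1E h : P 1 h = (h *m Lam) 0 0.
  pose Q : 'rV[C]_m -> C^o := P 1.
  have Qlin : linear Q by move=> s u v; rewrite /Q /P degree_sum1_linear.
  pose QL := HB.pack Q (GRing.isLinear.Build _ _ _ _ Q Qlin) : {linear 'rV[C]_m -> C^o}.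
  have {1}-> : h = \sum_i h 0 i *: delta_mx 0 i by exact: row_sum_delta.
  have -> : P 1 = QL by [].
  rewrite linear_sum mxE; apply: eq_bigr => i _.
  by rewrite linearZ /= mxE.
exists Lam => e e0.
pose rho := r / 2; have rho0 : 0 < rho by rewrite divr_gt0.
(* The absolute parts of degree [k] at polyradius [rho]; they are bounded because their series
   converges, [rho] being less than [r]. *)
pose s k : C := degree_sum (fun al => `|monomial c (const_mx rho%:C) al|) k.
have [S S0 sS] : exists2 S : R, 0 < S & forall k, s k <= S%:C.
  have [|cv _] := hc (const_mx rho%:C).
    move=> i; rewrite mxE ger0_norm ?ler0c ?(ltW rho0)// ltcR /rho; lra.
  have : bounded_fun (s : nat -> C^o).
    by apply: cvg_seq_bounded; apply/cvg_ex; exists 0; exact: cvg_series_cvg_0 cv.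
  move=> /pinfty_ex_gt0[B /ltW B0 hB]; have {}hB k : `|s k| <= B by exact: hB.
  exists (complex.Re B + 1).
    by rewrite ltr_wpDl// -ler0c RRe_real// ger0_real.
  move=> k; rewrite (le_trans (_ : _ <= `|s k|))//.
    apply: real_ler_norm; apply: ger0_real; apply: sumr_ge0 => al _.
    exact: normr_ge0.
  rewrite (le_trans (hB k))// -{1}[B]RRe_real ?ger0_real// lecR lerDl//.
(* [th] is the ratio of the new radius to [rho]: at most 1/4 for [weighted_geometric], and small
   enough for the sum [4 * th * (S / rho)] to be at most [e]. *)
pose th := Num.min 4^-1 (e * rho / (4 * S)).
have th0 : 0 < th by rewrite lt_min invr_gt0 divr_gt0 ?mulr_gt0//= ltr0n.
have th4 : th <= 4^-1 by rewrite ge_min lexx.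
have theS : 4 * th * (S / rho) <= e.
  have : th <= e * rho / (4 * S) by rewrite ge_min lexx orbT.
  rewrite ler_pdivlMr ?mulr_gt0// => h.
  have -> : 4 * th * (S / rho) = th * (4 * S) / rho by ring.
  by rewrite ler_pdivrMr.
exists (th * rho); first by rewrite mulr_gt0.
move=> x y M M0 xd yd xyM.
pose T : C := th%:C; pose Q : C := rho%:C.
have T0 : 0 < T by rewrite ltcR.
have Q0 : 0 < Q by rewrite ltcR.
have TQ : (th * rho)%:C = T * Q by rewrite rmorphM.
pose h := x - a; pose h' := y - a.
pose u k := P k h - P k h'.
have hd i : `|h 0 i| <= T * Q by rewrite -TQ; exact: ltW.
have h'd i : `|h' 0 i| <= T * Q by rewrite -TQ; exact: ltW.
have hh' : h - h' = x - y by rewrite /h /h' opprB addrA subrK.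
have hhM i : `|h 0 i - h' 0 i| <= M%:C.
  by have := xyM i; rewrite -hh' !mxE.
have uk k : T * Q * `|u k| <= k%:R * T ^+ k * (S * M)%:C.
  apply: (@le_trans _ _ (k%:R * T ^+ k * M%:C * s k)); last first.
    by rewrite -mulrA rmorphM (mulrC S%:C) ler_wpM2l// ?mulr_ge0 ?exprn_ge0 ?(ltW T0)//
      ler_wpM2l// ler0c.
  rewrite /u /P /s /degree_sum -sumrB mulr_sumr.
  apply: (le_trans (ler_wpM2l _ (ler_norm_sum _ _ _))); first by rewrite mulr_ge0// ltW.
  rewrite mulr_sumr; apply: ler_sum => al /eqP alk.
  rewrite /monomial -mulrBr !normrM mulrCA.
  have TQ0 : 0 <= T * Q by rewrite mulr_ge0// ltW.
  have M0' : 0 <= M%:C by rewrite ler0c.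
  have := monomial_lipschitz (index_enum 'I_m) (fun i => al i : nat) TQ0 M0' hd h'd hhM.
  move=> /(ler_wpM2l (normr_ge0 (c (fun i => al i : nat)))) hal. apply: (le_trans hal).
  rewrite alk; under [in leRHS]eq_bigr do rewrite mxE.
  rewrite -expr_sum alk normrX (ger0_norm (ltW Q0)) exprMn.
  by rewrite le_eqVlt; apply/orP; left; apply/eqP; ring.
have u0 : u 0%N = 0.
  apply/eqP; rewrite -normr_le0 -(pmulr_rle0 _ (mulr_gt0 T0 Q0)).
  by apply: (le_trans (uk 0%N)); rewrite !mul0r.
have u1 : u 1%N = ((x - y) *m Lam) 0 0.
  have E (A B : 'M[C]_1) : (A - B) 0 0 = A 0 0 - B 0 0 by rewrite !mxE.
  by rewrite /u !P1E -hh' (mulmxBl h h') E.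
have us : (series u : nat -> C^o) @ \oo --> (f x - f y : C^o).
  have lim z : (forall i, `|(z - a) 0 i| < (th * rho)%:C) ->
      series (fun k => P k (z - a)) @ \oo --> (f z : C^o).
    move=> zd; have [|_] := hc (z - a).
      move=> i; rewrite (lt_trans (zd i))// ltcR /rho mulrC.
      have : rho * th <= rho * 4^-1 by rewrite ler_pM2l.
      rewrite /rho; lra.
    by have -> : a + (z - a) = z by rewrite addrC subrK.
  have -> : series u = (fun n => series (fun k => P k h) n - series (fun k => P k h') n).
    by apply/funext => n; rewrite /series /= -sumrB.
  by apply: cvgB; apply: lim.
rewrite -u1; apply: (series_le_bound us) => n.
rewrite /series /= big_mkord big_ord_recl big_ord_recl /= u0 add0r.
rewrite addrC addrA addNr add0r.
rewrite (le_trans (ler_norm_sum _ _ _))//.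
have uk2 k : `|u k.+2| <= (k.+2%:R * T ^+ k.+1) * (S / rho * M)%:C.
  rewrite -(ler_pM2l (mulr_gt0 T0 Q0)) (le_trans (uk _))// le_eqVlt.
  apply/orP; left; apply/eqP.
  rewrite (_ : S / rho * M = S * M / rho); last by ring.
  rewrite [in RHS]rmorphM fmorphV -/Q exprS.
  have : Q != 0 by rewrite gt_eqF.
  by move=> ?; field.
apply: (@le_trans _ _ (\sum_(k < n) (k.+2%:R * T ^+ k.+1) * (S / rho * M)%:C)).
  by apply: ler_sum => k _; exact: uk2.
rewrite -mulr_suml.
have SM0 : 0 <= (S / rho * M)%:C by rewrite ler0c mulr_ge0// ltW// divr_gt0.
apply: (le_trans (ler_wpM2r SM0 (weighted_geometric n (ltW T0) _))).
  by rewrite -(rmorph_nat (real_complex R)) -fmorphV lecR.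
rewrite -(rmorph_nat (real_complex R)) -!rmorphM lecR mulrA.
by rewrite ler_wpM2r.
Qed.

End analytic.

(** * Real coordinates *)

Section realification.
Variables (R : realType) (m : nat).
Local Notation C := R[i].

Definition realify (x : 'rV[C]_m) : 'rV[R]_(m + m) :=
  row_mx (map_mx (@complex.Re R) x) (map_mx (@complex.Im R) x).

Definition complexify (x : 'rV[R]_(m + m)) : 'rV[C]_m :=
  \row_i (x 0 (lshift m i) +i* x 0 (rshift m i)).

Lemma realifyK : cancel realify complexify.
Proof.
move=> x; apply/rowP => i; rewrite mxE row_mxEl row_mxEr !mxE.
by case: (x 0 i).
Qed.

Lemma complexifyK : cancel complexify realify.
Proof.
move=> x; apply/rowP => i; case: (split_ordP i) => j ->.
  by rewrite row_mxEl !mxE.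
by rewrite row_mxEr !mxE.
Qed.

Lemma realifyD x y : realify (x + y) = realify x + realify y.
Proof.
rewrite /realify add_row_mx; congr row_mx; apply/matrixP => i j; rewrite !mxE.
  by case: (x i j) (y i j) => [? ?] [? ?].
by case: (x i j) (y i j) => [? ?] [? ?].
Qed.

Lemma complexifyD x y : complexify (x + y) = complexify x + complexify y.
Proof. by apply: (can_inj realifyK); rewrite realifyD !complexifyK. Qed.

Lemma realifyZ (s : R) x : realify (s%:C *: x) = s *: realify x.
Proof.
rewrite /realify scale_row_mx; congr row_mx; apply/matrixP => i j; rewrite !mxE.
  by case: (x i j) => ? ? /=; ring.
by case: (x i j) => ? ? /=; ring.
Qed.

Lemma complexifyZ (s : R) x : complexify (s *: x) = s%:C *: complexify x.
Proof. by apply: (can_inj realifyK); rewrite realifyZ !complexifyK. Qed.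

Lemma realify0 : realify 0 = 0.
Proof. by rewrite -[0](scale0r (0 : 'rV[C]_m)) -[0]/(0%:C) realifyZ scale0r. Qed.

Lemma realifyN x : realify (- x) = - realify x.
Proof. by apply/eqP; rewrite -addr_eq0 -realifyD addNr realify0. Qed.

Lemma realifyB x y : realify (x - y) = realify x - realify y.
Proof. by rewrite realifyD realifyN. Qed.

Lemma complexifyB x y : complexify (x - y) = complexify x - complexify y.
Proof. by apply: (can_inj realifyK); rewrite realifyB !complexifyK. Qed.

Lemma norm_complexi : `|'i%C : C| = 1.
Proof. by rewrite normc_def /= expr0n expr1n add0r sqrtr1. Qed.

Lemma complex_norm_le (z : C) (M : R) : `|complex.Re z| <= M -> `|complex.Im z| <= M ->
  `|z| <= (2 * M)%:C.
Proof.
move=> Rz Iz; rewrite [z]complexE (le_trans (ler_normD _ _))//.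
have n1 (x : R) : `|x%:C : C| = `|x|%:C by rewrite normc_def /= expr0n addr0 sqrtr_sqr.
rewrite normrM norm_complexi mul1r !n1 -rmorphD lecR; lra.
Qed.

Lemma complexify_entry x i : `|complexify x 0 i| <= (2 * `|x|)%:C.
Proof. by rewrite mxE; apply: complex_norm_le; exact: mx_norm_entry. Qed.

Lemma realify_le (x : 'rV[C]_m) (M : R) : 0 <= M ->
  (forall i, `|x 0 i| <= M%:C) -> `|realify x| <= M.
Proof.
move=> M0 xM; apply: mx_norm_lub => // i0 i; rewrite (ord1 i0).
have h (z : C) : `|z| <= M%:C -> `|complex.Re z| <= M /\ `|complex.Im z| <= M.
  move=> zM; split; first by rewrite -lecR; exact: le_trans (normc_ge_Re _) zM.
  rewrite -lecR; have := normc_ge_Re (z * 'i%C).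
  rewrite ReiNIm normrN => /le_trans; apply; apply: le_trans zM.
  by rewrite normrM norm_complexi mulr1.
case: (split_ordP i) => j ->.
  by rewrite row_mxEl mxE; exact: (h _ (xM j)).1.
by rewrite row_mxEr mxE; exact: (h _ (xM j)).2.
Qed.

Lemma nbhs_complexify (a : 'rV[base_type R BaseC]_m) U : nbhs a U ->
  exists2 d : R, 0 < d & forall x, `|x| < d -> U (a + complexify x).
Proof.
move=> /nbhs_ballP[e /= e0 h].
have er : e = (complex.Re e)%:C by rewrite RRe_real// gtr0_real.
have re0 : 0 < complex.Re e by rewrite -ltcR -er.
exists (complex.Re e / 2); first by rewrite divr_gt0.
move=> x xe; apply: h; rewrite -ball_normE /= opprD addrA subrr sub0r normrN.
apply: (@le_lt_trans _ _ (2 * `|x|)%:C).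
  by apply: mx_norm_lub => [|i j]; rewrite ?ler0c ?mulr_ge0// (ord1 i) complexify_entry.
by rewrite er ltcR; lra.
Qed.

Lemma nbhs_realify (a : 'rV[base_type R BaseC]_m) (d : R) : 0 < d ->
  \forall x \near a, `|realify (x - a)| < d.
Proof.
move=> d0; apply/nbhs_ballP; exists (d / 2)%:C; first by rewrite /= ltcR divr_gt0.
move=> x; rewrite -ball_normE /= distrC => xa.
apply: (@le_lt_trans _ _ (d / 2)); last by lra.
apply: realify_le => [|i]; first by rewrite ltW// divr_gt0.
by apply: le_trans (ltW xa); exact: mx_norm_entry.
Qed.

End realification.

(** * Differentials of vector-valued maps in real coordinates *)

Section vector_valued.
Variable R : realType.
Local Notation C := R[i].

Lemma derive_of_limit (K : numFieldType) (m : nat) (f : 'rV[K]_m -> K) a v (l : K) :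
  (forall e : K, 0 < e -> exists2 d : K, 0 < d & forall s, `|s| < d ->
     `|f (a + s *: v) - f a - s * l| <= e * `|s|) ->
  'D_v (f : _ -> K^o) a = l.
Proof.
move=> h; apply: cvg_lim => //; apply/cvgrPdist_le => e e0.
have [d d0 hd] := h e e0.
near=> s.
have s0 : s != 0 by near: s; exact: nbhs_dnbhs_neq.
have sd : `|s| < d by near: s; exact: dnbhs0_lt.
rewrite /= distrC.
have -> : s^-1 *: (f (s *: v + a) - f a) - l = s^-1 * (f (a + s *: v) - f a - s * l).
  by rewrite [RHS]mulrBr mulKf// (addrC a).
by rewrite (normrM s^-1) normfV ler_pdivrMl ?normr_gt0// (mulrC _ e); exact: hd.
Unshelve. all: by end_near. Qed.

Lemma Cinfty_vector (m n : nat) (U : set 'rV[R]_m) (f : 'rV[R]_m -> 'rV[R]_n) a :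
  nbhs a U -> (forall j, Cinfty U (fun x => f x 0 j)) ->
  exists2 L : {linear 'rV[R]_m -> 'rV[R]_n},
    forall v, L v = \row_j 'D_v (fun x => f x 0 j) a & strict_diff f L a.
Proof.
move=> aU fU.
pose Lam := \matrix_(i, j) 'D_(delta_mx 0 i) (fun x => f x 0 j) a.
have LamE v j : (v *m Lam) 0 j = \sum_i v 0 i * 'D_(delta_mx 0 i) (fun x => f x 0 j) a.
  by rewrite mxE; apply: eq_bigr => i _; rewrite mxE.
have fd e : 0 < e -> exists2 d : R, 0 < d & forall j x y, `|x - a| < d -> `|y - a| < d ->
    `|f x 0 j - f y 0 j - ((x - y) *m Lam) 0 j| <= e * `|x - y|.
  move=> e0; have h j := Cinfty_strict_diff aU (fU j) e0.
  have [d hd] := choice (fun j => let: ex_intro2 d d0 hd := h j in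
     ex_intro (fun d => 0 < d /\ _) d (conj d0 hd)).
  exists (\big[Num.min/1]_j d j).
    by apply/bigmin_gtP; split => // j _; case: (hd j).
  move=> j x y /bigmin_gtP[_ xd] /bigmin_gtP[_ yd]; rewrite LamE.
  by apply: (hd j).2; [exact: xd|exact: yd].
exists (mulmxr Lam : {linear 'rV[R]_m -> 'rV[R]_n}) => [v|].
  apply/rowP => j; rewrite [RHS]mxE; apply/esym; apply: derive_of_limit => e e0.
  have v0 : 0 < `|v| + 1 by rewrite ltr_wpDl.
  have [d d0 hd] := fd _ (divr_gt0 e0 v0).
  exists (d / (`|v| + 1)); first exact: divr_gt0.
  move=> s; rewrite ltr_pdivlMr// => sd.
  have := hd j (a + s *: v) a; rewrite subrr normr0 addrC addKr normrZ.
  have sv : `|s| * `|v| <= `|s| * (`|v| + 1) by rewrite ler_wpM2l// lerDl.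
  move=> /(_ (le_lt_trans sv sd) d0); rewrite -scalemxAl mxE (addrC a) => /le_trans; apply.
  rewrite mulrAC -mulrA ler_wpM2l ?(ltW e0)// ler_pdivrMr//.
move=> e e0; have [d d0 hd] := fd _ e0; exists d => // x y xd yd.
apply: mx_norm_lub => [|i0 j]; first by rewrite mulr_ge0// ltW.
by rewrite (ord1 i0); have := hd j x y xd yd; rewrite !mxE.
Qed.

Lemma analytic_vector (m n : nat) (U : set 'rV[C]_m) (f : 'rV[C]_m -> 'rV[C]_n) a :
  U a -> (forall j, analytic U (fun x => f x 0 j)) ->
  exists2 L : {linear 'rV[R]_(m + m) -> 'rV[R]_(n + n)},
    forall v, L v = realify (\row_j 'D_(complexify v) (fun x => f x 0 j : C^o) a)
    & strict_diff (fun z => realify (f (a + complexify z))) L 0.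
Proof.
move=> aU fU.
have [Lam0 hLam0] := choice (fun j => analytic_strict_diff (fU j) aU).
pose Lam := \matrix_(i, j) Lam0 j i 0.
have LamE v j : (v *m Lam) 0 j = (v *m Lam0 j) 0 0.
  by rewrite !mxE; apply: eq_bigr => i _; rewrite mxE.
have fd (e : R) : 0 < e -> exists2 d : R, 0 < d & forall j, forall x y : 'rV[C]_m,
    forall M : R, 0 <= M ->
    (forall i, `|(x - a) 0 i| < d%:C) -> (forall i, `|(y - a) 0 i| < d%:C) ->
    (forall i, `|(x - y) 0 i| <= M%:C) ->
    `|f x 0 j - f y 0 j - ((x - y) *m Lam) 0 j| <= (e * M)%:C.
  move=> e0; have h j := hLam0 j e e0.
  have [d hd] := choice (fun j => let: ex_intro2 d d0 hd := h j in
     ex_intro (fun d => 0 < d /\ _) d (conj d0 hd)).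
  exists (\big[Num.min/1]_j d j).
    by apply/bigmin_gtP; split => // j _; case: (hd j).
  move=> j x y M M0 xd yd xyM; rewrite LamE.
  have le_d : (\big[Num.min/1]_j d j)%:C <= (d j)%:C by rewrite lecR bigmin_le_cond.
  by apply: (hd j).2 => // i; apply: lt_le_trans le_d.
pose L0 v := realify (complexify v *m Lam).
have Llin : linear L0.
  by move=> s u v; rewrite /L0 complexifyD complexifyZ mulmxDl -scalemxAl realifyD realifyZ.
pose L := HB.pack L0 (GRing.isLinear.Build _ _ _ _ L0 Llin)
  : {linear 'rV[R]_(m + m) -> 'rV[R]_(n + n)}.
exists L => [v|].
  rewrite [LHS]/(L0 v) /L0; congr realify; apply/rowP => j; rewrite [RHS]mxE.
  apply/esym; apply: derive_of_limit => e e0.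
  have er : e = (complex.Re e)%:C by rewrite RRe_real// gtr0_real.
  have re0 : 0 < complex.Re e by rewrite -ltcR -er.
  have v0 : 0 < 2 * (`|v| + 1) by rewrite mulr_gt0// ltr_wpDl.
  have [d d0 hd] := fd _ (divr_gt0 re0 v0).
  exists (d / (2 * (`|v| + 1)))%:C; first by rewrite ltcR divr_gt0.
  move=> s; rewrite [`|s|]normc_def.
  set sn := Num.sqrt _ => ssd.
  have sE : `|s| = sn%:C by rewrite [LHS]normc_def.
  have sn0 : 0 <= sn by exact: sqrtr_ge0.
  rewrite ltcR ltr_pdivlMr// in ssd.
  have sv i : `|(s *: complexify v) 0 i| <= (sn * (2 * `|v|))%:C.
    rewrite mxE normrM sE rmorphM ler_wpM2l ?ler0c//; exact: complexify_entry.
  have lt_d : (sn * (2 * `|v|))%:C < d%:C.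
    by rewrite ltcR; apply: le_lt_trans ssd; rewrite ler_wpM2l//; lra.
  have aa : a + s *: complexify v - a = s *: complexify v by rewrite addrC addKr.
  have := hd j (a + s *: complexify v) a (sn * (2 * `|v|)).
  rewrite aa => /(_ _ _ _ sv) h.
  have {}h := h (mulr_ge0 sn0 (mulr_ge0 (ler0n _ 2) (normr_ge0 v))).
  have {}h := h (fun i => le_lt_trans (sv i) lt_d).
  have {}h : `|f (a + s *: complexify v) 0 j - f a 0 j - (s *: complexify v *m Lam) 0 j|
    <= (complex.Re e / (2 * (`|v| + 1)) * (sn * (2 * `|v|)))%:C.
    by apply: h => i; rewrite subrr mxE normr0 ltcR.
  have -> : s * (complexify v *m Lam) 0 j = (s *: complexify v *m Lam) 0 j.
    by rewrite -scalemxAl [RHS]mxE.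
  apply: (le_trans h); rewrite er -rmorphM lecR /=.
  rewrite mulrAC -mulrA ler_pM2l// ler_pdivrMr// ler_wpM2l//; lra.
move=> e e0; have e20 : 0 < e / 2 by rewrite divr_gt0.
have [d d0 hd] := fd _ e20; exists (d / 2); first exact: divr_gt0.
move=> x y; rewrite !subr0 => xd yd.
have lt (z : 'rV[R]_(m + m)) : `|z| < d / 2 ->
    forall i, `|(a + complexify z - a) 0 i| < d%:C.
  move=> zd i; rewrite (addrC a) addrK; apply: (le_lt_trans (complexify_entry _ _)).
  by rewrite ltcR; lra.
have E : (a + complexify x) - (a + complexify y) = complexify (x - y).
  by rewrite opprD addrACA subrr add0r complexifyB.
rewrite -realifyB [L _]/(L0 _) /L0 -realifyB; apply: realify_le.
  by rewrite mulr_ge0// ltW.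
move=> j; have := hd j (a + complexify x) (a + complexify y) (2 * `|x - y|).
rewrite E => h; have {}h := h (mulr_ge0 (ler0n _ 2) (normr_ge0 _)) (lt _ xd) (lt _ yd).
have {}h := h (fun i => complexify_entry (x - y) i).
rewrite -[f _ - f _]/(f _ - f _) !mxE in h *.
by apply: le_trans h _; rewrite lecR; lra.
Qed.

End vector_valued.

Section strict_diff_composition.
Variables (R : realType) (D : nat).

Lemma strict_diff_shift (X Y : normedModType R) (f L : X -> Y) a :
  strict_diff f L a -> strict_diff (fun z => f (a + z)) L 0.
Proof.
move=> h e e0; have [d d0 hd] := h e e0; exists d => // x y.
rewrite !subr0 => xd yd.
have := hd (a + x) (a + y).
have -> : (a + x) - (a + y) = x - y by rewrite opprD addrACA subrr add0r.
by rewrite -!(addrC x) -!(addrC y) !addrK; exact.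
Qed.

Lemma linear_strict_diff (m n : nat) (X : normedModType R) (f L : X -> 'rV[R]_D)
    (T : {linear 'rV[R]_D -> 'M[R]_(m, n)}) a :
  strict_diff f L a -> strict_diff (T \o f) (T \o L) a.
Proof.
move=> h e e0; have [C C0 TC] := linear_bound T.
have [d d0 hd] := h (e / C) (divr_gt0 e0 C0); exists d => // x y xd yd.
rewrite /= -!raddfB (le_trans (TC _))// -ler_pdivlMl// mulrA (mulrC C^-1).
exact: hd.
Qed.

End strict_diff_composition.

Section real_coordinates.
Variables (R : realType) (F : base_field).
Local Notation K := (base_type R F).

(** From here on the two base fields are treated by a single argument over the reals. *)
Definition rdim (m : nat) := match F with BaseR => m | BaseC => (m + m)%N end.

Definition to_real (m : nat) : 'rV[K]_m -> 'rV[R]_(rdim m) :=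
  match F return 'rV[base_type R F]_m ->
    'rV[R]_(match F with BaseR => m | BaseC => (m + m)%N end) with
  | BaseR => id | BaseC => @realify R m end.

Definition of_real (m : nat) : 'rV[R]_(rdim m) -> 'rV[K]_m :=
  match F return 'rV[R]_(match F with BaseR => m | BaseC => (m + m)%N end) ->
    'rV[base_type R F]_m with
  | BaseR => id | BaseC => @complexify R m end.

End real_coordinates.

Section real_coordinates_theory.
Variables (R : realType) (F : base_field) (m : nat).
Local Notation K := (base_type R F).
Local Notation to_real := (@to_real R F m).
Local Notation of_real := (@of_real R F m).

Lemma of_realK : cancel of_real to_real.
Proof. by case: F => // x; exact: complexifyK. Qed.

Lemma to_realK : cancel to_real of_real.
Proof. by case: F => // x; exact: realifyK. Qed.

Lemma of_realD x y : of_real (x + y) = of_real x + of_real y.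
Proof. by case: F x y => // x y; exact: complexifyD. Qed.

Lemma of_realB x y : of_real (x - y) = of_real x - of_real y.
Proof. by case: F x y => // x y; exact: complexifyB. Qed.

Lemma to_realB x y : to_real (x - y) = to_real x - to_real y.
Proof. by case: F x y => // x y; exact: realifyB. Qed.

Lemma of_real0 : of_real 0 = 0.
Proof. by rewrite -[X in of_real X](subrr 0) of_realB subrr. Qed.

Lemma nbhs_of_real (a : 'rV[K]_m) U : nbhs a U ->
  exists2 d : R, 0 < d & forall x, `|x| < d -> U (a + of_real x).
Proof.
case: F a U => [a U|a U]; last exact: nbhs_complexify.
move=> /nbhs_ballP[d /= d0 h]; exists d => // x xd.
by apply: h; rewrite -ball_normE /= opprD addrA subrr sub0r normrN.
Qed.

Lemma nbhs_to_real (a : 'rV[K]_m) (d : R) : 0 < d ->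
  \forall x \near a, `|to_real (x - a)| < d.
Proof.
case: F a => [a|a]; last exact: nbhs_realify.
by move=> d0; apply/nbhs_ballP; exists d => // x; rewrite -ball_normE /= distrC.
Qed.

End real_coordinates_theory.

Section smooth_strict_diff.
Variables (R : realType) (F : base_field).
Local Notation K := (base_type R F).

Lemma smooth_map_strict_diff m n (U : set 'rV[K]_m) (f : 'rV[K]_m -> 'rV[K]_n)
    (a : 'rV[K]_m) :
  nbhs a U -> smooth_map U f ->
  exists L : {linear 'rV[R]_(rdim F m) -> 'rV[R]_(rdim F n)},
    strict_diff (fun z => to_real (f (a + of_real z))) L 0.
Proof.
case: F U f a => U f a aU fU.
  have [L _ h] := Cinfty_vector aU fU.
  by exists L; exact: strict_diff_shift.
by have [L _ h] := analytic_vector (nbhs_singleton aU) fU; exists L.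
Qed.

Lemma smooth_cfun_strict_diff m n (U : set 'rV[K]_m) (f : 'rV[K]_m -> 'rV[R[i]]_n)
    (a : 'rV[K]_m) :
  nbhs a U -> (forall j, smooth_cfun U (fun x => f x 0 j)) ->
  exists2 L : {linear 'rV[R]_(rdim F m) -> 'rV[R]_(n + n)},
    forall v, L v = realify (\row_j cderive (fun x => f x 0 j) a (of_real v)) &
    strict_diff (fun z => realify (f (a + of_real z))) L 0.
Proof.
case: F U f a => U f a aU fU; last exact: analytic_vector (nbhs_singleton aU) fU.
have El j : (fun x => realify (f x) 0 (lshift n j)) = (fun x => complex.Re (f x 0 j)).
  by apply/funext => x; rewrite row_mxEl mxE.
have Er j : (fun x => realify (f x) 0 (rshift n j)) = (fun x => complex.Im (f x 0 j)).
  by apply/funext => x; rewrite row_mxEr mxE.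
have [|L LE h] := @Cinfty_vector R m (n + n) U (fun x => realify (f x)) a aU.
  move=> j; case: (split_ordP j) => {}j ->; first by rewrite El; case: (fU j).
  by rewrite Er; case: (fU j).
exists L; last exact: (strict_diff_shift h).
move=> v; rewrite LE; apply/rowP => j; rewrite mxE.
case: (split_ordP j) => {}j ->.
  by rewrite row_mxEl !mxE El.
by rewrite row_mxEr !mxE Er.
Qed.

Lemma slice_linear m : exists T : {linear 'rV[R]_(rdim F m) -> 'rV[R]_(rdim F (m + m))},
  forall z, of_real (T z) = row_mx (of_real z) 0 :> 'rV[K]_(m + m).
Proof.
case: F.
  pose T0 (z : 'rV[R]_m) : 'rV[R]_(m + m) := row_mx z 0.
  have Tlin : linear T0.
    by move=> s u v; rewrite /T0 scale_row_mx add_row_mx scaler0 addr0.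
  pose T := HB.pack T0 (GRing.isLinear.Build _ _ _ _ T0 Tlin)
    : {linear 'rV[R]_m -> 'rV[R]_(m + m)}.
  by exists T.
pose T0 (z : 'rV[R]_(m + m)) : 'rV[R]_(m + m + (m + m)) :=
  realify (row_mx (complexify z) 0).
have Tlin : linear T0.
  move=> s u v; rewrite /T0 complexifyD complexifyZ -realifyZ -realifyD.
  by rewrite scale_row_mx add_row_mx scaler0 addr0.
pose T := HB.pack T0 (GRing.isLinear.Build _ _ _ _ T0 Tlin)
  : {linear 'rV[R]_(m + m) -> 'rV[R]_(m + m + (m + m))}.
by exists T => z; exact: realifyK.
Qed.

(** For the group multiplication read in charts, with the right factor frozen. *)
Lemma smooth_slice_strict_diff m n (U : set 'rV[K]_(m + m))
    (f : 'rV[K]_(m + m) -> 'rV[K]_n) (a b : 'rV[K]_m) :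
  nbhs (row_mx a b) U -> smooth_map U f ->
  exists L : {linear 'rV[R]_(rdim F m) -> 'rV[R]_(rdim F n)},
    strict_diff (fun z => to_real (f (row_mx (a + of_real z) b))) L 0.
Proof.
move=> abU fU; have [L h] := smooth_map_strict_diff abU fU.
have [T TE] := slice_linear m.
have := strict_diff_mulmx (lin1_mx T) h.
exists (L \o mulmxr (lin1_mx T) : {linear _ -> _}).
have -> // : (fun z => to_real (f (row_mx (a + of_real z) b))) =
  (fun z => to_real (f (row_mx a b + of_real z))) \o mulmxr (lin1_mx T).
apply/funext => z /=; rewrite mul_rV_lin1 TE.
by rewrite add_row_mx addr0.
Qed.

End smooth_strict_diff.

(** * Endomorphisms as real matrices *)

Section endomorphism_matrix.
Variables (R : realType) (V : vectType R[i]).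
Local Notation n := (\dim {: 'End(V)}).

Definition end_vec (f : 'End(V)) : 'rV[R]_(n + n) := realify (\row_j ecoord j f).

Definition vec_end (x : 'rV[R]_(n + n)) : 'End(V) :=
  \sum_j complexify x 0 j *: (vbasis {: 'End(V)})`_j.

Lemma vec_endP (x : 'rV[R[i]]_n) :
  vec_end (realify x) = \sum_j x 0 j *: (vbasis {: 'End(V)})`_j.
Proof. by rewrite /vec_end realifyK. Qed.

Lemma end_vecK : cancel end_vec vec_end.
Proof.
move=> f; rewrite vec_endP [RHS](coord_vbasis (memvf f)).
by apply: eq_bigr => j _; rewrite mxE.
Qed.

Lemma vec_endK : cancel vec_end end_vec.
Proof.
move=> x; rewrite /end_vec -[RHS]complexifyK; congr realify.
apply/rowP => j; rewrite mxE /ecoord /vec_end coord_sum_free//.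
exact: (basis_free (vbasisP _)).
Qed.

Lemma end_vecD f g : end_vec (f + g) = end_vec f + end_vec g.
Proof.
rewrite /end_vec -realifyD; congr realify; apply/rowP => j; rewrite !mxE.
exact: linearD.
Qed.

Lemma end_vecZ (s : R) f : end_vec (s%:C *: f) = s *: end_vec f.
Proof.
rewrite /end_vec -realifyZ; congr realify; apply/rowP => j; rewrite !mxE.
exact: linearZ.
Qed.

Lemma vec_endD x y : vec_end (x + y) = vec_end x + vec_end y.
Proof. by apply: (can_inj end_vecK); rewrite end_vecD !vec_endK. Qed.

Lemma vec_endZ (s : R) x : vec_end (s *: x) = s%:C *: vec_end x.
Proof. by apply: (can_inj end_vecK); rewrite end_vecZ !vec_endK. Qed.

(* Right multiplication by f, since matrices act on row vectors: this makes
   end_mx multiplicative rather than antimultiplicative. *)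
Definition end_mx (f : 'End(V)) : 'M[R]_(n + n) :=
  lin1_mx (fun x => end_vec (vec_end x \o f)%VF).

Lemma end_mxE x f : x *m end_mx f = end_vec (vec_end x \o f)%VF.
Proof.
pose g x : 'rV[R]_(n + n) := end_vec (vec_end x \o f)%VF.
have glin : linear g.
  move=> s u v; rewrite /g vec_endD vec_endZ comp_lfunDl -comp_lfunZl.
  by rewrite end_vecD end_vecZ.
pose G := HB.pack g (GRing.isLinear.Build _ _ _ _ g glin)
  : {linear 'rV[R]_(n + n) -> 'rV[R]_(n + n)}.
exact: (mul_rV_lin1 G).
Qed.

Lemma end_mx_ext (A B : 'M[R]_(n + n)) :
  (forall x : 'rV[R]_(n + n), x *m A = x *m B) -> A = B.
Proof. by move=> h; apply/row_matrixP => i; rewrite !rowE. Qed.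

Lemma end_mxM f g : end_mx (f \o g)%VF = end_mx f *m end_mx g.
Proof.
apply: end_mx_ext => x; rewrite mulmxA !end_mxE end_vecK.
by rewrite comp_lfunA.
Qed.

Lemma end_mx1 : end_mx \1%VF = 1%:M.
Proof. by apply: end_mx_ext => x; rewrite end_mxE comp_lfun1r vec_endK mulmx1. Qed.

Lemma end_mxD f g : end_mx (f + g) = end_mx f + end_mx g.
Proof. by apply: end_mx_ext => x; rewrite mulmxDr !end_mxE comp_lfunDr end_vecD. Qed.

Lemma end_mxZ (s : R) f : end_mx (s%:C *: f) = s *: end_mx f.
Proof.
by apply: end_mx_ext => x; rewrite -scalemxAr !end_mxE -comp_lfunZr end_vecZ.
Qed.

Lemma end_mxN f : end_mx (- f) = - end_mx f.
Proof. by rewrite -scaleN1r -[-1](rmorphN1 (real_complex R)) end_mxZ scaleN1r. Qed.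

Lemma end_mxB f g : end_mx (f - g) = end_mx f - end_mx g.
Proof. by rewrite end_mxD end_mxN. Qed.

(** Evaluation at the identity recovers [f]; this is why the regular representation is faithful. *)
Lemma end_mx_vec f : end_vec \1%VF *m end_mx f = end_vec f.
Proof. by rewrite end_mxE end_vecK comp_lfun1l. Qed.

Lemma end_mx_inj : injective end_mx.
Proof.
by move=> f g fg; apply: (can_inj end_vecK); rewrite -(end_mx_vec f) fg end_mx_vec.
Qed.

Lemma end_mxX f k : end_mx (endo_exp f k) = end_mx f ^+ k.
Proof.
elim: k => [|k IHk]; first exact: end_mx1.
by rewrite /endo_exp /= -/(endo_exp f k) end_mxM IHk exprS.
Qed.

Lemma end_mx_linear : exists T : {linear 'rV[R]_(n + n) -> 'M[R]_(n + n)},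
  forall x, T x = end_mx (vec_end x).
Proof.
pose g x := end_mx (vec_end x).
have glin : linear g by move=> s u v; rewrite /g vec_endD vec_endZ end_mxD end_mxZ.
pose G := HB.pack g (GRing.isLinear.Build _ _ _ _ g glin)
  : {linear 'rV[R]_(n + n) -> 'M[R]_(n + n)}.
by exists G.
Qed.

(** For the converse, an inverse matrix need not be multiplication by an endomorphism a priori, but
    its value at the identity is an endomorphism, and a left inverse of [f]. *)
Lemma end_mx_invertible f : (endo_invertible f) <-> (end_mx f \in unitmx).
Proof.
split=> [f0|fu].
  have : end_mx f^-1%VF *m end_mx f = 1%:M.
    by rewrite -end_mxM (lker0_compVf f0) end_mx1.
  by move=> /mulmx1_unit[].
pose e := vec_end (end_vec \1%VF *m invmx (end_mx f)).
have ef : (e \o f)%VF = \1%VF.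
  apply: (can_inj end_vecK); rewrite -[RHS](mulmxKV fu).
  by rewrite end_mxE.
apply/eqP/eqP; rewrite -subv0; apply/subvP => x; rewrite memv_ker memv0 => /eqP fx.
by rewrite -[x]id_lfunE -ef comp_lfunE fx linear0.
Qed.

Lemma end_mx_cayley u : 1%:M - end_mx u \in unitmx ->
  end_mx (cayley u) = (1%:M + end_mx u) *m invmx (1%:M - end_mx u).
Proof.
rewrite -end_mx1 -end_mxB => uu; rewrite /cayley end_mxM end_mxD; congr (_ *m _).
have /lker0_compVf Vf : endo_invertible (\1 - u)%VF by apply/end_mx_invertible.
by rewrite -[LHS](mulmxK uu) -end_mxM Vf end_mx1 mul1mx.
Qed.

End endomorphism_matrix.

(** * Charts of a Lie group at the identity *)

Section submatrix_continuity.
Variables (K : numFieldType) (m n : nat).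

Lemma lsubmx_continuous : continuous (lsubmx : 'rV[K]_(m + n) -> 'rV[K]_m).
Proof.
move=> z P /nbhs_ballP[e e0 h]; apply/nbhs_ballP; exists e => // y.
rewrite -ball_normE /= => yz; apply: h; rewrite -ball_normE /=.
apply: le_lt_trans yz; apply: mx_norm_lub => // i j.
by have := mx_norm_entry (z - y) i (lshift n j); rewrite !mxE.
Qed.

Lemma rsubmx_continuous : continuous (rsubmx : 'rV[K]_(m + n) -> 'rV[K]_n).
Proof.
move=> z P /nbhs_ballP[e e0 h]; apply/nbhs_ballP; exists e => // y.
rewrite -ball_normE /= => yz; apply: h; rewrite -ball_normE /=.
apply: le_lt_trans yz; apply: mx_norm_lub => // i j.
by have := mx_norm_entry (z - y) i (rshift m j); rewrite !mxE.
Qed.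

Lemma row_mx_continuousl (b : 'rV[K]_n) :
  continuous (fun y : 'rV[K]_m => row_mx y b).
Proof.
move=> z P /nbhs_ballP[e e0 h]; apply/nbhs_ballP; exists e => // y.
rewrite -ball_normE /= => yz; apply: h; rewrite -ball_normE /=.
apply: le_lt_trans yz; rewrite opp_row_mx add_row_mx subrr.
apply: mx_norm_lub => // i j; case: (split_ordP j) => {}j ->.
  by rewrite row_mxEl; exact: mx_norm_entry.
by rewrite row_mxEr mxE normr0.
Qed.

End submatrix_continuity.

Section lie_group.
Variables (R : realType) (F : base_field) (G : lieGroup R F).
Variable phi : chart R F (lie_dim G) G.
Hypothesis phi1 : chart_at_1 phi.
Local Notation K := (base_type R F).
Local Notation D := (rdim F (lie_dim G)).

Definition local_point (z : 'rV[R]_D) : G := chart_inv phi (phi 1%g + of_real z).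

Lemma local_point0 : local_point 0 = 1%g.
Proof. by rewrite /local_point of_real0 addr0 chart_mapK//; case: phi1. Qed.

Lemma local_pointE p : chart_dom phi p -> local_point (to_real (phi p - phi 1%g)) = p.
Proof.
by move=> dp; rewrite /local_point to_realK addrC subrK chart_mapK.
Qed.

Lemma nbhs_local_point (r : R) : 0 < r ->
  nbhs (1%g : G) [set p | exists2 z, `|z| < r & p = local_point z].
Proof.
move=> r0; have [_ d1] := phi1.
have h1 : nbhs (1%g : G) (chart_dom phi).
  by apply: open_nbhs_nbhs; split => //; exact: chart_dom_open.
have h2 := chart_map_continuous d1 (nbhs_to_real (phi 1%g) r0).
apply: filterS (filterI h1 h2) => p [dp /= pr].
by exists (to_real (phi p - phi 1%g)) => //; rewrite local_pointE.
Qed.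

Lemma local_point_continuous : {for 0, continuous local_point}.
Proof.
have [_ d1] := phi1.
move=> P; rewrite local_point0 => P1.
have im1 : (phi @` chart_dom phi) (phi 1%g) by exists 1%g.
have := chart_inv_continuous im1; rewrite /= => /(_ P).
rewrite chart_mapK// => /(_ P1) /nbhs_of_real[d d0 h].
apply/nbhs_ballP; exists d => // z; rewrite -ball_normE /= sub0r normrN => zd.
exact: h.
Qed.

Lemma local_conjugate (g : G) (r : R) : 0 < r ->
  exists2 d : R, 0 < d & forall z, `|z| < d ->
    exists2 y, `|y| < r & (g * local_point z * g^-1)%g = local_point y.
Proof.
move=> r0.
have c1 : continuous (fun p : G => (g * p * g^-1)%g).
  move=> p; apply: (@continuous_comp _ _ _ (fun p : G => ((g * p)%g, g^-1%g))
    (fun q : G * G => (q.1 * q.2)%g)); last exact: lie_mul_continuous.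
  apply: cvg_pair; last exact: cvg_cst.
  apply: (@continuous_comp _ _ _ (fun p : G => (g, p))
    (fun q : G * G => (q.1 * q.2)%g)); last exact: lie_mul_continuous.
  by apply: cvg_pair; [exact: cvg_cst|exact: cvg_id].
have N1 := nbhs_local_point r0.
have : nbhs (0 : 'rV[R]_D) [set z | exists2 y, `|y| < r &
    (g * local_point z * g^-1)%g = local_point y].
  have h : {for 0, continuous ((fun p : G => (g * p * g^-1)%g) \o local_point)}.
    by apply: continuous_comp; [exact: local_point_continuous|exact: c1].
  apply: (h [set p | exists2 y, `|y| < r & p = local_point y]).
  by rewrite /= local_point0 mulg1 mulgV.
move=> /nbhs_ballP[d /= d0 h]; exists d => // z zd.
by apply: h; rewrite -ball_normE /= sub0r normrN.
Qed.

(** One point [g n] is picked in each member of a countable base. Since [p * q^-1] is near 1 for [q]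
    near [p], a small base set around [p] provides a [g n] with [p * (g n)^-1] in the chart ball. *)
Lemma countable_translates (r : R) : 0 < r -> exists g : nat -> G,
  forall p, exists n, exists2 z, `|z| < r & p = (local_point z * g n)%g.
Proof.
move=> r0.
have [B cB [Bo Bb]] := manifold_second_countable (lie_manifold G).
have [f fP] : exists f : nat -> set G, forall b, B b -> exists n, f n = b.
  have [inj injP] := elimT (countable_injP _) cB.
  exists (fun n => xget set0 [set b | B b /\ inj b = n]) => b Bb'; exists (inj b).
  have [] : [set b' | B b' /\ inj b' = inj b] (xget set0 [set b' | B b' /\ inj b' = inj b]).
    by apply: xgetPex; exists b.
  by move=> Bx /injP; apply; rewrite inE.
(* The default 1 is used only when [f n] is empty, which a base set containing [p] is not. *)
pose g n : G := xget 1%g (f n).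
exists g => p.
have c1 : continuous (fun q : G => (p * q^-1)%g).
  move=> q; apply: (@continuous_comp _ _ _ (fun q : G => (p, q^-1%g))
    (fun q : G * G => (q.1 * q.2)%g)); last exact: lie_mul_continuous.
  by apply: cvg_pair; [exact: cvg_cst|exact: lie_inv_continuous].
have : nbhs p [set q : G | exists2 z, `|z| < r & (p * q^-1)%g = local_point z].
  have /(c1 p) // : nbhs (p * p^-1)%g [set q : G | exists2 z, `|z| < r & q = local_point z].
  by rewrite mulgV; exact: nbhs_local_point.
move=> /Bb[b [/= Bb' bp] bsub].
have [n fn] := fP _ Bb'.
have : f n (g n) by apply: (@xgetPex _ 1%g (f n)); exists p; rewrite fn.
rewrite fn => /bsub[z zr pz]; exists n, z => //.
by rewrite -pz mulgVK.
Qed.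

End lie_group.

(** [th 0] is subtracted because [H] is written in coordinates centred at the identity. *)
Lemma strict_diff_chain (R : realType) (D D' N : nat) (H : 'rV[R]_D' -> 'M[R]_N)
    (L : {linear 'rV[R]_D' -> 'M[R]_N}) (th : 'rV[R]_D -> 'rV[R]_D')
    (M : {linear 'rV[R]_D -> 'rV[R]_D'}) :
  strict_diff H L 0 -> strict_diff th M 0 ->
  frechet (fun z => H (th z - th 0)) (L \o M) 0.
Proof.
move=> hH hth e e0.
have [CL CL0 CLb] := linear_bound L; have [CM CM0 CMb] := linear_bound M.
have [d1 d10 hd1] := hH _ (divr_gt0 (divr_gt0 e0 (ltr0n _ 2)) (addr_gt0 CM0 ltr01)).
have e10 : 0 < Num.min 1 (e / 2 / CL) by rewrite lt_min ltr01 !divr_gt0.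
have [d2 d20 hd2] := hth _ e10.
have CM10 : 0 < CM + 1 by rewrite addr_gt0.
exists (Num.min d2 (d1 / (CM + 1))); first by rewrite lt_min d20 divr_gt0.
move=> x; rewrite !subr0 lt_min ltr_pdivlMr// => /andP[xd2 xd1].
have := hd2 x 0; rewrite !subr0 normr0 => /(_ xd2 d20) hx.
have hx1 : `|th x - th 0 - M x| <= `|x|.
  by rewrite (le_trans hx)// -[leRHS]mul1r ler_wpM2r// ge_min lexx.
have hx2 : CL * `|th x - th 0 - M x| <= e / 2 * `|x|.
  rewrite -ler_pdivlMl// (le_trans hx)// mulrA (mulrC CL^-1) ler_wpM2r//.
  by rewrite ge_min lexx orbT.
have thx : `|th x - th 0| <= (CM + 1) * `|x|.
  rewrite -[th x - th 0](subrK (M x)) (le_trans (ler_normD _ _))//.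
  by rewrite mulrDl mul1r addrC lerD.
have := hd1 (th x - th 0) 0; rewrite !subr0 normr0.
move=> /(_ (le_lt_trans thx _) d10) h.
have {}h : `|H (th x - th 0) - H 0 - L (th x - th 0)| <=
    e / 2 / (CM + 1) * `|th x - th 0| by apply: h; rewrite mulrC.
have h2 : e / 2 / (CM + 1) * `|th x - th 0| <= e / 2 * `|x|.
  rewrite mulrAC ler_pdivrMr//.
  have : e / 2 * `|th x - th 0| <= e / 2 * ((CM + 1) * `|x|).
    by rewrite ler_wpM2l// ltW// divr_gt0.
  lra.
rewrite subrr /=.
have -> : H (th x - th 0) - H 0 - L (M x) =
   (H (th x - th 0) - H 0 - L (th x - th 0)) + L (th x - th 0 - M x).
  by rewrite [X in _ = _ + X]raddfB addrA subrK.
rewrite (le_trans (ler_normD _ _))//.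
have := CLb (th x - th 0 - M x); lra.
Qed.

Section representation.
Variables (R : realType) (F : base_field) (G : lieGroup R F).
Variables (V : vectType R[i]) (rho : G -> 'End(V)).
Hypothesis rho_rep : representation rho.
Variable phi : chart R F (lie_dim G) G.
Hypothesis phi1 : chart_at_1 phi.
Local Notation K := (base_type R F).
Local Notation D := (rdim F (lie_dim G)).
Local Notation n := (\dim {: 'End(V)}).

Definition rep_mx (g : G) : 'M[R]_(n + n) := end_mx (rho g).

Lemma rep_mx1 : rep_mx 1%g = 1%:M.
Proof. by case: rho_rep => r1 _ _; rewrite /rep_mx r1 end_mx1. Qed.

Lemma rep_mxM g h : rep_mx (g * h)%g = rep_mx g *m rep_mx h.
Proof. by case: rho_rep => _ rM _; rewrite /rep_mx rM end_mxM. Qed.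

Lemma rep_mxV g : rep_mx g *m rep_mx g^-1%g = 1%:M.
Proof. by rewrite -rep_mxM mulgV rep_mx1. Qed.

Lemma chart_im_nbhs (c : chart R F (lie_dim G) G) p :
  chart_dom c p -> nbhs (c p) (chart_im c).
Proof.
by move=> cp; apply: open_nbhs_nbhs; split; [exact: chart_im_open|exists p].
Qed.

Lemma rep_strict_diff : exists2 L : {linear 'rV[R]_D -> 'M[R]_(n + n)},
  forall v, L v = end_mx (differential rho phi (of_real v)) &
  strict_diff (fun z => rep_mx (local_point phi z)) L 0.
Proof.
have [_ _ /(_ phi phi1.1) sm] := rho_rep.
pose f (x : 'rV[K]_(lie_dim G)) := \row_j ecoord j (rho (chart_inv phi x)).
have fE j : (fun x => f x 0 j) = (fun x => ecoord j (rho (chart_inv phi x))).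
  by apply/funext => x; rewrite mxE.
have [|L LE Ls] := smooth_cfun_strict_diff (f := f) (chart_im_nbhs phi1.2).
  by move=> j; rewrite fE; exact: sm.
have [T TE] := @end_mx_linear R V.
exists (T \o L : {linear _ -> _}).
  move=> v; rewrite /= TE LE vec_endP /differential; congr end_mx.
  by apply: eq_bigr => j _; rewrite mxE fE.
have := linear_strict_diff T Ls.
have -> // : T \o (fun z => realify (f (phi 1%g + of_real z))) =
  (fun z => rep_mx (local_point phi z)).
by apply/funext => z; rewrite /= TE -[realify _]/(end_vec _) end_vecK.
Qed.

Variable L : {linear 'rV[R]_D -> 'M[R]_(n + n)}.
Hypothesis Ls : strict_diff (fun z => rep_mx (local_point phi z)) L 0.

(* H (x + z) = H (th z) H x, where th is right translation by the inverse of
   the group element at x, read in the chart. *)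
Lemma rep_frechet : exists2 r : R, 0 < r & forall x, `|x| < r ->
  exists2 Lx : {linear 'rV[R]_D -> 'M[R]_(n + n)},
    frechet (fun z => rep_mx (local_point phi z)) Lx x &
    forall v, exists2 w, range L w & Lx v = w *m rep_mx (local_point phi x).
Proof.
have [r r0 hr] := nbhs_of_real (chart_im_nbhs phi1.2).
exists r => // x /hr [g dg ga].
set a := phi 1%g + of_real x in ga.
have gx : local_point phi x = g by rewrite /local_point -/a -ga chart_mapK.
(* The domain of [phi] need not contain the inverse of [g], so another chart of the atlas is used
   there. *)
have [c2 Ac2 dc2] := atlas_cover (lie_manifold G) (g^-1%g : G).
pose b := c2 g^-1%g.
pose mul_loc (z : 'rV[K]_(lie_dim G + lie_dim G)) : G :=
  (chart_inv phi (lsubmx z) * chart_inv c2 (rsubmx z))%g.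
pose U := [set z | [/\ chart_im phi (lsubmx z), chart_im c2 (rsubmx z)
                   & chart_dom phi (mul_loc z)]].
have sm : smooth_map U (phi \o mul_loc).
  exact: lie_mul_smooth phi1.1 Ac2 phi1.1.
have mul_ab : mul_loc (row_mx a b) = 1%g.
  by rewrite /mul_loc row_mxKl row_mxKr -ga !chart_mapK// mulgV.
have cl : {for row_mx a b, continuous (chart_inv phi \o lsubmx)}.
  apply: continuous_comp; first exact: lsubmx_continuous.
  by rewrite row_mxKl; apply: chart_inv_continuous; exists g.
have cr : {for row_mx a b, continuous (chart_inv c2 \o rsubmx)}.
  apply: continuous_comp; first exact: rsubmx_continuous.
  by rewrite row_mxKr; apply: chart_inv_continuous; exists g^-1%g.
have cm : {for row_mx a b, continuous mul_loc}.
  apply: (@continuous_comp _ _ _ (fun z => (chart_inv phi (lsubmx z), chart_inv c2 (rsubmx z)))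
    (fun q : G * G => (q.1 * q.2)%g)); last exact: lie_mul_continuous.
  exact: cvg_pair cl cr.
have nU : nbhs (row_mx a b) U.
  have n1 : nbhs (row_mx a b) [set z | chart_im phi (lsubmx z)].
    apply: lsubmx_continuous; rewrite row_mxKl -ga.
    exact: chart_im_nbhs.
  have n2 : nbhs (row_mx a b) [set z | chart_im c2 (rsubmx z)].
    apply: rsubmx_continuous; rewrite row_mxKr.
    exact: chart_im_nbhs.
  have n3 : nbhs (row_mx a b) [set z | chart_dom phi (mul_loc z)].
    apply: (cm (chart_dom phi)); rewrite mul_ab.
    by apply: open_nbhs_nbhs; split; [exact: chart_dom_open|exact: phi1.2].
  apply: filterS (filterI n1 (filterI n2 n3)) => z [z1 [z2 z3]].
  by split.
have [M Ms] := smooth_slice_strict_diff nU sm.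
pose th z := to_real (phi (mul_loc (row_mx (a + of_real z) b))).
have th0 : th 0 = to_real (phi 1%g).
  by rewrite /th of_real0 addr0 /= mul_ab.
have hch := strict_diff_chain Ls Ms.
have [d d0 hd] : exists2 d : R, 0 < d & forall z, `|z| < d ->
    rep_mx (local_point phi (x + z)) =
    rep_mx (local_point phi (th z - th 0)) *m rep_mx g.
  have nab : nbhs a [set y | U (row_mx y b)].
    by apply: (@row_mx_continuousl K); exact: nU.
  have [d d0 hd] := nbhs_of_real nab; exists d => // z /hd [_ _ dz].
  have := local_pointE dz; rewrite to_realB -th0 -/(th z) => ->.
  rewrite -rep_mxM; congr rep_mx; rewrite /mul_loc row_mxKl row_mxKr.
  by rewrite chart_mapK// mulgVK /local_point of_realD addrA.
exists (mulmxr (rep_mx g) \o (L \o M) : {linear _ -> _}); last first.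
  by move=> v; exists (L (M v)); [exists (M v)|rewrite gx].
move=> e e0; have [C C0 Cb] := mulmx_bound (n + n) (rep_mx g).
have [d1 d10 hd1] := hch _ (divr_gt0 e0 C0).
exists (Num.min d d1); first by rewrite lt_min d0.
move=> y; rewrite lt_min => /andP[yd yd1].
have := hd1 (y - x); rewrite subr0 => /(_ yd1) h.
have Hy : rep_mx (local_point phi y) =
    rep_mx (local_point phi (th (y - x) - th 0)) *m rep_mx g.
  by rewrite -hd// addrC subrK.
have Hx : rep_mx (local_point phi x) =
    rep_mx (local_point phi (th 0 - th 0)) *m rep_mx g.
  by rewrite -hd ?normr0// addr0.
rewrite Hy Hx /= -!mulmxBl (le_trans (Cb _))// -ler_pdivlMl//.
by rewrite mulrA (mulrC C^-1).
Qed.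

End representation.

(** * Logarithms *)

Section matrix_log.
Variables (R : realType) (N : nat).
Local Notation K0 := (N.+1%:R : R).

Lemma is_cvg_series_geometric_bound (u : nat -> 'M[R]_N) :
  (forall k, `|u k| <= 2^-1 ^+ k) -> cvgn (series u).
Proof.
move=> ub; have h : `|2^-1 : R| < 1 by rewrite ger0_norm; lra.
have /cauchy_cvgP/cauchy_seriesP gc := @is_cvg_geometric_series R 1 _ h.
apply/cauchy_cvgP/cauchy_seriesP => e /gc; apply: filterS => -[p q] /=.
apply: le_lt_trans; rewrite (le_trans (ler_norm_sum _ _ _))//.
rewrite (le_trans _ (ler_norm _))//; apply: ler_sum => k _.
by rewrite /geometric /= mul1r.
Qed.

Lemma scale_mxX (s : R) (x : 'M[R]_N) j : (s *: x) ^+ j = s ^+ j *: x ^+ j.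
Proof.
elim: j => [|j IHj]; first by rewrite !expr0 scale1r.
by rewrite !exprS IHj -!mulmxE -scalemxAl -scalemxAr scalerA.
Qed.

Definition log_coef (k : nat) : R := (-1) ^+ k / k.+1%:R.

Definition log_sum (x : 'M[R]_N) := series (fun k => log_coef k *: x ^+ k.+1).

Lemma log_coef_le1 k : `|log_coef k| <= 1.
Proof.
rewrite normrM normrX normrN1 expr1n mul1r normfV ger0_norm//.
by rewrite invf_le1// ler1n.
Qed.

Lemma is_cvg_log_sum (x : 'M[R]_N) : K0 * `|x| <= 2^-1 -> cvgn (log_sum x).
Proof.
move=> x2; apply: is_cvg_series_geometric_bound => k.
rewrite normrZ (le_trans (ler_piMl _ (log_coef_le1 k)))//.
rewrite (le_trans (norm_mxX _ _))//.
apply: (@le_trans _ _ (2^-1 ^+ k.+1)).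
  by rewrite lerXn2r// nnegrE ?invr_ge0// mulr_ge0.
by rewrite exprS ler_piMl ?exprn_ge0 ?invr_ge0// invf_le1// ler1n.
Qed.

(** The first [p.*2] terms carry the powers 1 to 2p: the even ones cancel and the odd ones
    double. *)
Lemma log_sum_odd (x : 'M[R]_N) p : log_sum x p.*2 - log_sum (- x) p.*2 =
  \sum_(j < p) (2 / j.*2.+1%:R) *: x ^+ j.*2.+1.
Proof.
rewrite /log_sum /series /= !big_mkord -sumrB.
elim: p => [|p IHp]; first by rewrite !big_ord0.
have sg (K : pzRingType) : (-1) ^+ p.*2 = 1 :> K by rewrite -signr_odd odd_double.
have e1 : (- x) ^+ p.*2.+1 = - x ^+ p.*2.+1.
  by rewrite exprNn exprS sg mulr1 mulN1r.
have e2 : (- x) ^+ p.*2.+2 = x ^+ p.*2.+2.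
  by rewrite exprNn !exprS sg mulr1 mulrN1 opprK mul1r.
rewrite doubleS !big_ord_recr /= IHp e1 e2 subrr addr0; congr (_ + _).
by rewrite scalerN opprK -scalerDl /log_coef sg -mulrDl.
Qed.

Lemma log_sum_cvgP (x l : 'M[R]_N) : (log_sum x @ \oo --> l) <->
  forall e : R, 0 < e -> exists M, forall n, (M <= n)%N -> `|log_sum x n - l| <= e.
Proof.
split=> [/cvgrPdist_le h e /h[M _ hM]|h].
  by exists M => n Mn; rewrite distrC; exact: hM.
apply/cvgrPdist_le => e /h[M hM]; exists M => // n /hM.
by rewrite distrC.
Qed.

(* Along even partial sums, log (1 + x) - log (1 - x) has only odd terms. *)
Lemma log_difference_closed (D : nat) (L : {linear 'rV[R]_D -> 'M[R]_N})
    (x l1 l2 : 'M[R]_N) : log_sum x @ \oo --> l1 -> log_sum (- x) @ \oo --> l2 ->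
  (forall j, range L (x ^+ j.*2.+1)) -> range L (l1 - l2).
Proof.
move=> /log_sum_cvgP h1 /log_sum_cvgP h2 Lx; apply: range_closure => e e0.
have e20 : 0 < e / 2 by rewrite divr_gt0.
have [M1 hM1] := h1 _ e20; have [M2 hM2] := h2 _ e20.
pose p := maxn M1 M2.
exists (log_sum x p.*2 - log_sum (- x) p.*2).
  by rewrite log_sum_odd; apply: range_linear_sum => j _; exact: range_linearZ.
have -> : log_sum x p.*2 - log_sum (- x) p.*2 - (l1 - l2) =
   (log_sum x p.*2 - l1) - (log_sum (- x) p.*2 - l2).
  move: (log_sum x _) (log_sum (- x) _) => A B.
  by apply/matrixP => i j; rewrite !mxE; ring.
have pp : (p <= p.*2)%N by rewrite -addnn leq_addr.
rewrite (le_trans (ler_normB _ _))//.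
have := hM1 p.*2 (leq_trans (leq_maxl _ _) pp).
have := hM2 p.*2 (leq_trans (leq_maxr _ _) pp); lra.
Qed.

(** Division by [2 * t] turns the odd series into a power series in [t ^+ 2], the form that
    [expansion_coefficients] expects. *)
Lemma log_difference_expansion (x l1 l2 : 'M[R]_N) (t : R) (m : nat) : 0 < t <= 1 ->
  K0 * `|t *: x| <= 2^-1 ->
  log_sum (t *: x) @ \oo --> l1 -> log_sum (- (t *: x)) @ \oo --> l2 ->
  `|(2 * t)^-1 *: (l1 - l2) -
      \sum_(j < m) (t ^+ 2) ^+ j *: (j.*2.+1%:R^-1 *: x ^+ j.*2.+1)| <=
    (2 * (K0 * `|x|) ^+ m.*2.+1) * (t ^+ 2) ^+ m.
Proof.
move=> /andP[t0 t1] tx /log_sum_cvgP h1 /log_sum_cvgP h2.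
pose a j := (t ^+ 2) ^+ j *: (j.*2.+1%:R^-1 *: x ^+ j.*2.+1).
rewrite -/(\sum_(j < m) a j).
apply/ler_addgt0Pr => e e0.
(* Two errors of size [e * t], multiplied by [(2 * t)^-1], add up to [e]. *)
have et0 : 0 < e * t by rewrite mulr_gt0.
have [M1 hM1] := h1 _ et0; have [M2 hM2] := h2 _ et0.
pose p := maxn m (maxn M1 M2).
have pp : (p <= p.*2)%N by rewrite -addnn leq_addr.
have h3 := hM1 p.*2 (leq_trans (leq_trans (leq_maxl _ _) (leq_maxr _ _)) pp).
have h4 := hM2 p.*2 (leq_trans (leq_trans (leq_maxr _ _) (leq_maxr _ _)) pp).
have sumE : (2 * t)^-1 *: (log_sum (t *: x) p.*2 - log_sum (- (t *: x)) p.*2) =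
    \sum_(j < p) a j.
  rewrite log_sum_odd scaler_sumr; apply: eq_bigr => j _.
  rewrite /a scale_mxX !scalerA; congr (_ *: _).
  rewrite exprS -exprM mul2n.
  have : t != 0 by rewrite gt_eqF.
  have : j.*2.+1%:R != 0 :> R by rewrite pnatr_eq0.
  by move=> j0 t_neq0; field; rewrite t_neq0 nat1r j0.
have mp : (m <= p)%N by exact: leq_maxl.
have tail : `|\sum_(j < p) a j - \sum_(j < m) a j| <=
    2 * (K0 * `|x|) ^+ m.*2.+1 * (t ^+ 2) ^+ m.
  rewrite -(big_mkord xpredT a) -[X in _ - X](big_mkord xpredT a).
  rewrite (big_cat_nat (n := m))//= addrAC subrr add0r.
  rewrite (le_trans (ler_norm_sum _ _ _))// -{1}(add0n m) big_addn.
  rewrite big_mkord.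
  pose c := (K0 * `|x|) ^+ m.*2.+1 * (t ^+ 2) ^+ m.
  have c0 : 0 <= c by rewrite mulr_ge0// exprn_ge0// ?sqr_ge0// mulr_ge0.
  (* The terms decrease at least by the ratio [(K0 * |t x|) ^+ 2 <= 4^-1]; the cruder ratio 1/2
     bounds the tail by [2 * c]. *)
  apply: (@le_trans _ _ (\sum_(j < p - m) c * 2^-1 ^+ j)).
    apply: ler_sum => j _; rewrite /a !normrZ.
    have t20 : 0 <= t ^+ 2 by rewrite sqr_ge0.
    rewrite (ger0_norm (exprn_ge0 _ t20)) [`|_^-1|]ger0_norm ?invr_ge0//.
    have h5 : (j + m).*2.+1%:R^-1 * `|x ^+ (j + m).*2.+1| <= (K0 * `|x|) ^+ (j + m).*2.+1.
      rewrite (le_trans _ (norm_mxX _ _))// ler_piMl// invf_le1// ler1n//.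
    apply: (le_trans (ler_wpM2l (exprn_ge0 _ t20) h5)).
    have -> : (t ^+ 2) ^+ (j + m) * (K0 * `|x|) ^+ (j + m).*2.+1 =
       c * ((K0 * `|t *: x|) ^+ 2) ^+ j.
      rewrite normrZ (gtr0_norm t0) /c doubleD -addnS !exprD -!mul2n !exprM !exprMn.
      by ring.
    rewrite ler_wpM2l// lerXn2r ?nnegrE ?sqr_ge0 ?invr_ge0//.
    apply: (@le_trans _ _ (2^-1 ^+ 2)).
      by rewrite lerXn2r ?nnegrE ?invr_ge0// mulr_ge0.
    by rewrite expr2 ler_piMl ?invr_ge0// invf_le1// ler1n.
  have half k : \sum_(j < k) 2^-1 ^+ j = 2 - 2 * 2^-1 ^+ k :> R.
    elim: k => [|k IHk]; first by rewrite big_ord0 expr0 mulr1 subrr.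
    by rewrite big_ord_recr /= IHk exprS; field.
  rewrite -mulr_sumr half; have -> : 2 * (K0 * `|x|) ^+ m.*2.+1 * (t ^+ 2) ^+ m = c * 2.
    by rewrite /c; ring.
  by rewrite ler_wpM2l// lerBlDr lerDl mulr_ge0// exprn_ge0.
have -> : (2 * t)^-1 *: (l1 - l2) - \sum_(j < m) a j =
   (\sum_(j < p) a j - \sum_(j < m) a j) -
   (2 * t)^-1 *: ((log_sum (t *: x) p.*2 - l1) - (log_sum (- (t *: x)) p.*2 - l2)).
  rewrite -sumE; move: (log_sum _ _) (log_sum _ _) (\sum_(_ < m) _) (2 * t)^-1.
  by move=> A B Sm s; apply/matrixP => i j; rewrite !mxE; ring.
rewrite (le_trans (ler_normB _ _))// lerD// normrZ.
have t20 : 0 < 2 * t by rewrite mulr_gt0.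
rewrite gtr0_norm ?invr_gt0// ler_pdivrMl//.
rewrite (le_trans (ler_normB _ _))//; lra.
Qed.

End matrix_log.

(** * The equivalences *)

Section endomorphism_log.
Variables (R : realType) (V : vectType R[i]).
Local Notation n := (\dim {: 'End(V)}).

Definition endo_log_sum (f : 'End(V)) : nat -> 'End(V) :=
  series (fun k => ((-1) ^+ k / k.+1%:R) *: endo_exp f k.+1).

Lemma end_mx_log_sum f p : end_mx (endo_log_sum f p) = log_sum (end_mx f) p.
Proof.
rewrite /endo_log_sum /log_sum /series /= !big_mkord.
elim: p => [|p IHp].
  rewrite !big_ord0 -[0 in LHS](scale0r (0 : 'End(V))) -[X in X *: _]/(0%:C).
  by rewrite end_mxZ scale0r.
rewrite !big_ord_recr /= end_mxD IHp; congr (_ + _).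
have -> : (-1) ^+ p / p.+1%:R = (log_coef R p)%:C :> R[i].
  by rewrite /log_coef rmorphM rmorphXn rmorphN1 fmorphV rmorph_nat.
by rewrite end_mxZ -end_mxX.
Qed.

Lemma end_vec_bound : exists2 C : R, 0 < C &
  forall f : 'End(V), `|end_vec f| <= C * `|end_mx f|.
Proof.
have K0 : 0 < (n + n)%:R * `|end_vec (\1%VF : 'End(V))| + 1.
  by rewrite ltr_wpDl// mulr_ge0.
exists ((n + n)%:R * `|end_vec (\1%VF : 'End(V))| + 1) => // f.
rewrite -{1}end_mx_vec (le_trans (mx_norm_mul _ _))//.
by rewrite ler_wpM2r// lerDl.
Qed.

Lemma end_mx_bound : exists2 C : R, 0 < C &
  forall f : 'End(V), `|end_mx f| <= C * `|end_vec f|.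
Proof.
have [T TE] := @end_mx_linear R V; have [C C0 CT] := linear_bound T.
by exists C => // f; have := CT (end_vec f); rewrite TE end_vecK.
Qed.

Lemma is_logP (f l : 'End(V)) :
  is_log f l <-> (log_sum (end_mx (f - \1%VF)) @ \oo --> end_mx l).
Proof.
have ecoordE j (h : 'End(V)) : ecoord j h = complexify (end_vec h) 0 j.
  by rewrite /end_vec realifyK mxE.
have ecoordB j (h h' : 'End(V)) : ecoord j h - ecoord j h' = ecoord j (h - h').
  by rewrite /ecoord linearB.
split=> h.
  apply/log_sum_cvgP => e e0; have [C C0 CT] := end_mx_bound.
  have eC0 : 0 < (e / C)%:C by rewrite ltcR divr_gt0.
  have : \forall p \near \oo, forall j,
      `|ecoord j l - ecoord j (endo_log_sum (f - \1%VF) p)| <= (e / C)%:C.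
    apply: (@filter_forall _ _ (fun j p =>
      `|ecoord j l - ecoord j (endo_log_sum (f - \1%VF) p)| <= (e / C)%:C) \oo _) => j.
    exact: ((@cvgrPdist_le _ (R[i]^o) _ _ _ _ _).1 (h j) _ eC0).
  move=> [M _ hM]; exists M => p Mp.
  rewrite -end_mx_log_sum -end_mxB (le_trans (CT _))// mulrC -ler_pdivlMr//.
  apply: realify_le; first by rewrite ltW// divr_gt0.
  by move=> j; rewrite mxE -ecoordB distrC; exact: hM.
move=> j; apply: (@cvgrPdist_le _ (R[i]^o) _ _ _ _ _).2 => e e0.
have er : e = (complex.Re e)%:C by rewrite RRe_real// gtr0_real.
have re0 : 0 < complex.Re e by rewrite -ltcR -er.
have [C C0 CT] := end_vec_bound.
move/log_sum_cvgP : h => /(_ (complex.Re e / (2 * C))).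
move=> /(_ (divr_gt0 re0 (mulr_gt0 (ltr0Sn _ 1) C0)))[M hM].
exists M => // p /hM; rewrite -end_mx_log_sum -end_mxB => hp.
rewrite [X in `|X|]ecoordB -/(endo_log_sum (f - \1%VF)) ecoordE.
rewrite (le_trans (complexify_entry _ _))// er lecR.
have -> : end_vec (l - endo_log_sum (f - \1%VF) p) =
  - end_vec (endo_log_sum (f - \1%VF) p - l).
  by rewrite -opprB -scaleN1r -[-1](rmorphN1 (real_complex R)) end_vecZ scaleN1r.
rewrite normrN; have := CT (endo_log_sum (f - \1%VF) p - l).
rewrite ler_pdivlMr ?mulr_gt0// in hp; lra.
Qed.

(** The series converges among all matrices; its limit comes from an endomorphism because the image
    of [end_mx] is closed. *)
Lemma exists_log (f : 'End(V)) : (n + n).+1%:R * `|end_mx f| <= 2^-1 ->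
  exists l : 'End(V), log_sum (end_mx f) @ \oo --> end_mx l.
Proof.
move=> /is_cvg_log_sum/cvg_ex[l hl].
have [T TE] := @end_mx_linear R V.
suff [y _ yl] : range T l by exists (vec_end y); rewrite -TE yl.
apply: range_closure => e e0.
have /log_sum_cvgP/(_ e e0)[M hM] := hl.
exists (log_sum (end_mx f) M); last exact: hM.
by exists (end_vec (endo_log_sum f M)) => //; rewrite TE end_vecK end_mx_log_sum.
Qed.

End endomorphism_log.

Lemma small_scalar (R : realFieldType) (e d K a b : R) :
  0 < e -> 0 < d -> 0 <= K -> 0 <= a -> 0 <= b ->
  exists t, [/\ 0 < t <= 1, t < e, t * a < d & K * (t * b) <= 2^-1].
Proof.
move=> e0 d0 K0 a0 b0.
have a10 : 0 < a + 1 by rewrite ltr_wpDl.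
have Kb0 : 0 < 2 * (K * b + 1) by rewrite mulr_gt0// ltr_wpDl// mulr_ge0.
pose t := Num.min (Num.min 1 (e / 2)) (Num.min (d / 2 / (a + 1)) (2 * (K * b + 1))^-1).
have t0 : 0 < t by rewrite !lt_min ltr01 invr_gt0 Kb0 !divr_gt0.
exists t; split.
- by rewrite t0 !ge_min lexx.
- have : t <= e / 2 by rewrite !ge_min lexx !orbT.
  lra.
- have : t * (a + 1) <= d / 2 by rewrite -ler_pdivlMr// !ge_min lexx !orbT.
  lra.
have : t * (2 * (K * b + 1)) <= 1 by rewrite -ler_pdivlMr// div1r !ge_min lexx !orbT.
lra.
Qed.

Section equivalences.
Variables (R : realType) (F : base_field) (G : lieGroup R F).
Variables (V : vectType R[i]) (rho : G -> 'End(V)).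
Hypothesis rho_rep : representation rho.
Variable phi : chart R F (lie_dim G) G.
Hypothesis phi1 : chart_at_1 phi.
Local Notation K := (base_type R F).
Local Notation D := (rdim F (lie_dim G)).
Local Notation n := (\dim {: 'End(V)}).
Local Notation H := (fun z => rep_mx rho (local_point phi z)).
Local Notation dg := (range (differential rho phi)).
Local Notation K0 := ((n + n).+1%:R : R).
Variable L : {linear 'rV[R]_D -> 'M[R]_(n + n)}.
Hypothesis LE : forall v, L v = end_mx (differential rho phi (of_real v)).
Hypothesis Ls : strict_diff H L 0.
Variables (k : nat) (B : 'M[R]_(k, D)) (L' : {linear 'rV[R]_k -> 'M[R]_(n + n)}).
Variables (r c C : R).
Hypothesis FC : transversal_chart L (H \o mulmxr B) L' r c C.

Lemma differential_rangeP a : dg a <-> range L (end_mx a).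
Proof.
split=> [[x _ <-]|[v _]].
  by exists (to_real x) => //; rewrite LE to_realK.
by rewrite LE => /end_mx_inj <-; exists (of_real v).
Qed.

Lemma range_end_mx w : range L w -> exists2 a, dg a & w = end_mx a.
Proof.
by move=> [v _ <-]; exists (differential rho phi (of_real v)) => //; exact: LE.
Qed.

Lemma differentialE x : end_mx (differential rho phi x) = L (to_real x).
Proof. by rewrite LE to_realK. Qed.

Lemma power_spanP :
  power_span dg <-> (forall u, range L u -> forall j, range L (u ^+ j.*2.+1)).
Proof.
split=> [h u /range_end_mx[a da ->] j|h a /differential_rangeP da j].
  rewrite -end_mxX; apply/differential_rangeP.
  by have -> : j.*2.+1 = (2 * j + 1)%N; [rewrite addn1 mul2n|exact: h].
by apply/differential_rangeP; rewrite end_mxX addn1 mul2n; exact: h.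
Qed.

Lemma rep_local_point0 : H 0 = 1%:M.
Proof. by rewrite /= local_point0// rep_mx1. Qed.

Lemma cayley_power_span : cayley_representation rho phi -> power_span dg.
Proof.
move=> [N [oN N0 NC]]; apply/power_spanP => _ [v _ <-].
have /nbhs_of_real[d d0 hd] : nbhs (0 : 'rV[K]_(lie_dim G)) N by exact: open_nbhs_nbhs.
(* [s] is chosen so that [rho] maps the chart ball of radius [s] into the image of [F]; the
   translates covering G then give translates of that image covering the image of [rho]. *)
have [s s0 hs] := small_in_chart FC rep_local_point0 Ls (rep_frechet rho_rep phi1 Ls).
have [g hg] := countable_translates phi1 s0.
have v0 : 0 < `|v| + 1 by rewrite ltr_wpDl.
apply: (cayley_curve_powers FC (Gr := range (rep_mx rho))
  (g := fun m => rep_mx rho (g m)) (g' := fun m => rep_mx rho (g m)^-1%g)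
  _ _ (divr_gt0 d0 v0)).
- by move=> m; exact: rep_mxV.
- move=> _ [p _ <-]; have [m [z zs ->]] := hg p; exists m.
  by have [y yr Hz] := hs z zs; exists y => //; rewrite (rep_mxM rho_rep) -Hz.
- move=> t /andP[t0]; rewrite ltr_pdivlMr// => td tu.
  have /hd : `|t *: v| < d.
    by rewrite normrZ gtr0_norm//; apply: le_lt_trans td; rewrite ler_wpM2l ?lerDl// ltW.
  rewrite add0r => /NC[_ [p _ pC]]; exists p => //.
  rewrite /rep_mx pC; have uE : end_mx (differential rho phi (of_real (t *: v))) = t *: L v.
    by rewrite -LE linearZ.
  by rewrite end_mx_cayley uE.
Qed.

Lemma nbhs_differential (e : R) : 0 < e -> exists N : set 'rV[K]_(lie_dim G),
  [/\ open N, N 0 & forall x, N x -> `|end_mx (differential rho phi x)| < e].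
Proof.
move=> e0; have [CL CL0 CLb] := linear_bound L.
exists [set x | `|to_real x| < e / CL]; split.
- rewrite openE => x /= xe.
  have := nbhs_to_real x (_ : 0 < e / CL - `|to_real x|).
  rewrite subr_gt0 => /(_ xe); apply: filterS => y /=; rewrite to_realB => yx.
  rewrite -[to_real y](subrK (to_real x)) (le_lt_trans (ler_normD _ _))//; lra.
- by rewrite /= -[0](of_real0 R F) of_realK normr0 divr_gt0.
move=> x /=; rewrite ltr_pdivlMr// => xe.
by rewrite differentialE (le_lt_trans (CLb _))// mulrC.
Qed.

Lemma power_span_cayley : power_span dg -> cayley_representation rho phi.
Proof.
move=> /power_spanP ps; have [eta eta0 heta] := cayley_in_chart FC.
have [N [oN N0 Ne]] := nbhs_differential eta0.
exists N; split => // x Nx; set a := differential rho phi x.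
have La : range L (end_mx a) by apply/differential_rangeP; exists x.
have [au [z zr hz]] := heta _ (Ne _ Nx) (ps _ La).
split; first by apply/end_mx_invertible; rewrite end_mxB end_mx1.
exists (local_point phi (z *m B)) => //; apply: end_mx_inj.
by rewrite end_mx_cayley// hz.
Qed.

Lemma power_span_log : power_span dg -> log_condition rho phi.
Proof.
move=> /power_spanP ps.
have K2 : 0 < (2 * K0)^-1 by rewrite invr_gt0 mulr_gt0.
have [N [oN N0 Ne]] := nbhs_differential K2.
exists N; split => // x Nx; set a := differential rho phi x.
have La : range L (end_mx a) by apply/differential_rangeP; exists x.
have a2 : K0 * `|end_mx a| <= 2^-1.
  by rewrite mulrC -ler_pdivlMr// -invfM ltW//; exact: Ne.
have [l1 hl1] := exists_log a2.
have [|l2 hl2] := @exists_log _ _ (- a); first by rewrite end_mxN normrN.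
exists l1, l2; split.
- by apply/is_logP; rewrite addrAC subrr add0r.
- by apply/is_logP; rewrite addrAC subrr add0r.
apply/differential_rangeP; rewrite end_mxB end_mxN in hl2 *.
exact: log_difference_closed hl1 hl2 (ps _ La).
Qed.

Lemma log_power_span : log_condition rho phi -> power_span dg.
Proof.
move=> [N [oN N0 Nl]]; apply/power_spanP => _ [v _ <-] j; set u := L v.
have /nbhs_of_real[d d0 hd] : nbhs (0 : 'rV[K]_(lie_dim G)) N by exact: open_nbhs_nbhs.
suff : range L (j.*2.+1%:R^-1 *: u ^+ j.*2.+1).
  move=> /(range_linearZ (j.*2.+1%:R : R)).
  by rewrite scalerA mulfV ?scale1r// pnatr_eq0.
apply: (@expansion_coefficients _ _ _ L (fun j => j.*2.+1%:R^-1 *: u ^+ j.*2.+1)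
  (fun m => 2 * (K0 * `|u|) ^+ m.*2.+1)) => e e0.
have [t [/andP[t0 t1] te tv tu]] :=
  small_scalar e0 d0 (ler0n R (n + n).+1) (normr_ge0 v) (normr_ge0 u).
have tu2 : K0 * `|t *: u| <= 2^-1 by rewrite normrZ gtr0_norm.
have /hd : `|t *: v| < d by rewrite normrZ gtr0_norm.
rewrite add0r => /Nl[l1 [l2 [/is_logP h1 /is_logP h2 /differential_rangeP l12]]].
have uE : end_mx (differential rho phi (of_real (t *: v))) = t *: u.
  by rewrite -LE linearZ.
rewrite addrAC subrr add0r uE in h1.
rewrite addrAC subrr add0r end_mxN uE in h2.
rewrite end_mxB in l12.
exists (t ^+ 2).
  rewrite exprn_gt0//= expr2 (@le_lt_trans _ _ (t * 1)) ?ler_wpM2l ?(ltW t0)//.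
  by rewrite mulr1.
exists ((2 * t)^-1 *: (end_mx l1 - end_mx l2)); first exact: range_linearZ.
by move=> m; apply: log_difference_expansion => //; rewrite t0.
Qed.

(** Stability under Ad(g) for every [g], not only near 1: conjugation is continuous at 1, so it
    keeps small chart points in the ball where [small_in_chart] applies. *)
Lemma differential_conj (g : G) w : range L w ->
  range L (rep_mx rho g *m w *m rep_mx rho g^-1%g).
Proof.
have [s s0 hs] := small_in_chart FC rep_local_point0 Ls (rep_frechet rho_rep phi1 Ls).
apply: (conj_range rep_local_point0 Ls FC); first exact: rep_mxV.
have [d d0 hd] := local_conjugate phi1 g s0; exists d => // x /hd[y ys gy].
have [z zr hz] := hs y ys; exists z => //.
by rewrite -hz -gy !(rep_mxM rho_rep).
Qed.

Lemma differential_bracket a b : range L a -> range L b -> range L (a *m b - b *m a).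
Proof.
apply: (bracket_range rep_local_point0 Ls) => w Lw; exists 1 => // x A' _ HA.
have -> : A' = rep_mx rho (local_point phi x)^-1%g.
  have HV := rep_mxV rho_rep (local_point phi x).
  by rewrite -[RHS]mulmx1 -HA mulmxA (mulmx1C HV) mul1mx.
exact: differential_conj.
Qed.

Lemma power_span_triple : power_span dg ->
  forall a b, dg a -> dg b -> dg (a \o b \o a)%VF.
Proof.
move=> /power_spanP ps a b /differential_rangeP La /differential_rangeP Lb.
apply/differential_rangeP; rewrite !end_mxM.
apply: triple_range => //; first exact: differential_bracket.
by move=> u /ps/(_ 1%N); rewrite !exprS expr0 mulr1 -!mulmxE mulmxA.
Qed.

(** Expand (a + c) b (a + c) and remove the two diagonal terms. *)
Lemma triple_polarization : (forall a b, dg a -> dg b -> dg (a \o b \o a)%VF) ->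
  forall a b c, dg a -> dg b -> dg c -> dg ((a \o b \o c) + (c \o b \o a))%VF.
Proof.
move=> tri a b c' /differential_rangeP La db /differential_rangeP Lc.
have dac : dg (a + c') by apply/differential_rangeP; rewrite end_mxD; exact: range_linearD.
move/differential_rangeP : La => da; move/differential_rangeP : Lc => dc.
have /differential_rangeP h1 := tri _ _ dac db.
have /differential_rangeP h2 := tri _ _ da db.
have /differential_rangeP h3 := tri _ _ dc db.
apply/differential_rangeP.
suff -> : end_mx ((a \o b \o c') + (c' \o b \o a))%VF =
  end_mx ((a + c') \o b \o (a + c'))%VF - end_mx (a \o b \o a)%VF
    - end_mx (c' \o b \o c')%VF.
  by apply: range_linearB => //; exact: range_linearB.
rewrite !comp_lfunDl !comp_lfunDr !end_mxD.
move: (end_mx _) (end_mx _) (end_mx _) (end_mx _) => x y z w.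
by apply/matrixP => i j; rewrite !mxE; ring.
Qed.

(** With both outer arguments equal to u, the hypothesis gives twice u (u^(2j+1)) u = u^(2j+3). *)
Lemma polarization_power_span :
  (forall a b c, dg a -> dg b -> dg c -> dg ((a \o b \o c) + (c \o b \o a))%VF) ->
  power_span dg.
Proof.
move=> pol; apply/power_spanP => u Lu; elim=> [|j IHj]; first by rewrite expr1.
have [a da ua] := range_end_mx Lu; have [b db ub] := range_end_mx IHj.
have /differential_rangeP := pol _ _ _ da db da.
have half (A : 'M[R]_(n + n)) : 2^-1 *: (A + A) = A.
  by apply/matrixP => i j'; rewrite !mxE; field.
rewrite end_mxD !end_mxM -ua -ub => /(range_linearZ (2^-1 : R)); rewrite half.
by have -> : u ^+ j.+1.*2.+1 = u *m u ^+ j.*2.+1 *m u by rewrite doubleS exprSr exprS.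
Qed.

End equivalences.

Theorem theorem4p9 (R : realType) (F : base_field) (G : lieGroup R F)
    (V : vectType R[i]) (rho : G -> 'End(V)) (rho_rep : representation rho)
    (phi : chart R F (lie_dim G) G) (phi1 : chart_at_1 phi) :
  let dg : set 'End(V) := range (differential rho phi) in
  [<-> cayley_representation rho phi;
       log_condition rho phi;
       power_span dg;
       forall a b, dg a -> dg b -> dg (a \o b \o a)%VF;
       forall a b c, dg a -> dg b -> dg c ->
         dg ((a \o b \o c) + (c \o b \o a))%VF].
Proof.
move=> dg; have [L LE Ls] := rep_strict_diff rho_rep phi1.
have Hl := rep_frechet rho_rep phi1 Ls.
have [k [B [L' [r [c [C FC]]]]]] :=
  exists_transversal_chart (rep_local_point0 rho_rep phi1) Ls Hl.
tfae.
(* The first and last implications of the cycle both pass through the power span property. *)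
- by move=> /(cayley_power_span rho_rep phi1 LE Ls FC)/(power_span_log LE).
- exact: log_power_span LE.
- exact: (power_span_triple rho_rep phi1 LE Ls FC).
- exact: triple_polarization LE.
- by move=> /(polarization_power_span LE)/(power_span_cayley LE FC).
Qed.
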